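(* Let $k$ be an algebraically closed field of characteristic $0$ and let $n\ge1$. The virtual class in $K_0(\mathrm{Var}_k)$ of the variety $C_n(\mathrm{GL}_2(k))=\{(A_1,\dots,A_n)\in\mathrm{GL}_2(k)^n\mid A_iA_j=A_jA_i\text{ for all }i,j\}$ of commuting $n$-tuples of elements in $\mathrm{GL}_2(k)$ is $$\frac{1}{2}q(q^2 - 1)\left(2(q^2 - q)^{n-1} - 2(q - 1)^{n-1} + (q-1)(q^2 - 1)^{n-1} + (q - 1)^{2n-1}\right).$$ In particular, the variety of commuting $n$-tuples of elements in $\mathrm{GL}_2(k)$ is of dimension $2n+2$.
   Context: $K_0(\mathrm{Var}_k)$ is the Grothendieck ring of varieties over $k$: the free abelian group on isomorphism classes of varieties modulo $[X]=[U]+[Z]$ for $Z\subseteq X$ closed with open complement $U$, with product induced by the fiber product over $k$. The virtual class of a variety $X$ is $[X]$, and $q=[\mathbb{A}^1]$. The displayed expression is a polynomial in $q$ with integer coefficients and is interpreted as such. *)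

(* Defs.v *)
From HB Require Import structures.
From mathcomp Require Import all_boot all_order all_algebra.
From mathcomp Require Import generic_quotient ring_quotient freeg mpoly.
From mathcomp Require Import mathcomp_extra boolp classical_sets functions.
From mathcomp Require Import topology.

Set Implicit Arguments.
Unset Strict Implicit.
Unset Printing Implicit Defensive.

Import GRing.Theory.

Local Open Scope classical_set_scope.
Local Open Scope ring_scope.
Local Open Scope quotient_scope.

(* A sheaf of k-valued functions on T is given by the functions regular at
   each point: f in O(U) iff [reg x f] for all x in U.  Functions are total;
   [reg_near] and [reg_ext] say that [reg x f] only depends on the germ of f
   at x and is an open condition, so O is a sheaf by construction.  The last
   two axioms are those of a space with functions: D(f) is open and 1/f is
   regular on it. *)
Record is_space (k : fieldType) (T : topologicalType)
    (reg : T -> set (T -> k)) : Prop := IsSpace {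
  reg_near : forall x f, reg x f -> \forall y \near x, reg y f;
  reg_ext : forall x f g,
    (\forall y \near x, f y = g y) -> reg x f -> reg x g;
  reg_cst : forall x c, reg x (fun=> c);
  reg_add : forall x f g, reg x f -> reg x g -> reg x (fun y => f y + g y);
  reg_mul : forall x f g, reg x f -> reg x g -> reg x (fun y => f y * g y);
  reg_inv : forall x f, reg x f -> f x != 0 -> reg x (fun y => (f y)^-1);
  reg_neq0 : forall x f, reg x f -> f x != 0 -> \forall y \near x, f y != 0
}.

Record space (k : fieldType) := Space {
  points :> topologicalType;
  regular_at : points -> set (points -> k);
  space_ax : is_space regular_at
}.

Definition is_morphism (k : fieldType) (X Y : space k) (f : X -> Y) : Prop :=
  continuous f /\
  forall x g, regular_at (f x) g -> regular_at x (fun y => g (f y)).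

Definition isomorphic (k : fieldType) (X Y : space k) : Prop :=
  exists (f : X -> Y) (g : Y -> X),
    [/\ is_morphism f, is_morphism g, cancel f g & cancel g f].

Section Spaces.
Variable k : fieldType.
Implicit Types X Y Z : space k.

Lemma morphism_id X : is_morphism (fun x : X => x).
Proof. by split=> // x; exact: cvg_id. Qed.

Lemma morphism_comp X Y Z (f : X -> Y) (g : Y -> Z) :
  is_morphism f -> is_morphism g -> is_morphism (fun x => g (f x)).
Proof.
move=> [cf rf] [cg rg]; split=> [x|x h /rg /rf //].
by apply: (@continuous_comp _ _ _ f g); [exact: cf|exact: cg].
Qed.

Lemma isomorphic_refl X : isomorphic X X.
Proof. by exists id, id; split=> //; exact: morphism_id. Qed.

Lemma isomorphic_sym X Y : isomorphic X Y -> isomorphic Y X.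
Proof. by move=> [f [g [mf mg fK gK]]]; exists g, f. Qed.

Lemma isomorphic_trans X Y Z :
  isomorphic X Y -> isomorphic Y Z -> isomorphic X Z.
Proof.
move=> [f [g [mf mg fK gK]]] [f' [g' [mf' mg' fK' gK']]].
exists (fun x => f' (f x)), (fun z => g (g' z)); split.
- exact: morphism_comp.
- exact: morphism_comp.
- by move=> x; rewrite fK' fK.
- by move=> x; rewrite gK gK'.
Qed.

Lemma reg_opp X (x : X) f : regular_at x f -> regular_at x (fun y => - f y).
Proof.
move=> rf; have := reg_mul (space_ax X) (reg_cst (space_ax X) x (-1)) rf.
by apply: (reg_ext (space_ax X)); apply: nearW => y; rewrite mulN1r.
Qed.

Lemma reg_div X (x : X) f g : regular_at x f -> regular_at x g -> g x != 0 ->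
  regular_at x (fun y => f y / g y).
Proof.
move=> rf rg g0; apply: (reg_mul (space_ax X)) => //.
exact: (reg_inv (space_ax X)).
Qed.

Lemma reg_sum X (x : X) (I : Type) (s : seq I) (F : I -> X -> k) :
  (forall i, regular_at x (F i)) -> regular_at x (fun y => \sum_(i <- s) F i y).
Proof.
move=> rF; have sX := space_ax X; elim: s => [|i s IH].
  apply: (reg_ext sX) (reg_cst sX x 0).
  by apply: filterE => y; rewrite big_nil.
apply: (reg_ext sX) (reg_add sX (rF i) IH).
by apply: filterE => y; rewrite big_cons.
Qed.

Lemma reg_prod X (x : X) (I : Type) (s : seq I) (F : I -> X -> k) :
  (forall i, regular_at x (F i)) -> regular_at x (fun y => \prod_(i <- s) F i y).
Proof.
move=> rF; have sX := space_ax X; elim: s => [|i s IH].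
  apply: (reg_ext sX) (reg_cst sX x 1).
  by apply: filterE => y; rewrite big_nil.
apply: (reg_ext sX) (reg_mul sX (rF i) IH).
by apply: filterE => y; rewrite big_cons.
Qed.

Lemma reg_exp X (x : X) f m :
  regular_at x f -> regular_at x (fun y => f y ^+ m).
Proof.
move=> rf; have sX := space_ax X; elim: m => [|m IH].
  exact: (reg_cst sX).
apply: (reg_ext sX) (reg_mul sX rf IH).
by apply: filterE => y; rewrite exprS.
Qed.

Lemma regular_zeros_closed X (f : X -> k) :
  (forall x, regular_at x f) -> closed [set x | f x = 0].
Proof.
move=> rf; rewrite -openC openE => x /= /eqP fx0.
apply: filterS (reg_neq0 (space_ax X) (rf x) fx0) => y /eqP.
by [].
Qed.

(* The coarsest structure of space with functions making i a morphism: for an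
   inclusion this is the induced structure on a subset, for a bijection it is
   transport of structure. *)
Section Initial.
Variables (T : choiceType) (X : space k) (i : T -> X).

Definition initial_regular_at (x : initial_topology i) :
    set (initial_topology i -> k) :=
  [set f | exists2 g, regular_at (i x) g & \forall y \near x, f y = g (i y)].

Let icont (x : initial_topology i) (P : set X) :
  (\forall y \near i x, P y) -> \forall y \near x, P (i y).
Proof. by move=> nP; exact: (@initial_continuous T X i x). Qed.

Lemma initial_is_space : is_space initial_regular_at.
Proof.
have sX := space_ax X; split.
- move=> x f [g rg fg]; have nf := nbhs_interior fg.
  have /icont rn := reg_near sX rg.
  by apply: filterS2 nf rn => y fgy rgy; exists g.
- move=> x f g fg [h rh fh]; exists h => //.
  by apply: filterS2 fg fh => y <-.
- by move=> x c; exists (fun=> c); [exact: (reg_cst sX)|exact: filterE].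
- move=> x f g [f' rf ff'] [g' rg gg'].
  exists (fun y => f' y + g' y); first exact: (reg_add sX).
  by apply: filterS2 ff' gg' => y -> ->.
- move=> x f g [f' rf ff'] [g' rg gg'].
  exists (fun y => f' y * g' y); first exact: (reg_mul sX).
  by apply: filterS2 ff' gg' => y -> ->.
- move=> x f [g rg fg] fx0; exists (fun y => (g y)^-1).
    by apply: (reg_inv sX) => //; rewrite -(nbhs_singleton fg).
  by apply: filterS fg => y ->.
- move=> x f [g rg fg]; rewrite (nbhs_singleton fg) => g0.
  have /icont gn := reg_neq0 sX rg g0.
  by apply: filterS2 fg gn => y ->.
Qed.

Definition initial_space : space k := Space initial_is_space.

Lemma initial_morphism : is_morphism (i : initial_space -> X).
Proof.
split=> [|x g rg]; first exact: initial_continuous.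
by exists g => //; exact: filterE.
Qed.

Lemma initial_morphismP Y (h : Y -> initial_space) :
  is_morphism (fun y => i (h y)) -> is_morphism h.
Proof.
move=> [cih rih]; have ch : continuous h.
  exact: (@continuous_comp_initial T Y X i h cih).
split=> // y f [g rg fg].
apply: (reg_ext (space_ax Y)) (rih y g rg).
have nfg : \forall z \near y, f (h z) = g (i (h z)) := ch y _ fg.
by apply: filterS nfg => z ->.
Qed.

End Initial.

Definition sub_space X (S : set X) : space k :=
  @initial_space (S : choiceType) X val.

End Spaces.

(* The product in the category of spaces with functions (its universal property
   is [prod_space_fst], [prod_space_snd], [prod_space_pair]); not the product
   topology.  [prod_fun z] is the algebra generated by the functions pulled
   back from the factors, i.e. the sums of a_i(x) b_i(y) with a_i regular at
   z.1 and b_i regular at z.2; basic opens are the sets h != 0 in U x V. *)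
Section Product.
Variables (k : fieldType) (X Y : space k).

Definition prod_points : Type := (X * Y)%type.
HB.instance Definition _ := Choice.on prod_points.

Inductive prod_fun (z : X * Y) : set (X * Y -> k) :=
| prod_fun_fst f of regular_at z.1 f : prod_fun z (fun w => f w.1)
| prod_fun_snd f of regular_at z.2 f : prod_fun z (fun w => f w.2)
| prod_fun_add f g of prod_fun z f & prod_fun z g :
    prod_fun z (fun w => f w + g w)
| prod_fun_mul f g of prod_fun z f & prod_fun z g :
    prod_fun z (fun w => f w * g w).

Definition prod_nbhs (z : prod_points) : set_system prod_points :=
  [set A | exists U V h, [/\ nbhs z.1 U, nbhs z.2 V, prod_fun z h, h z != 0 &
    forall w, U w.1 -> V w.2 -> h w != 0 -> A w]].

HB.instance Definition _ := hasNbhs.Build prod_points prod_nbhs.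

Lemma prod_fun_cst z c : prod_fun z (fun=> c).
Proof. exact: (prod_fun_fst (reg_cst (space_ax X) z.1 c)). Qed.

Lemma prod_fun_near z h : prod_fun z h ->
  exists U V, [/\ nbhs z.1 U, nbhs z.2 V &
    forall w, U w.1 -> V w.2 -> prod_fun w h].
Proof.
elim=> {h} [f rf|f rf|f g _ [U [V [nU nV H]]] _ [U' [V' [nU' nV' H']]]
                     |f g _ [U [V [nU nV H]]] _ [U' [V' [nU' nV' H']]]].
- exists [set x | regular_at x f], setT; split=> [||w rw _].
  + exact: reg_near (space_ax X) _ _ rf.
  + exact: filterT.
  + exact: prod_fun_fst.
- exists setT, [set x | regular_at x f]; split=> [||w _ rw].
  + exact: filterT.
  + exact: reg_near (space_ax Y) _ _ rf.
  + exact: prod_fun_snd.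
- exists (U `&` U'), (V `&` V'); split; [exact: filterI|exact: filterI|].
  by move=> w [? ?] [? ?]; apply: prod_fun_add; [exact: H|exact: H'].
- exists (U `&` U'), (V `&` V'); split; [exact: filterI|exact: filterI|].
  by move=> w [? ?] [? ?]; apply: prod_fun_mul; [exact: H|exact: H'].
Qed.

Let prod_nbhs_filter (z : prod_points) : ProperFilter (nbhs z).
Proof.
apply: Build_ProperFilter_ex.
  move=> A [U [V [h [nU nV _ h0 H]]]]; exists z.
  by apply: H; [exact: nbhs_singleton nU|exact: nbhs_singleton nV|].
split.
- exists setT, setT, (fun=> 1); split=> //; try exact: filterT.
  + exact: prod_fun_cst.
  + exact: oner_neq0.
- move=> A B [U [V [h [nU nV ph h0 H]]]] [U' [V' [h' [nU' nV' ph' h0' H']]]].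
  exists (U `&` U'), (V `&` V'), (fun w => h w * h' w); split.
  + exact: filterI.
  + exact: filterI.
  + exact: prod_fun_mul.
  + by rewrite mulf_neq0.
  + move=> w [? ?] [? ?]; rewrite mulf_eq0 => /norP[? ?].
    by split; [exact: H|exact: H'].
- move=> A B AB [U [V [h [nU nV ph h0 H]]]]; exists U, V, h; split=> // w *.
  by apply: AB; exact: H.
Qed.

Let prod_nbhs_singleton (z : prod_points) (A : set prod_points) :
  nbhs z A -> A z.
Proof.
move=> [U [V [h [nU nV _ h0 H]]]].
by apply: H; [exact: nbhs_singleton nU|exact: nbhs_singleton nV|].
Qed.

Let prod_nbhs_nbhs (z : prod_points) (A : set prod_points) :
  nbhs z A -> nbhs z (nbhs^~ A).
Proof.
move=> [U [V [h [/nbhs_interior nU /nbhs_interior nV ph h0 H]]]].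
have [U' [V' [nU' nV' ph']]] := prod_fun_near ph.
exists (U^° `&` U'), (V^° `&` V'), h; split=> //; try exact: filterI.
move=> w [Uw U'w] [Vw V'w] hw; exists U, V, h; split=> //; exact: ph'.
Qed.

HB.instance Definition _ := Nbhs_isNbhsTopological.Build prod_points
  prod_nbhs_filter prod_nbhs_singleton prod_nbhs_nbhs.

Definition prod_regular_at (z : prod_points) : set (prod_points -> k) :=
  [set f | exists g h, [/\ prod_fun z g, prod_fun z h, h z != 0 &
    \forall w \near z, f w = g w / h w]].

Let prod_near (z : prod_points) U V (P : set prod_points) :
  nbhs z.1 U -> nbhs z.2 V -> (forall w, U w.1 -> V w.2 -> P w) -> nbhs z P.
Proof.
move=> nU nV H; exists U, V, (fun=> 1); split=> //.
- exact: prod_fun_cst.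
- exact: oner_neq0.
- by move=> w ? ? _; exact: H.
Qed.

Let prod_neq0 (z : prod_points) h :
  prod_fun z h -> h z != 0 -> \forall w \near z, h w != 0.
Proof.
by move=> ph h0; exists setT, setT, h; split=> //; exact: filterT.
Qed.

Lemma prod_is_space : is_space prod_regular_at.
Proof.
split.
- move=> z f [g [h [pg ph h0 fgh]]].
  have nf := nbhs_interior fgh; have nh := prod_neq0 ph h0.
  have [U [V [nU nV Hg]]] := prod_fun_near pg.
  have [U' [V' [nU' nV' Hh]]] := prod_fun_near ph.
  have ng := prod_near nU nV Hg; have nhh := prod_near nU' nV' Hh.
  apply: filterS2 (filterI nf nh) (filterI ng nhh) => w [fw hw] [gw hhw].
  by exists g, h; split.
- move=> z f f' ff' [g [h [pg ph h0 fgh]]]; exists g, h; split=> //.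
  by apply: filterS2 ff' fgh => w <-.
- move=> z c; exists (fun=> c), (fun=> 1); split; try exact: prod_fun_cst.
  + exact: oner_neq0.
  + by apply: filterE => w; rewrite divr1.
- move=> z f f' [g [h [pg ph h0 fgh]]] [g' [h' [pg' ph' h0' fgh']]].
  exists (fun w => g w * h' w + g' w * h w), (fun w => h w * h' w); split.
  + by apply: prod_fun_add; exact: prod_fun_mul.
  + exact: prod_fun_mul.
  + by rewrite mulf_neq0.
  + apply: filterS2 (filterI fgh fgh')
      (filterI (prod_neq0 ph h0) (prod_neq0 ph' h0')) => w [-> ->] [hw hw'].
    by rewrite addf_div.
- move=> z f f' [g [h [pg ph h0 fgh]]] [g' [h' [pg' ph' h0' fgh']]].
  exists (fun w => g w * g' w), (fun w => h w * h' w); split.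
  + exact: prod_fun_mul.
  + exact: prod_fun_mul.
  + by rewrite mulf_neq0.
  + by apply: filterS2 fgh fgh' => w -> ->; rewrite mulf_div.
- move=> z f [g [h [pg ph h0 fgh]]] fz; exists h, g; split=> //.
  + by move: fz; rewrite (nbhs_singleton fgh) mulf_eq0 => /norP[].
  + by apply: filterS fgh => w ->; rewrite invf_div.
- move=> z f [g [h [pg ph h0 fgh]]] fz.
  have g0 : g z != 0.
    by move: fz; rewrite (nbhs_singleton fgh) mulf_eq0 => /norP[].
  apply: filterS2 fgh (filterI (prod_neq0 ph h0) (prod_neq0 pg g0)).
  by move=> w -> [hw gw]; rewrite mulf_neq0// invr_neq0.
Qed.

Definition prod_space : space k := Space prod_is_space.

Lemma prod_space_fst : is_morphism (fst : prod_space -> X).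
Proof.
split=> [z A nA|z f rf].
  by apply: prod_near nA filterT _ => w.
exists (fun w => f w.1), (fun=> 1); split.
- exact: prod_fun_fst.
- exact: prod_fun_cst.
- exact: oner_neq0.
- by apply: filterE => w; rewrite divr1.
Qed.

Lemma prod_space_snd : is_morphism (snd : prod_space -> Y).
Proof.
split=> [z A nA|z f rf].
  by apply: prod_near filterT nA _ => w.
exists (fun w => f w.2), (fun=> 1); split.
- exact: prod_fun_snd.
- exact: prod_fun_cst.
- exact: oner_neq0.
- by apply: filterE => w; rewrite divr1.
Qed.

Lemma prod_space_pair (Z : space k) (f : Z -> X) (g : Z -> Y) :
  is_morphism f -> is_morphism g -> is_morphism (fun z => (f z, g z) : prod_space).
Proof.
move=> [cf rf] [cg rg].
have rh z h : prod_fun (f z, g z) h -> regular_at z (fun w => h (f w, g w)).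
  elim=> {h} [h /rf //|h /rg //|h h' _ + _|h h' _ + _].
  - exact: (reg_add (space_ax Z)).
  - exact: (reg_mul (space_ax Z)).
have cp : continuous (fun z => (f z, g z) : prod_space).
  move=> z A [U [V [h [nU nV /rh ph h0 H]]]].
  have nh := reg_neq0 (space_ax Z) ph h0.
  have nU' : \forall w \near z, U (f w) := cf z U nU.
  have nV' : \forall w \near z, V (g w) := cg z V nV.
  by apply: filterS3 nU' nV' nh => w *; exact: H.
split=> // z F [a [b [/rh pa /rh pb b0 fab]]].
apply: (reg_ext (space_ax Z)) (reg_div pa pb b0).
have nF : \forall w \near z, F (f w, g w) = a (f w, g w) / b (f w, g w) :=
  cp z _ fab.
by apply: filterS nF => w ->.
Qed.

End Product.

Section Affine.
Variables (k : fieldType) (n : nat).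

Definition affine_points : Type := 'rV[k]_n.
HB.instance Definition _ := Choice.on affine_points.

Definition zeros (P : set {mpoly k[n]}) : set affine_points :=
  [set x | forall p, P p -> p.@[x 0] = 0].

Definition zariski_open : set_system affine_points :=
  [set U | exists P, U = ~` zeros P].

Let zariski_openT : zariski_open setT.
Proof.
exists [set 1]; apply/seteqP; split=> // x _ /(_ 1 erefl)/eqP.
by rewrite meval1 oner_eq0.
Qed.

Let zariski_openI : setI_closed zariski_open.
Proof.
move=> _ _ [P ->] [Q ->].
exists [set r | exists p q, [/\ P p, Q q & r = p * q]].
rewrite -setCU; congr (~` _); apply/seteqP; split=> x.
  move=> [H|H] _ [p [q [Pp Qq ->]]]; rewrite mevalM.
    by rewrite (H p Pp) mul0r.
  by rewrite (H q Qq) mulr0.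
move=> H; have [Px|/existsNP[p /not_implyP[Pp p0]]] := pselect (zeros P x).
  by left.
right=> q Qq; have /eqP := H (p * q) (ex_intro _ p (ex_intro _ q (And3 Pp Qq erefl))).
by rewrite mevalM mulf_eq0 => /orP[/eqP//|/eqP].
Qed.

Let zariski_open_bigU (I : Type) (f : I -> set affine_points) :
  (forall i, zariski_open (f i)) -> zariski_open (\bigcup_i f i).
Proof.
move=> /choice[P fP]; exists (\bigcup_i P i).
apply/seteqP; split=> x.
  by move=> [i _]; rewrite fP => + H; apply=> p Pp; apply: H; exists i.
move=> H; apply: contrapT => H'; apply: H => p [i _ Pp].
apply: contrapT => p0; apply: H'; exists i => //; rewrite fP => /(_ p Pp).
exact: p0.
Qed.

HB.instance Definition _ := isOpenTopological.Build affine_points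
  zariski_openT zariski_openI zariski_open_bigU.

Lemma zeros_closed P : closed (zeros P).
Proof. by rewrite -openC; exists P. Qed.

Lemma mpoly_near_neq0 (x : affine_points) (p : {mpoly k[n]}) :
  p.@[x 0] != 0 -> \forall y \near x, p.@[(y : 'rV[k]_n) 0] != 0.
Proof.
move=> p0; exists (~` zeros [set p]); split=> [|H|y /= H].
- by exists [set p].
- by move: p0; rewrite (H p)// eqxx.
- by apply: contra_notN H => /eqP y0 _ ->.
Qed.

Lemma affine_nbhsP (x : affine_points) (A : set affine_points) : nbhs x A ->
  exists2 p : {mpoly k[n]}, p.@[x 0] != 0 &
    forall y : affine_points, p.@[y 0] != 0 -> A y.
Proof.
move=> [_ [[P ->] Px PA]].
move/existsNP : Px => [p /not_implyP[Pp /eqP p0]]; exists p => // y y0.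
by apply: PA => /(_ p Pp) /eqP; apply/negP.
Qed.

Definition affine_regular_at (x : affine_points) : set (affine_points -> k) :=
  [set f | exists g h : {mpoly k[n]}, h.@[x 0] != 0 /\
    \forall y \near x, f y = g.@[(y : 'rV[k]_n) 0] / h.@[(y : 'rV[k]_n) 0]].

Lemma affine_is_space : is_space affine_regular_at.
Proof.
split.
- move=> x f [g [h [h0 /nbhs_interior fgh]]].
  by apply: filterS2 fgh (mpoly_near_neq0 h0) => y fy hy; exists g, h.
- move=> x f f' ff' [g [h [h0 fgh]]]; exists g, h; split=> //.
  by apply: filterS2 ff' fgh => y <-.
- move=> x c; exists c%:MP, 1; rewrite meval1 oner_neq0; split=> //.
  by apply: filterE => y; rewrite meval1 mevalC divr1.
- move=> x f f' [g [h [h0 fgh]]] [g' [h' [h0' fgh']]].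
  exists (g * h' + g' * h), (h * h'); split; first by rewrite mevalM mulf_neq0.
  apply: filterS2 (filterI fgh fgh')
    (filterI (mpoly_near_neq0 h0) (mpoly_near_neq0 h0')) => y [-> ->] [hy hy'].
  by rewrite mevalD !mevalM addf_div.
- move=> x f f' [g [h [h0 fgh]]] [g' [h' [h0' fgh']]].
  exists (g * g'), (h * h'); split; first by rewrite mevalM mulf_neq0.
  by apply: filterS2 fgh fgh' => y -> ->; rewrite !mevalM mulf_div.
- move=> x f [g [h [h0 fgh]]] fx; exists h, g; split.
    by move: fx; rewrite (nbhs_singleton fgh) mulf_eq0 => /norP[].
  by apply: filterS fgh => y ->; rewrite invf_div.
- move=> x f [g [h [h0 fgh]]] fx.
  have g0 : g.@[x 0] != 0.
    by move: fx; rewrite (nbhs_singleton fgh) mulf_eq0 => /norP[].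
  apply: filterS3 fgh (mpoly_near_neq0 g0) (mpoly_near_neq0 h0) => y -> gy hy.
  by rewrite mulf_neq0// invr_neq0.
Qed.

Definition affine_space : space k := Space affine_is_space.

Lemma affine_reg_mpoly (p : {mpoly k[n]}) (x : affine_space) :
  regular_at x (fun y => p.@[(y : 'rV[k]_n) 0]).
Proof.
exists p, 1; rewrite meval1 oner_neq0; split=> //.
by apply: filterE => y; rewrite meval1 divr1.
Qed.

Lemma affine_reg_coord i (x : affine_space) :
  regular_at x (fun y => (y : 'rV[k]_n) 0 i).
Proof.
apply: (reg_ext (space_ax affine_space)) (affine_reg_mpoly 'X_i x).
by apply: filterE => y; rewrite mevalXU.
Qed.

Lemma reg_mpoly (X : space k) (h : X -> 'rV[k]_n) (x : X) :
  (forall i, regular_at x (fun y => h y 0 i)) ->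
  forall p : {mpoly k[n]}, regular_at x (fun y => p.@[h y 0]).
Proof.
have sX := space_ax X.
move=> rh p; apply: (reg_ext sX (f := fun y =>
    \sum_(m <- msupp p) p@_m * \prod_i h y 0 i ^+ m i)).
  by apply: filterE => y; rewrite mevalE.
apply: reg_sum => m; apply: (reg_mul sX); first exact: (reg_cst sX).
by apply: reg_prod => i; exact: reg_exp.
Qed.

Lemma affine_morphism (X : space k) (h : X -> affine_space) :
  (forall i x, regular_at x (fun y => (h y : 'rV[k]_n) 0 i)) -> is_morphism h.
Proof.
move=> rh; have sX := space_ax X.
have rp x p : regular_at x (fun y => p.@[(h y : 'rV[k]_n) 0]).
  by apply: reg_mpoly => i; exact: rh.
have ch : continuous h.
  move=> x A /affine_nbhsP[p p0 pA].
  by apply: filterS (reg_neq0 sX (rp x p) p0) => y; exact: pA.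
split=> // x f [g [h' [h0 fgh]]].
apply: (reg_ext sX) (reg_div (rp x g) (rp x h') h0).
have nf : \forall y \near x,
  f (h y) = g.@[(h y : 'rV[k]_n) 0] / h'.@[(h y : 'rV[k]_n) 0] := ch x _ fgh.
by apply: filterS nf => y ->.
Qed.

End Affine.

(* Closed algebraic subsets of affine space, with the induced structure. *)
Definition is_affine (k : fieldType) (X : space k) : Prop :=
  exists (n : nat) (P : set {mpoly k[n]}),
    isomorphic X (@sub_space k (affine_space k n) (zeros P)).

Definition is_separated (k : fieldType) (X : space k) : Prop :=
  closed [set z : prod_space X X | z.1 = z.2].

(* Varieties in the sense of Serre: spaces with functions that are covered by
   finitely many affine open subspaces and are separated; not necessarily
   irreducible.  Over an algebraically closed field these are the reduced
   separated schemes of finite type, and [prod_space] is the fibre product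
   over k. *)
Definition is_variety (k : fieldType) (X : space k) : Prop :=
  (exists (I : finType) (U : I -> set X),
    (forall i, open (U i) /\ is_affine (sub_space (U i))) /\
    \bigcup_i U i = setT) /\
  is_separated X.

Section Subspaces.
Variable k : fieldType.
Implicit Types X Y Z W : space k.

Lemma sub_space_val X (S : set X) : is_morphism (val : sub_space S -> X).
Proof. exact: initial_morphism. Qed.

Definition to_sub_space X Y (S : set X) (f : Y -> X) (fS : forall y, S (f y)) :
  Y -> sub_space S := fun y => exist _ (f y) (mem_set (fS y)).

Lemma to_sub_space_morphism X Y (S : set X) (f : Y -> X)
    (fS : forall y, S (f y)) : is_morphism f -> is_morphism (to_sub_space fS).
Proof. by move=> mf; exact: initial_morphismP. Qed.

Lemma sub_spaceP X (S : set X) (x : sub_space S) : S (val x).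
Proof. by case: x => x xS; exact: set_mem. Qed.

Lemma sub_space_inj X (S : set X) : injective (val : sub_space S -> X).
Proof. by move=> [x ?] [y ?] /= xy; exact: eq_sig_hprop. Qed.

Lemma isomorphic_sub_space X Y (S : set X) (T : set Y) (f : X -> Y) (g : Y -> X) :
  is_morphism f -> is_morphism g ->
  (forall x, S x -> T (f x)) -> (forall y, T y -> S (g y)) ->
  (forall x, S x -> g (f x) = x) -> (forall y, T y -> f (g y) = y) ->
  isomorphic (sub_space S) (sub_space T).
Proof.
move=> mf mg fST gTS fK gK.
have fS (x : sub_space S) : T (f (val x)) by exact: fST _ (sub_spaceP _).
have gT (y : sub_space T) : S (g (val y)) by exact: gTS _ (sub_spaceP _).
exists (to_sub_space fS), (to_sub_space gT); split.
- apply: to_sub_space_morphism; apply: morphism_comp mf; exact: sub_space_val.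
- apply: to_sub_space_morphism; apply: morphism_comp mg; exact: sub_space_val.
- by move=> x; apply: sub_space_inj; rewrite /= fK//; exact: sub_spaceP.
- by move=> x; apply: sub_space_inj; rewrite /= gK//; exact: sub_spaceP.
Qed.

Lemma isomorphic_setT X : isomorphic X (sub_space [set: X]).
Proof.
exists (@to_sub_space X X setT (fun x => x) (fun=> I)), val; split.
- by apply: to_sub_space_morphism; exact: morphism_id.
- exact: sub_space_val.
- by [].
- by move=> x; apply: sub_space_inj.
Qed.

Lemma prod_map_morphism X Y Z W (f : X -> Z) (g : Y -> W) :
  is_morphism f -> is_morphism g ->
  is_morphism (fun z : prod_space X Y => (f z.1, g z.2) : prod_space Z W).
Proof.
move=> mf mg; apply: prod_space_pair.
  by apply: morphism_comp mf; exact: prod_space_fst.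
by apply: morphism_comp mg; exact: prod_space_snd.
Qed.

Lemma prod_isomorphic X Y Z W :
  isomorphic X Z -> isomorphic Y W ->
  isomorphic (prod_space X Y) (prod_space Z W).
Proof.
move=> [f [g [mf mg fK gK]]] [f' [g' [mf' mg' fK' gK']]].
exists (fun z => (f z.1, f' z.2)), (fun z => (g z.1, g' z.2)); split.
- exact: prod_map_morphism.
- exact: prod_map_morphism.
- by case=> x y /=; rewrite fK fK'.
- by case=> x y /=; rewrite gK gK'.
Qed.

Lemma prod_isomorphicC X Y : isomorphic (prod_space X Y) (prod_space Y X).
Proof.
exists (fun z => (z.2, z.1)), (fun z => (z.2, z.1)); split.
- by apply: prod_space_pair; [exact: prod_space_snd|exact: prod_space_fst].
- by apply: prod_space_pair; [exact: prod_space_snd|exact: prod_space_fst].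
- by case.
- by case.
Qed.

Lemma prod_isomorphicA X Y Z :
  isomorphic (prod_space X (prod_space Y Z)) (prod_space (prod_space X Y) Z).
Proof.
exists (fun z => ((z.1, z.2.1), z.2.2)), (fun z => (z.1.1, (z.1.2, z.2))).
split=> [||[x [y z]]//|[[x y] z]//].
- have m1 := @prod_space_fst k X (prod_space Y Z).
  have m2 := @prod_space_snd k X (prod_space Y Z).
  have m21 := morphism_comp m2 (@prod_space_fst k Y Z).
  have m22 := morphism_comp m2 (@prod_space_snd k Y Z).
  exact: (prod_space_pair (prod_space_pair m1 m21) m22).
- have m1 := @prod_space_fst k (prod_space X Y) Z.
  have m2 := @prod_space_snd k (prod_space X Y) Z.
  have m11 := morphism_comp m1 (@prod_space_fst k X Y).
  have m12 := morphism_comp m1 (@prod_space_snd k X Y).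
  exact: (prod_space_pair m11 (prod_space_pair m12 m2)).
Qed.

Lemma prod_isomorphic1 X : isomorphic (prod_space (affine_space k 0) X) X.
Proof.
exists snd, (fun x => ((0 : 'rV[k]_0) : affine_space k 0, x)); split=> //.
- exact: prod_space_snd.
- apply: prod_space_pair; last exact: morphism_id.
  by apply: affine_morphism => -[].
- by case=> o x /=; congr (_, _); apply/rowP => -[].
Qed.

Lemma prod_sub_space X Y (S : set X) (T : set Y) :
  isomorphic (prod_space (sub_space S) (sub_space T))
    (sub_space ([set z | S z.1 /\ T z.2] : set (prod_space X Y))).
Proof.
pose f (z : prod_space (sub_space S) (sub_space T)) : prod_space X Y :=
  (val z.1, val z.2).
have fST z : S (f z).1 /\ T (f z).2 by split; exact: sub_spaceP.
pose R : set (prod_space X Y) := [set z | S z.1 /\ T z.2].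
rewrite -/R.
have gS (z : sub_space R) : S (val z : prod_space X Y).1.
  by have [] := sub_spaceP z.
have gT (z : sub_space R) : T (val z : prod_space X Y).2.
  by have [] := sub_spaceP z.
exists (to_sub_space fST), (fun z => (to_sub_space gS z, to_sub_space gT z)).
split.
- apply: to_sub_space_morphism.
  exact: (prod_map_morphism (@sub_space_val X S) (@sub_space_val Y T)).
- apply: prod_space_pair; apply: to_sub_space_morphism.
    by apply: morphism_comp (@prod_space_fst _ X Y); exact: sub_space_val.
  by apply: morphism_comp (@prod_space_snd _ X Y); exact: sub_space_val.
- by case=> x y; congr pair; apply: sub_space_inj; exact: erefl.
- by move=> z; apply: sub_space_inj; exact: (esym (surjective_pairing (val z : X * Y))).
Qed.

Lemma prod_sub_space_fst X Y (S : set X) :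
  isomorphic (prod_space (sub_space S) Y)
    (sub_space ([set z | S z.1] : set (prod_space X Y))).
Proof.
apply: (isomorphic_trans
  (prod_isomorphic (isomorphic_refl _) (isomorphic_setT Y))).
have -> : [set z | S z.1] = [set z | S z.1 /\ setT z.2] :> set (prod_space X Y).
  by apply/seteqP; split=> z //= [].
exact: prod_sub_space.
Qed.

Lemma morphism_open X Y (f : X -> Y) (U : set Y) :
  is_morphism f -> open U -> open (f @^-1` U).
Proof. by move=> [cf _]; exact: open_comp. Qed.

Lemma morphism_closed X Y (f : X -> Y) (U : set Y) :
  is_morphism f -> closed U -> closed (f @^-1` U).
Proof. by move=> [cf _] cU; apply: closed_comp cU => x _; exact: cf. Qed.

Lemma separated_inj X Y (i : X -> Y) :
  is_morphism i -> injective i -> is_separated Y -> is_separated X.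
Proof.
move=> mi inji sY; rewrite /is_separated.
have -> : [set z : prod_space X X | z.1 = z.2] =
    (fun z : prod_space X X => (i z.1, i z.2) : prod_space Y Y) @^-1`
      [set z : prod_space Y Y | z.1 = z.2].
  by apply/seteqP; split=> -[x y] /=; [move=> ->|move/inji].
by apply: morphism_closed sY; exact: prod_map_morphism.
Qed.

Lemma affine_space_separated n : is_separated (affine_space k n).
Proof.
rewrite /is_separated.
pose d i (z : prod_space (affine_space k n) (affine_space k n)) :=
  (z.1 : 'rV[k]_n) 0 i + - (z.2 : 'rV[k]_n) 0 i.
have -> : [set z : prod_space (affine_space k n) (affine_space k n) | z.1 = z.2]
    = \bigcap_i [set z | d i z = 0].
  apply/seteqP; split=> [[x y] /= -> i _|[x y] /= xy].
    by rewrite /d /= subrr.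
  apply/rowP => i; have /= := xy i I.
  by rewrite /d /= => /eqP; rewrite subr_eq0 => /eqP.
apply: closed_bigI => i _; apply: regular_zeros_closed => z.
apply: (reg_add (space_ax _)); last apply: reg_opp.
  have [_ H] := @prod_space_fst k (affine_space k n) (affine_space k n).
  exact: (H z _ (affine_reg_coord i z.1)).
have [_ H] := @prod_space_snd k (affine_space k n) (affine_space k n).
exact: (H z _ (affine_reg_coord i z.2)).
Qed.

Lemma separated_prod X Y :
  is_separated X -> is_separated Y -> is_separated (prod_space X Y).
Proof.
move=> sX sY; rewrite /is_separated; set P := prod_space X Y.
have m1 := @prod_space_fst k P P; have m2 := @prod_space_snd k P P.
have mX := prod_space_pair (morphism_comp m1 (@prod_space_fst k X Y))
  (morphism_comp m2 (@prod_space_fst k X Y)).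
have mY := prod_space_pair (morphism_comp m1 (@prod_space_snd k X Y))
  (morphism_comp m2 (@prod_space_snd k X Y)).
have := closedI (morphism_closed mX sX) (morphism_closed mY sY).
congr closed; apply/seteqP; split=> -[[x y] [x' y']] /=.
  by move=> [/= -> ->].
by move=> [-> ->].
Qed.

Lemma is_affine_iso X Y : isomorphic X Y -> is_affine X -> is_affine Y.
Proof.
move=> XY [n [P XP]]; exists n, P; apply: isomorphic_trans XP.
exact: isomorphic_sym.
Qed.

Lemma is_affine_separated X : is_affine X -> is_separated X.
Proof.
move=> [n [P [f [g [mf mg fK _]]]]].
apply: (@separated_inj X (affine_space k n) (fun x => val (f x))).
- by apply: morphism_comp mf _; exact: sub_space_val.
- by move=> x y /sub_space_inj /(can_inj fK).
- exact: affine_space_separated.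
Qed.

Lemma is_affine_variety X : is_affine X -> is_variety X.
Proof.
move=> aX; split; last exact: is_affine_separated.
exists unit, (fun=> setT); split=> [_|].
  split; first exact: openT.
  by apply: is_affine_iso aX; exact: isomorphic_setT.
by apply/seteqP; split=> // x _; exists tt.
Qed.

Lemma zeros_comp n m (t : n.-tuple {mpoly k[m]}) (P : set {mpoly k[n]})
    (x : 'rV[k]_m) :
  zeros [set q | exists2 p, P p & q = p \mPo t] x <->
  zeros P (\row_i (tnth t i).@[x 0]).
Proof.
have E (p : {mpoly k[n]}) :
    (p \mPo t).@[x 0] = p.@[(\row_i (tnth t i).@[x 0]) 0].
  rewrite comp_mpoly_meval; apply: meval_eq => i.
  by rewrite mxE.
split=> [H p Pp|H _ [p Pp ->]].
  by apply: etrans (esym (E p)) (H _ _); exists p.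
exact: etrans (E p) (H p Pp).
Qed.

Lemma zerosU n (P Q : set {mpoly k[n]}) (x : 'rV[k]_n) :
  zeros (P `|` Q) x <-> zeros P x /\ zeros Q x.
Proof.
split=> [H|[HP HQ] p []]; last 2 first.
- exact: HP.
- exact: HQ.
by split=> p ?; apply: H; [left|right].
Qed.

Lemma is_affine_prod X Y :
  is_affine X -> is_affine Y -> is_affine (prod_space X Y).
Proof.
move=> [n [P XP]] [m [Q YQ]].
apply: is_affine_iso (isomorphic_sym (prod_isomorphic XP YQ)) _.
apply: is_affine_iso (isomorphic_sym (prod_sub_space _ _)) _.
pose tl := [tuple 'X_(lshift m i) : {mpoly k[n + m]} | i < n].
pose tr := [tuple 'X_(rshift n i) : {mpoly k[n + m]} | i < m].
exists (n + m)%N, ([set q | exists2 p, P p & q = p \mPo tl] `|`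
  [set q | exists2 p, Q p & q = p \mPo tr]).
have El (w : 'rV[k]_(n + m)) : \row_i (tnth tl i).@[w 0] = lsubmx w.
  by apply/rowP => i; rewrite !mxE tnth_mktuple mevalXU.
have Er (w : 'rV[k]_(n + m)) : \row_i (tnth tr i).@[w 0] = rsubmx w.
  by apply/rowP => i; rewrite !mxE tnth_mktuple mevalXU.
pose f (z : prod_space (affine_space k n) (affine_space k m)) :
  affine_space k (n + m) := row_mx (z.1 : 'rV[k]_n) (z.2 : 'rV[k]_m).
pose g (w : affine_space k (n + m)) :
  prod_space (affine_space k n) (affine_space k m) :=
  (lsubmx (w : 'rV[k]_(n + m)), rsubmx (w : 'rV[k]_(n + m))).
apply: (@isomorphic_sub_space _ _ _ _ f g).
- apply: affine_morphism => i z; case: (splitP i) => j ij.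
    have -> : i = lshift m j by exact: val_inj.
    have [_ H] := @prod_space_fst k (affine_space k n) (affine_space k m).
    apply: (reg_ext (space_ax _)) (H z _ (affine_reg_coord j z.1)).
    by apply: filterE => y; rewrite row_mxEl.
  have -> : i = rshift n j by exact: val_inj.
  have [_ H] := @prod_space_snd k (affine_space k n) (affine_space k m).
  apply: (reg_ext (space_ax _)) (H z _ (affine_reg_coord j z.2)).
  by apply: filterE => y; rewrite row_mxEr.
- apply: prod_space_pair; apply: affine_morphism => i z.
    apply: (reg_ext (space_ax _)) (affine_reg_coord (lshift m i) z).
    by apply: filterE => y; rewrite mxE.
  apply: (reg_ext (space_ax _)) (affine_reg_coord (rshift n i) z).
  by apply: filterE => y; rewrite mxE.
- move=> [x y] /= [Px Qy]; apply/zerosU.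
  by split; apply/zeros_comp; rewrite (El, Er) /f /= (row_mxKl, row_mxKr).
- by move=> w /zerosU[/zeros_comp + /zeros_comp]; rewrite El Er.
- by move=> [x y] _; rewrite /g /f /= row_mxKl row_mxKr.
- by move=> w _; rewrite /f /= hsubmxK.
Qed.

Lemma is_variety_prod X Y :
  is_variety X -> is_variety Y -> is_variety (prod_space X Y).
Proof.
move=> [[I [U [oU cU]]] sX] [[J [V [oV cV]]] sY].
split; last exact: separated_prod.
exists (I * J)%type, (fun ij => [set z | U ij.1 z.1 /\ V ij.2 z.2]); split.
  move=> [i j] /=; have [oUi aUi] := oU i; have [oVj aVj] := oV j; split.
    exact: (openI (morphism_open (@prod_space_fst k X Y) oUi)
      (morphism_open (@prod_space_snd k X Y) oVj)).
  exact: is_affine_iso (prod_sub_space _ _) (is_affine_prod aUi aVj).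
apply/seteqP; split=> // -[x y] _.
have : setT x by []; rewrite -cU => -[i _ Ux].
have : setT y by []; rewrite -cV => -[j _ Vy].
by exists (i, j).
Qed.

Lemma is_variety_iso X Y : isomorphic X Y -> is_variety X -> is_variety Y.
Proof.
move=> [f [g [mf mg fK gK]]] [[I [U [oU cU]]] sX]; split; last first.
  exact: separated_inj mg (can_inj gK) sX.
exists I, (fun i => g @^-1` U i); split=> [i|].
  have [oUi aUi] := oU i; split; first exact: morphism_open.
  apply: is_affine_iso aUi.
  apply: (isomorphic_sub_space mf mg) => //.
  by move=> x; rewrite /= fK.
by apply/seteqP; split=> // y _; have : setT (g y) by []; rewrite -cU.
Qed.

End Subspaces.

Record variety (k : closedFieldType) := Variety {
  variety_space :> space k;
  variety_ax : is_variety variety_space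
}.

Definition prod_variety (k : closedFieldType) (X Y : variety k) : variety k :=
  Variety (is_variety_prod (variety_ax X) (variety_ax Y)).

Definition affine_variety (k : closedFieldType) (X : space k)
  (aX : is_affine X) : variety k := Variety (is_affine_variety aX).

Section IsoClasses.
Variable k : closedFieldType.

(* Varieties form a large type, so isomorphism classes are taken among the
   varieties whose points lie in [nat * seq k]; by [small_model] every variety
   is isomorphic to one of those (send a point to the index of a chart
   containing it and its coordinates in that chart). *)
Record small_variety := SmallVariety {
  small_points : set (nat * seq k);
  small_topology : Topological.axioms_ (set_type small_points);
  small_regular_at : Topological.Pack small_topology ->
    set (Topological.Pack small_topology -> k);
  small_space_ax : is_space small_regular_at;
  small_variety_ax : is_variety (Space small_space_ax)
}.

Definition variety_of_small (s : small_variety) : variety k :=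
  Variety (small_variety_ax s).

HB.instance Definition _ := gen_eqMixin small_variety.
HB.instance Definition _ := gen_choiceMixin small_variety.

Lemma small_model (X : variety k) :
  exists s : small_variety, isomorphic X (variety_of_small s).
Proof.
have [[I [U [/all_and2[_ aU] cU]]] _] := variety_ax X.
have /choice[e inj_e] : forall i, exists e : X -> seq k,
    forall x y, U i x -> U i y -> e x = e y -> x = y.
  move=> i; have [n [P [f [g [_ _ fK _]]]]] := aU i.
  pose c (y : sub_space (U i)) := [seq (val (f y) : 'rV[k]_n) 0 j | j : 'I_n].
  exists (fun x => if pselect (U i x) is left Ux
    then c (exist _ x (mem_set Ux)) else [::]).
  move=> x y Ux Uy.
  case: pselect => [{}Ux|/(_ Ux)//]; case: pselect => [{}Uy|/(_ Uy)//].
  move=> /eq_in_map E.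
  have /(can_inj fK)/(congr1 val)// : f (exist _ x (mem_set Ux)) =
    f (exist _ y (mem_set Uy)).
  apply: sub_space_inj; apply/rowP => j; apply: E.
  by rewrite mem_enum.
have /choice[ix Uix] : forall x : X, exists i, U i x.
  by move=> x; have : setT x by []; rewrite -cU => -[i _ Ux]; exists i.
pose emb (x : X) := (nat_of_ord (enum_rank (ix x)), e (ix x) x).
have emb_inj : injective emb.
  move=> x y [/ord_inj/enum_rank_inj xy]; rewrite -xy => exy.
  by apply: (inj_e (ix x)) exy => //; rewrite xy.
pose S : set (nat * seq k) := range emb.
have /choice[inv invK] : forall s : S, exists x, emb x = val s.
  by move=> [s sS]; have [x _ xs] := set_mem sS; exists x.
pose Y := @initial_space k (S : choiceType) X inv.
have embS x : S (emb x) by exists x.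
pose f (x : X) : S := exist _ (emb x) (mem_set (embS x)).
have invf x : inv (f x) = x by apply: emb_inj; rewrite invK.
have finv s : f (inv s) = s by apply: val_inj; rewrite /= invK.
have iXY : isomorphic X Y.
  exists f, inv; split=> //; last exact: initial_morphism.
  apply: initial_morphismP; have -> : (fun y => inv (f y)) = id.
    exact/funext.
  exact: morphism_id.
have vY := is_variety_iso iXY (variety_ax X).
by exists (@SmallVariety S (Topological.class Y) (@regular_at k Y) (space_ax Y) vY).
Qed.

Definition iso_rel (s t : small_variety) : bool :=
  `[< isomorphic (variety_of_small s) (variety_of_small t) >].

Lemma iso_rel_equiv : equiv_class_of iso_rel.
Proof.
split=> [s|s t|t s u].
- by apply/asboolP; exact: isomorphic_refl.
- by apply/asboolP/asboolP; exact: isomorphic_sym.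
- move=> /asboolP st /asboolP tu; apply/asboolP.
  exact: isomorphic_trans st tu.
Qed.

Canonical iso_rel_equiv_rel := EquivRelPack iso_rel_equiv.
Canonical iso_rel_encModRel := defaultEncModRel iso_rel.

Definition iso_class : Type := {eq_quot iso_rel}.
HB.instance Definition _ := Choice.on iso_class.
HB.instance Definition _ : EqQuotient small_variety iso_rel iso_class :=
  EqQuotient.on iso_class.

Definition iso_class_of (X : variety k) : iso_class :=
  \pi_iso_class (projT1 (cid (small_model X))).

Definition variety_of (c : iso_class) : variety k := variety_of_small (repr c).

Lemma iso_class_ofP X Y : iso_class_of X = iso_class_of Y <-> isomorphic X Y.
Proof.
rewrite /iso_class_of; case: cid => s Xs; case: cid => t Yt /=.
split=> [/eqmodP/asboolP st|XY].
  exact: isomorphic_trans Xs (isomorphic_trans st (isomorphic_sym Yt)).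
apply/eqmodP/asboolP.
exact: isomorphic_trans (isomorphic_sym Xs) (isomorphic_trans XY Yt).
Qed.

Lemma variety_ofK c : iso_class_of (variety_of c) = c.
Proof.
rewrite -[RHS]reprK /iso_class_of /variety_of; case: cid => s cs /=.
by apply/eqmodP/asboolP; exact: isomorphic_sym.
Qed.

Lemma variety_of_iso X : isomorphic (variety_of (iso_class_of X)) X.
Proof. by apply/iso_class_ofP; rewrite variety_ofK. Qed.

Definition class_mul (c d : iso_class) : iso_class :=
  iso_class_of (prod_variety (variety_of c) (variety_of d)).

Lemma class_mulE X Y :
  class_mul (iso_class_of X) (iso_class_of Y) = iso_class_of (prod_variety X Y).
Proof.
by apply/iso_class_ofP; apply: prod_isomorphic; exact: variety_of_iso.
Qed.

Lemma affine_space_affine n : is_affine (affine_space k n).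
Proof.
exists n, set0; have -> : zeros set0 = setT :> set (affine_space k n).
  by apply/seteqP; split=> // x _ p.
exact: isomorphic_setT.
Qed.

Definition affine_space_variety n : variety k :=
  affine_variety (affine_space_affine n).

Definition class_one : iso_class := iso_class_of (affine_space_variety 0).

Lemma class_mulC : commutative class_mul.
Proof. by move=> c d; apply/iso_class_ofP; exact: prod_isomorphicC. Qed.

Lemma class_mulA : associative class_mul.
Proof.
move=> c d e; rewrite -(variety_ofK c) -(variety_ofK d) -(variety_ofK e).
by rewrite !class_mulE; apply/iso_class_ofP; exact: prod_isomorphicA.
Qed.

Lemma class_mul1 : left_id class_one class_mul.
Proof.
move=> c; rewrite -(variety_ofK c) class_mulE; apply/iso_class_ofP.
exact: prod_isomorphic1.
Qed.

Local Notation F := {freeg iso_class / int}.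

Definition free_mul (a b : F) : F :=
  fglift (fun c => fglift (fun d => << class_mul c d >> : F) b) a.

Lemma free_ind (P : F -> Prop) :
  (forall x y, P x -> P y -> P (x - y)) -> (forall c, P << c >>) ->
  forall x, P x.
Proof.
move=> PB P1.
have P0 : P 0 by rewrite -(subrr << class_one >>); exact: PB.
have PD x y : P x -> P y -> P (x + y).
  by move=> Px Py; rewrite -[y]opprK -[- y]sub0r; apply: (PB) => //; exact: PB.
move=> x; rewrite -[x]freeg_sumE; elim/big_rec : _ => // c y _ Py.
apply: (PD) => //; have Pn m : P << m%:Z *g c >>.
  rewrite -[m%:Z]natz -freegU_muln; elim: m => [|m IH]; first by rewrite mulr0n.
  by rewrite mulrS; exact: PD.
case: (coeff c x) => m; first exact: Pn.
by rewrite NegzE -freegUN -sub0r; exact: PB.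
Qed.

Lemma free_mulU c d : free_mul << c >> << d >> = << class_mul c d >>.
Proof. by rewrite /free_mul !liftU !scale1r. Qed.

Lemma free_mulBl a a' b : free_mul (a - a') b = free_mul a b - free_mul a' b.
Proof. exact: lift_is_additive. Qed.

Lemma free_mulDl a a' b : free_mul (a + a') b = free_mul a b + free_mul a' b.
Proof.
have E0 : free_mul 0 b = 0.
  by rewrite -[X in free_mul X](subrr 0) free_mulBl subrr.
have E c : free_mul (- c) b = - free_mul c b.
  by rewrite -[- c]sub0r free_mulBl E0 sub0r.
by rewrite -[a' in LHS]opprK free_mulBl E opprK.
Qed.

Lemma free_mulC a b : free_mul a b = free_mul b a.
Proof.
have E a' b' b'' : (forall d, free_mul << d >> (b' - b'') =
    free_mul << d >> b' - free_mul << d >> b'') ->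
  free_mul a' (b' - b'') = free_mul a' b' - free_mul a' b''.
  move=> H; elim/free_ind : a' => // x y xE yE.
  by rewrite !free_mulBl xE yE opprD addrACA -opprD.
have free_mulBr x y z : free_mul x (y - z) = free_mul x y - free_mul x z.
  by apply: E => d; rewrite /free_mul !liftU !scale1r lift_is_additive.
elim/free_ind : a b => [x y xE yE b|c].
  by rewrite free_mulBl free_mulBr xE yE.
elim/free_ind => [x y xE yE|d]; first by rewrite free_mulBl free_mulBr xE yE.
by rewrite !free_mulU class_mulC.
Qed.

Lemma free_mulBr a b b' : free_mul a (b - b') = free_mul a b - free_mul a b'.
Proof. by rewrite free_mulC free_mulBl !(free_mulC a). Qed.

Lemma free_mulA a b c : free_mul a (free_mul b c) = free_mul (free_mul a b) c.
Proof.
elim/free_ind : a b c => [x y xE yE b c|a].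
  by rewrite !free_mulBl xE yE.
elim/free_ind => [x y xE yE c|b].
  by rewrite !(free_mulBl, free_mulBr) xE yE.
elim/free_ind => [x y xE yE|c]; first by rewrite !free_mulBr xE yE.
by rewrite !free_mulU class_mulA.
Qed.

Lemma free_mul1 a : free_mul << class_one >> a = a.
Proof.
elim/free_ind : a => [x y xE yE|c]; first by rewrite free_mulBr xE yE.
by rewrite free_mulU class_mul1.
Qed.

Definition scissor : set F :=
  [set r | exists (X U Z : variety k) (A : set X),
    [/\ closed A, isomorphic Z (sub_space A), isomorphic U (sub_space (~` A)) &
      r = << iso_class_of X >> - << iso_class_of U >> - << iso_class_of Z >>]].

(* The subgroup generated by the relations. *)
Definition scissor_span : set F :=
  [set r | forall H : set F, H 0 -> (forall a b, H a -> H b -> H (a - b)) ->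
    scissor `<=` H -> H r].

Definition scissor_pred : {pred F} := [pred r | `[< scissor_span r >]].

Lemma scissor_pred_zmod : zmod_closed scissor_pred.
Proof.
split=> [|a b /asboolP Ha /asboolP Hb]; apply/asboolP => H H0 HB HS //.
by apply: (HB); [exact: Ha|exact: Hb].
Qed.
HB.instance Definition _ :=
  GRing.isZmodClosed.Build F scissor_pred scissor_pred_zmod.

Lemma scissor_mul a b : scissor a -> scissor (free_mul a << b >>).
Proof.
move=> [X [U [Z [A [cA ZA UA ->]]]]]; pose Y := variety_of b.
exists (prod_variety X Y), (prod_variety U Y), (prod_variety Z Y).
exists [set z | A z.1]; split.
- exact: morphism_closed (@prod_space_fst k X Y) cA.
- exact: isomorphic_trans (prod_isomorphic ZA (isomorphic_refl Y))
    (prod_sub_space_fst Y A).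
- exact: isomorphic_trans (prod_isomorphic UA (isomorphic_refl Y))
    (prod_sub_space_fst Y (~` A)).
- by rewrite !free_mulBl !free_mulU -!class_mulE variety_ofK.
Qed.

Lemma scissor_span_ideal a b : scissor_span a -> scissor_span (free_mul a b).
Proof.
move=> Ha; apply: (Ha (fun a => scissor_span (free_mul a b))).
- by move=> H H0 HB HS; rewrite -(subrr 0) free_mulBl subrr.
- move=> x y Hx Hy H H0 HB HS; rewrite free_mulBl.
  by apply: (HB); [exact: Hx|exact: Hy].
- move=> x Sx; elim/free_ind : b => [y z Hy Hz|c] H H0 HB HS.
    by rewrite free_mulBr; apply: (HB); [exact: Hy|exact: Hz].
  by apply: HS; exact: scissor_mul.
Qed.

Definition K0 : Type := {ideal_quot scissor_pred}.
HB.instance Definition _ := GRing.Zmodule.on K0.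

Definition K0_of (a : F) : K0 := \pi a.

Lemma K0_ofP a b : K0_of a = K0_of b <-> scissor_span (a - b).
Proof.
rewrite /K0_of; split.
  by move/eqP; rewrite -Quotient.idealrBE => /asboolP.
by move=> H; apply/eqP; rewrite -Quotient.idealrBE; apply/asboolP.
Qed.

Lemma K0_ofK (x : K0) : K0_of (repr x) = x.
Proof. exact: reprK. Qed.

Lemma K0_ofD a b : K0_of (a + b) = K0_of a + K0_of b.
Proof. exact: Quotient.pi_add. Qed.

Definition K0_mul (x y : K0) : K0 := K0_of (free_mul (repr x) (repr y)).
Definition K0_one : K0 := K0_of << class_one >>.

Lemma K0_mulE a b : K0_mul (K0_of a) (K0_of b) = K0_of (free_mul a b).
Proof.
apply/K0_ofP; set a' := repr _; set b' := repr _.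
have aa : scissor_span (a' - a) by apply/K0_ofP; exact: K0_ofK.
have bb : scissor_span (b' - b) by apply/K0_ofP; exact: K0_ofK.
have -> : free_mul a' b' - free_mul a b =
    free_mul (a' - a) b' - (0 - free_mul (b' - b) a).
  rewrite sub0r opprK !free_mulBl (free_mulC b' a) (free_mulC b a).
  by rewrite addrA subrK.
have ha := @scissor_span_ideal _ b' aa; have hb := @scissor_span_ideal _ a bb.
move=> H H0 HB HS; apply: (HB); first exact: ha.
by apply: (HB) => //; exact: hb.
Qed.

Lemma K0_mulA : associative K0_mul.
Proof.
move=> x y z; rewrite -(K0_ofK x) -(K0_ofK y) -(K0_ofK z).
by rewrite !K0_mulE free_mulA.
Qed.

Lemma K0_mulC : commutative K0_mul.
Proof.
by move=> x y; rewrite -(K0_ofK x) -(K0_ofK y) !K0_mulE free_mulC.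
Qed.

Lemma K0_mul1 : left_id K0_one K0_mul.
Proof. by move=> x; rewrite -(K0_ofK x) K0_mulE free_mul1. Qed.

Lemma K0_mulD : left_distributive K0_mul +%R.
Proof.
move=> x y z; rewrite -(K0_ofK x) -(K0_ofK y) -(K0_ofK z).
rewrite -K0_ofD !K0_mulE -K0_ofD; congr K0_of.
exact: free_mulDl.
Qed.

HB.instance Definition _ := GRing.Zmodule_isComPzRing.Build K0
  K0_mulA K0_mulC K0_mul1 K0_mulD.

Definition virtual_class (X : variety k) : K0 := K0_of << iso_class_of X >>.

End IsoClasses.

Section VirtualClasses.
Variable k : closedFieldType.
Implicit Types X Y U Z : variety k.

Lemma virtual_class_iso X Y :
  isomorphic X Y -> virtual_class X = virtual_class Y.
Proof. by move=> /iso_class_ofP XY; rewrite /virtual_class XY. Qed.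

Lemma virtual_class_scissor X U Z (A : set X) : closed A ->
  isomorphic Z (sub_space A) -> isomorphic U (sub_space (~` A)) ->
  virtual_class X = virtual_class U + virtual_class Z.
Proof.
move=> cA ZA UA; rewrite /virtual_class -K0_ofD; apply/K0_ofP => H _ _; apply.
by exists X, U, Z, A; split=> //; rewrite opprD addrA.
Qed.

Lemma virtual_class_prod X Y :
  virtual_class (prod_variety X Y) = virtual_class X * virtual_class Y.
Proof.
by rewrite [RHS]K0_mulE free_mulU class_mulE.
Qed.

Lemma virtual_class_point : virtual_class (affine_space_variety k 0) = 1.
Proof. by []. Qed.

End VirtualClasses.

Definition lefschetz (k : closedFieldType) : K0 k :=
  virtual_class (affine_space_variety k 1).

(* [horner] needs a nontrivial ring, and 1 != 0 in [K0 k] is not proved here. *)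
Definition int_poly_eval (R : pzRingType) (P : {poly int}) (x : R) : R :=
  \sum_(i < size P) (P`_i)%:~R * x ^+ i.

Definition irreducible_set (T : topologicalType) (S : set T) : Prop :=
  S !=set0 /\ forall A B, closed A -> closed B ->
    S `<=` A `|` B -> S `<=` A \/ S `<=` B.

Definition irreducible_chain (T : topologicalType) (m : nat)
    (Z : nat -> set T) : Prop :=
  (forall i, (i <= m)%N -> closed (Z i) /\ irreducible_set (Z i)) /\
  (forall i, (i < m)%N -> Z i `<` Z i.+1).

(* Krull dimension. *)
Definition has_dimension (T : topologicalType) (d : nat) : Prop :=
  (exists Z : nat -> set T, irreducible_chain d Z) /\
  (forall m (Z : nat -> set T), irreducible_chain m Z -> (m <= d)%N).

Lemma is_affine_principal (k : fieldType) n (P : set {mpoly k[n]})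
    (f : {mpoly k[n]}) :
  is_affine (sub_space ([set x | zeros P x /\ f.@[x 0] != 0] :
    set (affine_space k n))).
Proof.
set S : set (affine_space k n) := [set x | _].
pose tl := [tuple 'X_(lshift 1 i) : {mpoly k[n + 1]} | i < n].
pose fl := (f \mPo tl) * 'X_(rshift n ord0) - 1.
pose R := [set q | exists2 p, P p & q = p \mPo tl] `|` [set fl].
exists (n + 1)%N, R.
have El (w : 'rV[k]_(n + 1)) : \row_i (tnth tl i).@[w 0] = lsubmx w.
  by apply/rowP => i; rewrite !mxE tnth_mktuple mevalXU.
have Ef (w : 'rV[k]_(n + 1)) : fl.@[w 0] = f.@[lsubmx w 0] * rsubmx w 0 0 - 1.
  rewrite mevalB mevalM meval1 mevalXU comp_mpoly_meval mxE; congr (_ * _ - _).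
  by apply: meval_eq => i; rewrite -El mxE.
have RP (w : 'rV[k]_(n + 1)) :
    zeros R w <-> zeros P (lsubmx w) /\ f.@[lsubmx w 0] * rsubmx w 0 0 = 1.
  split=> [/zerosU[/zeros_comp + /(_ fl erefl)/eqP]|[Pw fw]].
    by rewrite El Ef subr_eq0 => ? /eqP.
  apply/zerosU; split; first by apply/zeros_comp; rewrite El.
  by move=> _ ->; apply: etrans (Ef w) _; rewrite fw subrr.
pose v (x : sub_space S) : 'rV[k]_n := val x.
have vS x : zeros P (v x) /\ f.@[v x 0] != 0 by exact: (sub_spaceP x).
pose h (x : sub_space S) : affine_space k (n + 1) :=
  row_mx (v x) (const_mx (f.@[v x 0])^-1).
have hR x : zeros R (h x).
  have [Px fx] := vS x; apply/RP; rewrite /h row_mxKl row_mxKr mxE.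
  by split=> //; rewrite divff.
pose u (w : sub_space (zeros R : set (affine_space k (n + 1)))) :
  'rV[k]_(n + 1) := val w.
pose g w : affine_space k n := lsubmx (u w).
have uR w : zeros R (u w) by exact: (sub_spaceP w).
have gS w : S (g w).
  have [Pw fw] := (RP _).1 (uR w); split=> //.
  by apply/eqP => f0; move/eqP: fw; rewrite f0 mul0r eq_sym oner_eq0.
have sS := space_ax (sub_space S).
have [_ rv] := @sub_space_val _ (affine_space k n) S.
have [_ ru] := @sub_space_val _ (affine_space k (n + 1)) (zeros R).
exists (to_sub_space hR), (to_sub_space gS); split.
- apply: to_sub_space_morphism; apply: affine_morphism => i x.
  case: (splitP i) => j ij.
    have -> : i = lshift 1 j by exact: val_inj.
    apply: (reg_ext sS) (rv x _ (affine_reg_coord j (v x))).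
    by apply: filterE => y; rewrite row_mxEl.
  have -> : i = rshift n j by exact: val_inj.
  apply: (reg_ext sS) (reg_inv sS (rv x _ (affine_reg_mpoly f (v x))) _).
    by apply: filterE => y; rewrite row_mxEr mxE.
  by have [] := vS x.
- apply: to_sub_space_morphism; apply: affine_morphism => i w.
  apply: (reg_ext (space_ax _)) (ru w _ (affine_reg_coord (lshift 1 i) (u w))).
  by apply: filterE => y; rewrite mxE.
- move=> x; apply: sub_space_inj; exact: (row_mxKl (v x) _).
- move=> w; apply: sub_space_inj.
  have [_ fw] := (RP _).1 (uR w).
  rewrite -[RHS]/(u w) -[RHS]hsubmxK; congr row_mx.
  apply/rowP => j; rewrite ord1 mxE.
  have f0 : f.@[lsubmx (u w) 0] != 0 by have [] := gS w.
  by apply: (mulfI f0); rewrite fw divff.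
Qed.

Section Commuting.
Variables (k : closedFieldType) (n : nat).

(* Affine space of dimension n * (2 * 2) is identified with n-tuples of 2 x 2
   matrices; [tuple_mx v i] is the i-th matrix. *)
Definition tuple_mx (v : 'rV[k]_(n * (2 * 2))) (i : 'I_n) : 'M[k]_2 :=
  vec_mx (row i (vec_mx v)).

Definition commuting_GL2 : set (affine_space k (n * (2 * 2))) :=
  [set v | (forall i, tuple_mx v i \in unitmx) /\
    (forall i j, tuple_mx v i *m tuple_mx v j = tuple_mx v j *m tuple_mx v i)].

Lemma commuting_GL2_affine : is_affine (sub_space commuting_GL2).
Proof.
pose G i : 'M[{mpoly k[n * (2 * 2)]}]_2 :=
  \matrix_(a, b) 'X_(mxvec_index i (mxvec_index a b)).
have GE (v : 'rV[k]_(n * (2 * 2))) i : map_mx (meval (v 0)) (G i) = tuple_mx v i.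
  by apply/matrixP => a b; rewrite !mxE mevalXU.
pose P := [set p | exists i j a b, p = (G i *m G j - G j *m G i) a b].
pose f := \prod_i \det (G i).
have -> : commuting_GL2 = [set x | zeros P x /\ f.@[x 0] != 0].
  have fE (v : 'rV[k]_(n * (2 * 2))) : f.@[v 0] = \prod_i \det (tuple_mx v i).
    by rewrite rmorph_prod; apply: eq_bigr => i _; rewrite -det_map_mx GE.
  have PE (v : 'rV[k]_(n * (2 * 2))) i j a b :
      ((G i *m G j - G j *m G i) a b).@[v 0] =
      (tuple_mx v i *m tuple_mx v j - tuple_mx v j *m tuple_mx v i) a b.
    by rewrite -!GE -!map_mxM -map_mxB [RHS]mxE.
  apply/seteqP; split=> v [].
    move=> uv cv; split.
      by move=> _ [i [j [a [b ->]]]]; apply: etrans (PE _ _ _ _ _) _;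
         rewrite cv subrr mxE.
    rewrite -[_.@[_]]/(meval ((v : 'rV[k]_(n * (2 * 2))) 0) f) fE.
    by apply/prodf_neq0 => i _; have := uv i; rewrite unitmxE unitfE.
  move=> Pv; rewrite -[_.@[_]]/(meval ((v : 'rV[k]_(n * (2 * 2))) 0) f) fE.
  move=> /prodf_neq0 fv; split=> [i|i j].
    by rewrite unitmxE unitfE; exact: fv.
  apply/eqP; rewrite -subr_eq0; apply/eqP/matrixP => a b; rewrite [RHS]mxE.
  by rewrite -PE; apply: Pv; exists i, j, a, b.
exact: is_affine_principal.
Qed.

Definition commuting_variety : variety k := affine_variety commuting_GL2_affine.

End Commuting.

(* Main.v *)
From HB Require Import structures.
From mathcomp Require Import all_boot all_order all_algebra.
From mathcomp Require Import mpoly.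
From mathcomp Require Import boolp classical_sets.
From mathcomp Require Import topology.
From Stdlib Require Import Ring.
Require Import Defs.

(** Write [q] for the class of the affine line.

    The class of [C_n].  Split a commuting tuple by its first matrix [A].  If
    [A] is scalar, the remaining matrices form an arbitrary point of [C_(n-1)].
    Otherwise the centralizer of [A] is [k[A]], so that each further matrix is
    [z + y U], where [U] is the traceless part of [A], and
    [U^2 = delta = u^2 + b c] is scalar.  The other matrices are thus free
    units of the two-dimensional algebra [k[U]], with norm [z^2 - delta y^2],
    and everything depends on the family of these unit groups over the space of
    nonscalar [A].  Where [delta = 0] the unit group is [G_m x A^1]; where
    [delta] is the square of an invertible regular function it is
    [G_m x G_m].  Where [delta] is invertible but has no regular square root the
    family is not a product, and a halving argument over the double cover
    [w^2 = delta] is not available, since [2] may be a zero divisor in the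
    Grothendieck ring.  Instead one removes the zero locus of the norm from the
    plane: apart from the origin it is [G_m] times the double cover
    ([cls_unit_family_ramified]), and over the double cover [delta] is a square.
    This is a recursion with integral coefficients ([cls_family_ramified]).
    The coordinates [b], [c], [u] of [U] stratify the space of matrices in such
    a way that on each stratum some coordinate is invertible, which makes [y] a
    regular function of the matrix ([cls_peel]).  Adding up the strata gives a
    recursion for [C_(n+1)] ([cls_commuting_recursion]), which is solved in the
    polynomial ring.

    The dimension.  The commuting tuples are covered by three polynomial maps
    from affine space of dimension [2n + 2], as all members of a tuple have the
    form [x_i + y_i M] with a common [M], which can be normalized to depend on
    two parameters.  In a chain of irreducible closed sets
    [Z_0 < ... < Z_m], choose [f_i] vanishing on [Z_(i-1)] and not on [Z_i].
    The monomials in [f_1, ..., f_m] are linearly independent on [Z_m], and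
    there are [T^m] of them with exponents below [T].  After pulling back to
    the charts they are polynomials of degree [O(T)] in [2n + 2] variables,
    which form a space of dimension [O(T^(2n+2))]; so [m <= 2n + 2]
    ([chain_length]).  A chain of length [2n + 2] consists of the closures of
    the images of a flag of coordinate subspaces under one such chart
    ([flag_chain]); these are irreducible because any two of their points lie
    on a rational curve inside. *)

Set Implicit Arguments.
Unset Strict Implicit.
Unset Printing Implicit Defensive.

Import GRing.Theory.
Local Open Scope ring_scope.

(** * Ring identities *)

(** The same operation of a ring can be reached through different structures,
    giving terms that are convertible but syntactically distinct, on which
    [ring] fails.  The aliases below provide one canonical form, which
    [fold_ring] restores up to conversion. *)
Section RingTactic.
Variable R : comPzRingType.

Definition radd (x y : R) : R := x + y.
Definition rmul (x y : R) : R := x * y.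
Definition ropp (x : R) : R := - x.
Definition rzero : R := 0.
Definition rone : R := 1.

Lemma comPz_ring_theory : @ring_theory (GRing.ComPzRing.sort R)
  rzero rone radd rmul (fun x y => radd x (ropp y)) ropp eq.
Proof.
split=> //.
- exact: add0r.
- exact: addrC.
- exact: addrA.
- exact: mul1r.
- exact: mulrC.
- exact: mulrA.
- exact: mulrDl.
- exact: subrr.
Qed.

End RingTactic.

Ltac fold_ring R :=
  repeat match goal with
  | |- context [@Algebra.add ?s ?x ?y] => change (@Algebra.add s x y) with (@radd R x y)
  | |- context [@Algebra.opp ?s ?x] => change (@Algebra.opp s x) with (@ropp R x)
  | |- context [@GRing.mul ?s ?x ?y] => change (@GRing.mul s x y) with (@rmul R x y)
  | |- context [@Algebra.zero ?s] => change (@Algebra.zero s) with (@rzero R)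
  | |- context [@GRing.one ?s] => change (@GRing.one s) with (@rone R)
  end;
  match goal with |- @eq _ ?x ?y => change (@eq (GRing.ComPzRing.sort R) x y) end.

(** * Sets and regular functions in coordinates *)

Section Coordinates.
Variable k : closedFieldType.
Local Open Scope classical_set_scope.

(** Working with pairs and scalars instead of row vectors keeps the formulas for
    the strata readable; the bijection with affine space transports the
    geometry. *)
Class has_coords (T : Type) := Coords {
  codim : nat;
  enc : T -> 'rV[k]_codim;
  dec : 'rV[k]_codim -> T;
  encK : cancel enc dec;
  decK : cancel dec enc
}.

#[global] Arguments codim T {has_coords}.
#[global] Arguments enc {T has_coords}.
#[global] Arguments dec {T has_coords}.
#[global] Arguments encK {T has_coords}.
#[global] Arguments decK {T has_coords}.

#[global] Instance coords_rV n : has_coords 'rV[k]_n :=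
  @Coords 'rV[k]_n n id id (fun=> erefl) (fun=> erefl).

Lemma coords_unit_decK : cancel (fun _ : 'rV[k]_0 => tt) (fun=> 0).
Proof. by move=> v; apply/rowP => -[]. Qed.

Lemma coords_unit_encK : cancel (fun=> 0 : 'rV[k]_0) (fun _ : 'rV[k]_0 => tt).
Proof. by case. Qed.

#[global] Instance coords_unit : has_coords unit :=
  Coords coords_unit_encK coords_unit_decK.

Lemma coords_line_encK :
  cancel (fun x : k => const_mx x : 'rV[k]_1) (fun v => v 0 0).
Proof. by move=> x; rewrite mxE. Qed.

Lemma coords_line_decK :
  cancel (fun v : 'rV[k]_1 => v 0 0) (fun x : k => const_mx x).
Proof. by move=> v; apply/rowP => i; rewrite ord1 mxE. Qed.

#[global] Instance coords_line : has_coords k :=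
  Coords coords_line_encK coords_line_decK.

Section CoordsPair.
Context (A B : Type) (cA : has_coords A) (cB : has_coords B).

Definition pair_enc (z : A * B) : 'rV[k]_(codim A + codim B) :=
  row_mx (enc z.1) (enc z.2).
Definition pair_dec (v : 'rV[k]_(codim A + codim B)) : A * B :=
  (dec (lsubmx v), dec (rsubmx v)).

Lemma pair_encK : cancel pair_enc pair_dec.
Proof. by case=> a b; rewrite /pair_dec row_mxKl row_mxKr !encK. Qed.

Lemma pair_decK : cancel pair_dec pair_enc.
Proof. by move=> v; rewrite /pair_enc /= !decK hsubmxK. Qed.

End CoordsPair.

#[global] Instance coords_pair A B (cA : has_coords A) (cB : has_coords B) :
  has_coords (A * B) := Coords (@pair_encK A B cA cB) (@pair_decK A B cA cB).

(** A quotient of two polynomials on all of [S] is required, not just locally: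
    then both the zero locus and its complement in [S] are again described by
    polynomials. *)
Definition ratfun {T} {cT : has_coords T} (S : set T) (f : T -> k) : Prop :=
  exists g h : {mpoly k[codim T]}, forall x, S x ->
    h.@[enc x 0] != 0 /\ f x = g.@[enc x 0] / h.@[enc x 0].

Section RatFun.
Context {T : Type} {cT : has_coords T}.
Implicit Types (S : set T) (f : T -> k).

Lemma ratfun_sub S S' f : S' `<=` S -> ratfun S f -> ratfun S' f.
Proof. by move=> SS [g [h H]]; exists g, h => x /SS /H. Qed.

Lemma eq_ratfun S f f' : (forall x, S x -> f x = f' x) ->
  ratfun S f -> ratfun S f'.
Proof.
by move=> ff [g [h H]]; exists g, h => x Sx; rewrite -ff//; exact: H.
Qed.

Lemma ratfun_mpoly S (p : {mpoly k[codim T]}) : ratfun S (fun x => p.@[enc x 0]).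
Proof. by exists p, 1 => x _; rewrite meval1 divr1 oner_eq0. Qed.

Lemma ratfun_cst S c : ratfun S (fun=> c).
Proof.
by apply: eq_ratfun (ratfun_mpoly S c%:MP) => x _; rewrite mevalC.
Qed.

Lemma ratfun_coord S i : ratfun S (fun x => enc x 0 i).
Proof.
by apply: eq_ratfun (ratfun_mpoly S 'X_i) => x _; rewrite mevalXU.
Qed.

Lemma ratfunD S f f' : ratfun S f -> ratfun S f' ->
  ratfun S (fun x => f x + f' x).
Proof.
move=> [g [h H]] [g' [h' H']]; exists (g * h' + g' * h), (h * h') => x Sx.
have [h0 ->] := H x Sx; have [h0' ->] := H' x Sx.
by rewrite mevalD !mevalM mulf_neq0// addf_div.
Qed.

Lemma ratfunM S f f' : ratfun S f -> ratfun S f' ->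
  ratfun S (fun x => f x * f' x).
Proof.
move=> [g [h H]] [g' [h' H']]; exists (g * g'), (h * h') => x Sx.
have [h0 ->] := H x Sx; have [h0' ->] := H' x Sx.
by rewrite !mevalM mulf_neq0// mulf_div.
Qed.

Lemma ratfunN S f : ratfun S f -> ratfun S (fun x => - f x).
Proof.
move=> rf; apply: eq_ratfun (ratfunM (ratfun_cst S (-1)) rf) => x _.
by rewrite mulN1r.
Qed.

Lemma ratfunB S f f' : ratfun S f -> ratfun S f' ->
  ratfun S (fun x => f x - f' x).
Proof. by move=> rf rf'; apply: ratfunD => //; exact: ratfunN. Qed.

Lemma ratfunX S f m : ratfun S f -> ratfun S (fun x => f x ^+ m).
Proof.
move=> rf; elim: m => [|m IH]; first exact: ratfun_cst.
by apply: eq_ratfun (ratfunM rf IH) => x _; rewrite exprS.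
Qed.

Lemma ratfunV S f : (forall x, S x -> f x != 0) -> ratfun S f ->
  ratfun S (fun x => (f x)^-1).
Proof.
move=> f0 [g [h H]]; exists h, g => x Sx; have [h0 fE] := H x Sx.
by have := f0 x Sx; rewrite fE mulf_eq0 negb_or invf_div => /andP[-> _].
Qed.

Lemma ratfun_sum S (I : Type) (s : seq I) (F : I -> T -> k) :
  (forall i, ratfun S (F i)) -> ratfun S (fun x => \sum_(i <- s) F i x).
Proof.
move=> rF; elim: s => [|i s IH].
  by apply: eq_ratfun (ratfun_cst S 0) => x _; rewrite big_nil.
by apply: eq_ratfun (ratfunD (rF i) IH) => x _; rewrite big_cons.
Qed.

Lemma ratfun_prod S (I : Type) (s : seq I) (F : I -> T -> k) :
  (forall i, ratfun S (F i)) -> ratfun S (fun x => \prod_(i <- s) F i x).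
Proof.
move=> rF; elim: s => [|i s IH].
  by apply: eq_ratfun (ratfun_cst S 1) => x _; rewrite big_nil.
by apply: eq_ratfun (ratfunM (rF i) IH) => x _; rewrite big_cons.
Qed.

Lemma ratfun_meval S n (v : T -> 'rV[k]_n) (p : {mpoly k[n]}) :
  (forall i, ratfun S (fun x => v x 0 i)) -> ratfun S (fun x => p.@[v x 0]).
Proof.
move=> rv; apply: (@eq_ratfun S
    (fun x => \sum_(m <- msupp p) p@_m * \prod_i v x 0 i ^+ m i)).
  by move=> x _; rewrite mevalE.
apply: ratfun_sum => m; apply: ratfunM; first exact: ratfun_cst.
by apply: ratfun_prod => i; exact: ratfunX.
Qed.

End RatFun.

Definition regmap {T T'} {cT : has_coords T} {cT' : has_coords T'} (S : set T)
  (phi : T -> T') : Prop := forall i, ratfun S (fun x => enc (phi x) 0 i).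

Section RegMap.
Context {T A B : Type} {cT : has_coords T} {cA : has_coords A} {cB : has_coords B}.
Implicit Types (S : set T).

Lemma regmap_id S : regmap S (fun x => x).
Proof. by move=> i; exact: ratfun_coord. Qed.

Lemma regmap_cst S (a : A) : regmap S (fun=> a).
Proof. by move=> i; exact: ratfun_cst. Qed.

Lemma regmap_pair S (f : T -> A) (g : T -> B) :
  regmap S f -> regmap S g -> regmap S (fun x => (f x, g x)).
Proof.
move=> rf rg i; case: (splitP i) => j ij.
  have -> : i = lshift _ j by exact: val_inj.
  by apply: eq_ratfun (rf j) => x _; rewrite [RHS]row_mxEl.
have -> : i = rshift _ j by exact: val_inj.
by apply: eq_ratfun (rg j) => x _; rewrite [RHS]row_mxEr.
Qed.

Lemma regmap_fst S (f : T -> A * B) : regmap S f -> regmap S (fun x => (f x).1).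
Proof.
by move=> rf i; apply: eq_ratfun (rf (lshift _ i)) => x _; rewrite [LHS]row_mxEl.
Qed.

Lemma regmap_snd S (f : T -> A * B) : regmap S f -> regmap S (fun x => (f x).2).
Proof.
by move=> rf i; apply: eq_ratfun (rf (rshift _ i)) => x _; rewrite [LHS]row_mxEr.
Qed.

Lemma ratfun_regmap S (f : T -> k) : regmap S f <-> ratfun S f.
Proof.
split=> [/(_ 0)|rf i]; first by apply: eq_ratfun => x _; rewrite mxE.
by apply: eq_ratfun rf => x _; rewrite mxE.
Qed.

Lemma ratfun_comp S (S' : set A) (f : T -> A) (g : A -> k) :
  ratfun S' g -> regmap S f -> (forall x, S x -> S' (f x)) ->
  ratfun S (fun x => g (f x)).
Proof.
move=> [a [b H]] rf SS.
apply: (@eq_ratfun _ _ S (fun x => a.@[enc (f x) 0] / b.@[enc (f x) 0])).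
  by move=> x /SS /H [_ ->].
apply: ratfunM; first exact: ratfun_meval.
apply: ratfunV; last exact: ratfun_meval.
by move=> x /SS /H [].
Qed.

End RegMap.

Lemma regmap_comp T A B (cT : has_coords T) (cA : has_coords A) (cB : has_coords B)
  (S : set T) (S' : set A) (f : T -> A) (g : A -> B) :
  regmap S' g -> regmap S f -> (forall x, S x -> S' (f x)) ->
  regmap S (fun x => g (f x)).
Proof. by move=> rg rf SS i; exact: (ratfun_comp (rg i)). Qed.

(** Principal open subsets of closed sets.  They are affine varieties and they
    are stable under cutting by the vanishing of a regular function and by its
    complement, so that every stratum below is one of them. *)
Definition basic {T} {cT : has_coords T} (S : set T) : Prop :=
  exists (P : set {mpoly k[codim T]}) (f : {mpoly k[codim T]}), forall x,
    S x <-> zeros P (enc x) /\ f.@[enc x 0] != 0.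

Section Basic.
Context {T : Type} {cT : has_coords T}.
Implicit Types (S : set T) (f : T -> k).

Lemma basicT : basic [set: T].
Proof.
exists set0, 1 => x; split=> // _; split; first by move=> p.
by rewrite meval1 oner_eq0.
Qed.

Lemma basicE S S' : (forall x, S x <-> S' x) -> basic S -> basic S'.
Proof.
move=> SS [P [f H]]; exists P, f => x; split.
  by move/SS/H.
by move=> /H /SS.
Qed.

Lemma basic_eq0 S f : basic S -> ratfun S f ->
  basic [set x | S x /\ f x = 0].
Proof.
move=> [P [p HS]] [g [h H]]; exists (P `|` [set g]), p => x; split.
  move=> [Sx fx]; have [Px px] := (HS x).1 Sx; split=> //.
  move=> q [|->]; first exact: Px.
  have [h0] := H x Sx; rewrite fx => /esym/eqP.
  by rewrite mulf_eq0 invr_eq0 (negbTE h0) orbF => /eqP.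
move=> [Px px]; have Sx : S x by apply/HS; split=> // q Pq; apply: Px; left.
split=> //; have [h0 ->] := H x Sx.
by rewrite (Px g (or_intror erefl)) mul0r.
Qed.

Lemma basic_neq0 S f : basic S -> ratfun S f ->
  basic [set x | S x /\ f x != 0].
Proof.
move=> [P [p HS]] [g [h H]]; exists P, (p * g) => x; rewrite mevalM.
split.
  move=> [Sx]; have [Px px] := (HS x).1 Sx; have [h0 ->] := H x Sx => gh.
  split=> //; rewrite mulf_neq0//; apply: contraNneq gh => ->.
  by rewrite mul0r.
rewrite mulf_eq0 negb_or => -[Px /andP[px gx]].
have Sx : S x by apply/HS.
by split=> //; have [h0 ->] := H x Sx; rewrite mulf_neq0// invr_eq0.
Qed.

Lemma basic_all0 S (I : finType) (F : I -> T -> k) : basic S ->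
  (forall i, ratfun S (F i)) -> basic [set x | S x /\ forall i, F i x = 0].
Proof.
move=> bS rF.
have H : forall s : seq I, basic [set x | S x /\ forall i, i \in s -> F i x = 0].
  elim=> [|i s IH]; first by apply: basicE bS => x; split=> // -[].
  have /basic_eq0 H := IH; have {H} := H _ (ratfun_sub _ (rF i)).
  move=> /(_ (fun x H => H.1)); apply: basicE => x /=; split.
    move=> [[Sx Fs] Fi]; split=> // j; rewrite inE => /predU1P[->//|]; exact: Fs.
  move=> [Sx H]; split; last by apply: H; rewrite inE eqxx.
  by split=> // j js; apply: H; rewrite inE js orbT.
apply: basicE (H (enum I)) => x; split=> -[Sx Fx]; split=> // i.
by apply: Fx; rewrite mem_enum.
Qed.

Lemma basic_all_neq0 S (I : finType) (F : I -> T -> k) : basic S ->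
  (forall i, ratfun S (F i)) -> basic [set x | S x /\ forall i, F i x != 0].
Proof.
move=> bS rF.
have := basic_neq0 bS (ratfun_prod (index_enum I) rF).
apply: basicE => x /=; split=> -[Sx H]; split=> //.
  by move=> i; move/prodf_neq0: H; exact.
by apply/prodf_neq0 => i _.
Qed.

End Basic.

Lemma basic_prod A B (cA : has_coords A) (cB : has_coords B) (S : set A) (S' : set B) :
  basic S -> basic S' -> basic [set z : A * B | S z.1 /\ S' z.2].
Proof.
move=> [P [p HS]] [Q [q HQ]].
pose a := @codim A cA; pose b := @codim B cB.
pose e : A * B -> 'rV[k]_(a + b) := @pair_enc A B cA cB.
pose tl := [tuple 'X_(lshift b i) : {mpoly k[a + b]} | i < a].
pose tr := [tuple 'X_(rshift a i) : {mpoly k[a + b]} | i < b].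
have El (w : A * B) : \row_i (tnth tl i).@[e w 0] = enc w.1.
  by apply/rowP => i; rewrite !mxE tnth_mktuple mevalXU [LHS]row_mxEl.
have Er (w : A * B) : \row_i (tnth tr i).@[e w 0] = enc w.2.
  by apply/rowP => i; rewrite !mxE tnth_mktuple mevalXU [LHS]row_mxEr.
have Ep (w : A * B) : (p \mPo tl).@[e w 0] = p.@[enc w.1 0].
  by rewrite comp_mpoly_meval; apply: meval_eq => i; rewrite -El mxE.
have Eq (w : A * B) : (q \mPo tr).@[e w 0] = q.@[enc w.2 0].
  by rewrite comp_mpoly_meval; apply: meval_eq => i; rewrite -Er mxE.
exists ([set r | exists2 r', P r' & r = r' \mPo tl] `|`
  [set r | exists2 r', Q r' & r = r' \mPo tr]), ((p \mPo tl) * (q \mPo tr)) => w.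
rewrite -[enc w]/(e w) mevalM Ep Eq; split.
  move=> [/HS[Pw pw] /HQ[Qw qw]]; split; last by rewrite mulf_neq0.
  by apply/zerosU; split; apply/zeros_comp; rewrite (El, Er).
move=> [/zerosU[/zeros_comp + /zeros_comp]]; rewrite El Er mulf_eq0 negb_or.
by move=> Pw Qw /andP[pw qw]; split; [apply/HS|apply/HQ].
Qed.

End Coordinates.

#[global] Arguments has_coords k T : clear implicits.
#[global] Arguments codim {k} T {has_coords}.
#[global] Arguments enc {k T has_coords}.
#[global] Arguments dec {k T has_coords}.

(** Regularity follows the syntax of the expression; what remains are the
    nonvanishing conditions on denominators. *)
Ltac regular := repeat first
  [ assumption
  | by apply: ratfun_cst
  | lazymatch goal with
    | |- regmap _ (fun x => (_, _)) => apply: regmap_pair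
    | |- regmap _ (fun x => fst _) => apply: regmap_fst
    | |- regmap _ (fun x => snd _) => apply: regmap_snd
    | |- regmap _ (fun x => x) => apply: regmap_id
    | |- regmap _ fst => apply: regmap_fst
    | |- regmap _ snd => apply: regmap_snd
    | |- ratfun _ (fun x => Algebra.add _ (Algebra.opp _)) => apply: ratfunB
    | |- ratfun _ (fun x => Algebra.add _ _) => apply: ratfunD
    | |- ratfun _ (fun x => Algebra.opp _) => apply: ratfunN
    | |- ratfun _ (fun x => GRing.mul _ _) => apply: ratfunM
    | |- ratfun _ (fun x => fst _) => apply/ratfun_regmap
    | |- ratfun _ (fun x => snd _) => apply/ratfun_regmap
    | |- ratfun _ (fun x => x) => apply/ratfun_regmap
    | |- ratfun _ fst => apply/ratfun_regmap
    | |- ratfun _ snd => apply/ratfun_regmap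
    | |- ratfun _ (fun x => GRing.inv _) => apply: ratfunV
    end
  (* Coordinates of pairs are left to the rules for maps: turning them into
     functions here would loop. *)
  | apply/ratfun_regmap; lazymatch goal with
    | |- ratfun _ (fun x => fst _) => fail
    | |- ratfun _ (fun x => snd _) => fail
    | |- ratfun _ _ => idtac
    end ].

#[global] Arguments basicT {k T cT}.

(** * Classes of basic sets *)

Section Classes.
Variable k : closedFieldType.
Local Open Scope classical_set_scope.

Definition coord_image {T} {cT : has_coords k T} (S : set T) :
  set (affine_space k (codim T)) := [set v | S (dec v)].

Definition coord_space {T} {cT : has_coords k T} (S : set T) : space k :=
  sub_space (coord_image S).

Lemma basic_affine T (cT : has_coords k T) (S : set T) :
  basic S -> is_affine (coord_space S).
Proof.
move=> [P [f H]]; rewrite /coord_space.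
have -> : coord_image S = [set x | zeros P x /\ f.@[x 0] != 0].
  by apply/seteqP; split=> v; rewrite /coord_image /= H decK.
exact: is_affine_principal.
Qed.

Lemma ratfun_regular T (cT : has_coords k T) (S : set T) (f : T -> k) :
  ratfun S f -> forall x : coord_space S,
  regular_at x (fun y => f (dec (val y))).
Proof.
move=> [g [h H]] x; have [_ rv] := @sub_space_val k _ (coord_image S).
have HS y := H (@dec k T cT (val y)) (@sub_spaceP k _ (coord_image S) y).
apply: (@reg_ext k _ _ (space_ax (coord_space S)) x
    (fun y => g.@[(val y : 'rV[k]_(codim T)) 0] /
              h.@[(val y : 'rV[k]_(codim T)) 0])).
  by apply: filterE => y; have [_ ->] := HS y; rewrite decK.
apply: reg_div.
- exact: rv (affine_reg_mpoly g _).
- exact: rv (affine_reg_mpoly h _).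
- by have [+ _] := HS x; rewrite decK.
Qed.

Lemma regmap_isomorphic A B (cA : has_coords k A) (cB : has_coords k B)
    (S : set A) (S' : set B) (f : A -> B) (g : B -> A) :
  regmap S f -> regmap S' g ->
  (forall x, S x -> S' (f x)) -> (forall y, S' y -> S (g y)) ->
  (forall x, S x -> g (f x) = x) -> (forall y, S' y -> f (g y) = y) ->
  isomorphic (coord_space S) (coord_space S').
Proof.
move=> rf rg fS gS fK gK.
pose F (x : @coord_space A cA S) : affine_space k (@codim k B cB) :=
  @enc k B cB (f (@dec k A cA (val x))).
pose G (y : @coord_space B cB S') : affine_space k (@codim k A cA) :=
  @enc k A cA (g (@dec k B cB (val y))).
have FS x : @coord_image B cB S' (F x).
  by rewrite /coord_image /= /F encK; apply: fS; exact: (sub_spaceP x).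
have GS y : @coord_image A cA S (G y).
  by rewrite /coord_image /= /G encK; apply: gS; exact: (sub_spaceP y).
exists (to_sub_space FS), (to_sub_space GS); split.
- apply: to_sub_space_morphism; apply: affine_morphism => i x.
  exact: (ratfun_regular (rf i)).
- apply: to_sub_space_morphism; apply: affine_morphism => i x.
  exact: (ratfun_regular (rg i)).
- move=> x; apply: sub_space_inj; rewrite /= /G /= /F encK fK ?decK//.
  exact: (sub_spaceP x).
- move=> y; apply: sub_space_inj; rewrite /= /F /= /G encK gK ?decK//.
  exact: (sub_spaceP y).
Qed.

(** This identifies the two pieces of a decomposition, which live inside the
    space of [S], with the spaces of subsets of the ambient affine space. *)
Lemma sub_sub_space (X : space k) (S A : set X) :
  isomorphic (sub_space ((fun x : sub_space S => A (val x)) : set (sub_space S)))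
    (sub_space (S `&` A)).
Proof.
set A' : set (sub_space S) := fun x => A (val x).
pose f (x : sub_space A') : X := val (val x).
have fS x : (S `&` A) (f x) by split; [exact: sub_spaceP|exact: (sub_spaceP x)].
pose g (y : sub_space (S `&` A)) : X := val y.
have gS y : S (g y) by have [] := sub_spaceP y.
pose g' : sub_space (S `&` A) -> sub_space S := to_sub_space gS.
have gA y : A' (g' y) by have [] := sub_spaceP y.
exists (to_sub_space fS), (to_sub_space gA); split.
- apply: to_sub_space_morphism.
  by apply: morphism_comp (@sub_space_val _ _ S); exact: sub_space_val.
- do 2 apply: to_sub_space_morphism; exact: sub_space_val.
- by move=> x; do 2 apply: sub_space_inj.
- by move=> y; apply: sub_space_inj.
Qed.

(** Making the class total in [S] allows one to compute with classes of sets
    without carrying proofs of affineness; the value [0] is only met on sets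
    that are not affine. *)
Definition cls {T} {cT : has_coords k T} (S : set T) : K0 k :=
  if pselect (is_affine (coord_space S)) is left aS
  then virtual_class (affine_variety aS) else 0.

Lemma clsE T (cT : has_coords k T) (S : set T) (X : variety k) : basic S ->
  isomorphic X (coord_space S) -> virtual_class X = cls S.
Proof.
move=> bS XS; rewrite /cls; case: pselect => [aS|]; last first.
  by have := basic_affine bS.
exact: virtual_class_iso.
Qed.

Lemma cls_iso A B (cA : has_coords k A) (cB : has_coords k B)
    (S : set A) (S' : set B) (f : A -> B) (g : B -> A) :
  regmap S f -> regmap S' g ->
  (forall x, S x -> S' (f x)) -> (forall y, S' y -> S (g y)) ->
  (forall x, S x -> g (f x) = x) -> (forall y, S' y -> f (g y) = y) ->
  cls S = cls S'.
Proof.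
move=> rf rg fS gS fK gK; have I := regmap_isomorphic rf rg fS gS fK gK.
rewrite /cls; case: pselect => [aS|nS]; case: pselect => [aS'|nS'] //.
- exact: virtual_class_iso.
- by case: nS'; exact: is_affine_iso I aS.
- by case: nS; exact: is_affine_iso (isomorphic_sym I) aS'.
Qed.

Lemma eq_cls A (cA : has_coords k A) (S S' : set A) : (forall x, S x <-> S' x) ->
  cls S = cls S'.
Proof. by move=> SS; congr cls; apply/seteqP; split=> x; rewrite SS. Qed.

(** The scissor relation, for a hypersurface. *)
Lemma cls_split T (cT : has_coords k T) (S : set T) (f : T -> k) :
  basic S -> ratfun S f ->
  cls S = cls [set x | S x /\ f x != 0] + cls [set x | S x /\ f x = 0].
Proof.
move=> bS rf.
have aS := basic_affine bS.
have b0 := basic_eq0 bS rf; have b1 := basic_neq0 bS rf.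
rewrite -(clsE bS (X := affine_variety aS) (isomorphic_refl _)).
rewrite -(clsE b0 (X := affine_variety (basic_affine b0)) (isomorphic_refl _)).
rewrite -(clsE b1 (X := affine_variety (basic_affine b1)) (isomorphic_refl _)).
pose Z : set (@coord_space T cT S) := fun x => f (@dec k T cT (val x)) = 0.
have cZ : closed Z by apply: regular_zeros_closed; exact: ratfun_regular.
apply: (@virtual_class_scissor k (affine_variety aS) _ _ Z cZ);
  apply: isomorphic_sym.
  exact: (@sub_sub_space _ (coord_image S) (fun v => f (dec v) = 0)).
have -> : ~` Z = (fun x : coord_space S => f (dec (val x)) != 0).
  by apply/seteqP; split=> x /eqP.
exact: (@sub_sub_space _ (coord_image S) (fun v => f (dec v) != 0)).
Qed.

Lemma cls_prod A B (cA : has_coords k A) (cB : has_coords k B)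
    (S : set A) (S' : set B) : basic S -> basic S' ->
  cls [set z : A * B | S z.1 /\ S' z.2] = cls S * cls S'.
Proof.
move=> bS bS'; have bP := basic_prod bS bS'.
have aS := basic_affine bS; have aS' := basic_affine bS'.
rewrite -(clsE bS (X := affine_variety aS) (isomorphic_refl _)).
rewrite -(clsE bS' (X := affine_variety aS') (isomorphic_refl _)).
rewrite -virtual_class_prod; apply/esym; apply: clsE => //=.
apply: isomorphic_trans (prod_sub_space _ _) _.
pose a := @codim k A cA; pose b := @codim k B cB.
pose f (z : prod_space (affine_space k a) (affine_space k b)) :
  affine_space k (a + b) := row_mx (z.1 : 'rV[k]_a) (z.2 : 'rV[k]_b).
pose g (w : affine_space k (a + b)) :
  prod_space (affine_space k a) (affine_space k b) :=
  (lsubmx (w : 'rV[k]_(a + b)), rsubmx (w : 'rV[k]_(a + b))).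
apply: (@isomorphic_sub_space _ _ _ _ _ f g).
- apply: affine_morphism => i z; case: (splitP i) => j ij.
    have -> : i = lshift b j by exact: val_inj.
    have [_ H] := @prod_space_fst k (affine_space k a) (affine_space k b).
    apply: (reg_ext (space_ax _)) (H z _ (affine_reg_coord j z.1)).
    by apply: filterE => y; rewrite row_mxEl.
  have -> : i = rshift a j by exact: val_inj.
  have [_ H] := @prod_space_snd k (affine_space k a) (affine_space k b).
  apply: (reg_ext (space_ax _)) (H z _ (affine_reg_coord j z.2)).
  by apply: filterE => y; rewrite row_mxEr.
- apply: prod_space_pair; apply: affine_morphism => i z.
    apply: (reg_ext (space_ax _)) (affine_reg_coord (lshift b i) z).
    by apply: filterE => y; rewrite mxE.
  apply: (reg_ext (space_ax _)) (affine_reg_coord (rshift a i) z).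
  by apply: filterE => y; rewrite mxE.
- move=> [x y] /= [Sx Sy]; rewrite /coord_image /= /pair_dec /f.
  by rewrite row_mxKl row_mxKr.
- by move=> w.
- by move=> [x y] _; rewrite /g /f /= row_mxKl row_mxKr.
- by move=> w _; rewrite /f /= hsubmxK.
Qed.

Lemma cls_unit : cls [set: unit] = 1.
Proof.
rewrite -virtual_class_point; apply/esym; apply: clsE; first exact: basicT.
exact: isomorphic_setT.
Qed.

Lemma cls_line : cls [set: k] = lefschetz k.
Proof.
apply/esym; apply: clsE; first exact: basicT.
exact: isomorphic_setT.
Qed.

End Classes.

(** * Two by two matrices and tuples of them *)

Section Matrices.
Variable R : comPzRingType.

Definition mx2 (p q r t : R) : 'M[R]_2 := \matrix_(i, j)
  if i == 0 then if j == 0 then p else q else if j == 0 then r else t.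

Lemma ord2P (P : 'I_2 -> Prop) : P 0 -> P 1 -> forall i, P i.
Proof.
move=> P0 P1 i; case: (unliftP 0 i) => [j ->|->//].
suff -> : lift 0 j = 1 by []; by apply: val_inj; rewrite /= ord1.
Qed.

Lemma eq_mx2 (A B : 'M[R]_2) : A 0 0 = B 0 0 -> A 0 1 = B 0 1 ->
  A 1 0 = B 1 0 -> A 1 1 = B 1 1 -> A = B.
Proof. by move=> *; apply/matrixP => i j; elim/ord2P: i; elim/ord2P: j. Qed.

Lemma mulmx2E (A B : 'M[R]_2) i j : (A *m B) i j = A i 0 * B 0 j + A i 1 * B 1 j.
Proof.
by rewrite mxE big_ord_recl big_ord1 (_ : lift ord0 ord0 = 1) //; exact: val_inj.
Qed.

Lemma det_mx2 (A : 'M[R]_2) : \det A = A 0 0 * A 1 1 - A 0 1 * A 1 0.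
Proof.
rewrite (expand_det_row _ 0) big_ord_recl big_ord1 /cofactor !det_mx11 !mxE.
have -> : lift ord0 ord0 = 1 :> 'I_2 by exact: val_inj.
have -> : lift 1 0 = 0 :> 'I_2 by exact: val_inj.
by rewrite /= addn0 add0n expr0 expr1 mul1r mulN1r mulrN.
Qed.

End Matrices.

Section Tuples.
Variable k : closedFieldType.
Local Open Scope classical_set_scope.

Definition untuple n (M : 'I_n -> 'M[k]_2) : 'rV[k]_(n * (2 * 2)) :=
  mxvec (\matrix_i mxvec (M i)).

Lemma untupleK n (M : 'I_n -> 'M[k]_2) i : tuple_mx (untuple M) i = M i.
Proof. by rewrite /tuple_mx /untuple mxvecK rowK mxvecK. Qed.

Lemma tuple_mxK n (v : 'rV[k]_(n * (2 * 2))) : untuple (tuple_mx v) = v.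
Proof.
rewrite /untuple -[RHS]vec_mxK; congr mxvec; apply/row_matrixP => i.
by rewrite rowK /tuple_mx vec_mxK.
Qed.

Lemma eq_untuple n (M M' : 'I_n -> 'M[k]_2) : M =1 M' -> untuple M = untuple M'.
Proof.
by move=> MM; congr mxvec; apply/row_matrixP => i; rewrite !rowK MM.
Qed.

Lemma tuple_mxE n (v : 'rV[k]_(n * (2 * 2))) i a b :
  tuple_mx v i a b = v 0 (mxvec_index i (mxvec_index a b)).
Proof. by rewrite !mxE. Qed.

Definition cons_mx n (A : 'M[k]_2) (v : 'rV[k]_(n * (2 * 2))) :
  'rV[k]_(n.+1 * (2 * 2)) :=
  untuple (fun i => if unlift ord0 i is Some j then tuple_mx v j else A).

Definition tail_mx n (v : 'rV[k]_(n.+1 * (2 * 2))) : 'rV[k]_(n * (2 * 2)) :=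
  untuple (fun i => tuple_mx v (lift ord0 i)).

Lemma cons_mx0 n A (v : 'rV[k]_(n * (2 * 2))) : tuple_mx (cons_mx A v) ord0 = A.
Proof. by rewrite untupleK unlift_none. Qed.

Lemma cons_mxS n A (v : 'rV[k]_(n * (2 * 2))) i :
  tuple_mx (cons_mx A v) (lift ord0 i) = tuple_mx v i.
Proof. by rewrite untupleK liftK. Qed.

Lemma cons_mxK n A (v : 'rV[k]_(n * (2 * 2))) : tail_mx (cons_mx A v) = v.
Proof.
by rewrite -[RHS]tuple_mxK; apply: eq_untuple => i; rewrite cons_mxS.
Qed.

Lemma tail_mxK n (v : 'rV[k]_(n.+1 * (2 * 2))) :
  cons_mx (tuple_mx v ord0) (tail_mx v) = v.
Proof.
rewrite -[RHS]tuple_mxK; apply: eq_untuple => i.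
by case: unliftP => [j ->|->]; rewrite ?untupleK.
Qed.

(** The shape in which commuting tuples are built and taken apart by induction
    on their length. *)
Lemma commuting_GL2_cons n A (v : 'rV[k]_(n * (2 * 2))) :
  @commuting_GL2 k n.+1 (cons_mx A v) <->
  [/\ A \in unitmx, @commuting_GL2 k n v &
      forall i, tuple_mx v i *m A = A *m tuple_mx v i].
Proof.
split=> [[uv cv]|[uA [uv cv] cA]].
  split; first by have := uv ord0; rewrite cons_mx0.
    split=> [i|i j]; first by have := uv (lift ord0 i); rewrite cons_mxS.
    by have := cv (lift ord0 i) (lift ord0 j); rewrite !cons_mxS.
  by move=> i; have := cv (lift ord0 i) ord0; rewrite cons_mxS cons_mx0.
have P (Q : 'I_n.+1 -> Prop) : Q ord0 -> (forall i, Q (lift ord0 i)) -> forall i, Q i.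
  by move=> Q0 QS i; case: (unliftP ord0 i) => [j ->|->].
split; first by apply: P => [|i]; rewrite ?cons_mx0 ?cons_mxS.
apply: (P) => [|i]; apply: (P) => [|j]; rewrite ?cons_mx0 ?cons_mxS//.
Qed.

Section Regular.
Context {T : Type} {cT : has_coords k T}.
Implicit Type S : set T.

Lemma regmap_untuple S n (M : T -> 'I_n -> 'M[k]_2) :
  (forall i a b, ratfun S (fun x => M x i a b)) ->
  regmap S (fun x => untuple (M x)).
Proof.
move=> rM j; case/mxvec_indexP: j => i j; case/mxvec_indexP: j => a b.
by apply: eq_ratfun (rM i a b) => x _; rewrite -[M x i]untupleK tuple_mxE.
Qed.

Lemma ratfun_tuple_mx S n (v : T -> 'rV[k]_(n * (2 * 2))) i a b :
  regmap S v -> ratfun S (fun x => tuple_mx (v x) i a b).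
Proof.
by move=> /(_ (mxvec_index i (mxvec_index a b))); apply: eq_ratfun => x _;
  rewrite tuple_mxE.
Qed.

Lemma regmap_cons S n (A : T -> 'M[k]_2) (v : T -> 'rV[k]_(n * (2 * 2))) :
  (forall a b, ratfun S (fun x => A x a b)) -> regmap S v ->
  regmap S (fun x => cons_mx (A x) (v x)).
Proof.
move=> rA rv; apply: regmap_untuple => i a b.
by case: unliftP => [j _|_//]; exact: ratfun_tuple_mx.
Qed.

Lemma regmap_tail S n (v : T -> 'rV[k]_(n.+1 * (2 * 2))) :
  regmap S v -> regmap S (fun x => tail_mx (v x)).
Proof.
by move=> rv; apply: regmap_untuple => i a b; exact: ratfun_tuple_mx.
Qed.

Lemma ratfun_mulmx S (A B : T -> 'M[k]_2) i j :
  (forall a b, ratfun S (fun x => A x a b)) ->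
  (forall a b, ratfun S (fun x => B x a b)) ->
  ratfun S (fun x => (A x *m B x) i j).
Proof.
move=> rA rB.
apply: (eq_ratfun (f := fun x => A x i 0 * B x 0 j + A x i 1 * B x 1 j)).
  by move=> x _; rewrite mulmx2E.
by apply: ratfunD; apply: ratfunM.
Qed.

End Regular.
End Tuples.

(** * Families of commuting tuples in a varying centralizer *)

Section Centralizers.
Variable k : closedFieldType.
Local Open Scope classical_set_scope.
Add Ring kring : (comPz_ring_theory k).

Definition traceless (u b c : k) : 'M[k]_2 := mx2 u b c (- u).

(** Commuting with [[u, b], [c, -u]] means that the traceless part of [A] is
    proportional to [(u, b, c)]: these are the three two by two minors. *)
Lemma traceless_comm (A : 'M[k]_2) u b c :
  A *m traceless u b c = traceless u b c *m A <->
  [/\ A 0 1 * c = b * A 1 0, b * (A 0 0 - A 1 1) = 2%:R * (u * A 0 1) &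
      c * (A 0 0 - A 1 1) = 2%:R * (u * A 1 0)].
Proof.
split=> [E|[E1 E2 E3]].
  have e i j : (A *m traceless u b c) i j = (traceless u b c *m A) i j by rewrite E.
  move: (e 0 0) (e 0 1) (e 1 0); rewrite !mulmx2E !mxE /=.
  set p := A 0 0; set q := A 0 1; set r := A 1 0; set t := A 1 1.
  move=> e0 e1 e2; split.
  - apply: (@addrI _ (p * u)); rewrite e0; congr (_ + _); exact: mulrC.
  - apply/eqP; rewrite -subr_eq0; apply/eqP.
    have -> : b * (p - t) - 2%:R * (u * q) = (p * b + q * - u) - (u * q + b * t).
      by rewrite mulr2n; fold_ring k; ring.
    by rewrite e1 subrr.
  - apply/eqP; rewrite -subr_eq0; apply/eqP.
    have -> : c * (p - t) - 2%:R * (u * r) = (c * p + - u * r) - (r * u + t * c).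
      by rewrite mulr2n; fold_ring k; ring.
    by rewrite e2 subrr.
move: E1 E2 E3.
set p := A 0 0; set q := A 0 1; set r := A 1 0; set t := A 1 1 => e0 e1 e2.
apply: eq_mx2; rewrite !mulmx2E !mxE /= -/p -/q -/r -/t.
- by rewrite e0; fold_ring k; ring.
- have -> : p * b + q * - u = b * (p - t) + b * t - u * q by fold_ring k; ring.
  by rewrite e1 mulr2n; fold_ring k; ring.
- have -> : c * p + - u * r = c * (p - t) + c * t - u * r by fold_ring k; ring.
  by rewrite e2 mulr2n; fold_ring k; ring.
- by rewrite [r * b]mulrC -e0; fold_ring k; ring.
Qed.

Lemma basic_commuting T (cT : has_coords k T) n (S : set T)
    (v : T -> 'rV[k]_(n * (2 * 2))) : basic S -> regmap S v ->
  basic [set x | S x /\ @commuting_GL2 k n (v x)].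
Proof.
move=> bS rv.
have rt i p q : ratfun S (fun x => tuple_mx (v x) i p q).
  by apply: ratfun_tuple_mx.
have /(basic_all_neq0 bS) b1 (i : 'I_n) : ratfun S (fun x => \det (tuple_mx (v x) i)).
  apply: eq_ratfun (fun x _ => esym (det_mx2 (tuple_mx (v x) i))) _.
  by apply: ratfunB; apply: ratfunM.
set X1 := [set _ | _] in b1.
have /(basic_all0 b1) b2 (I : 'I_n * 'I_n * ('I_2 * 'I_2)) : ratfun X1 (fun x =>
    (tuple_mx (v x) I.1.1 *m tuple_mx (v x) I.1.2) I.2.1 I.2.2 -
    (tuple_mx (v x) I.1.2 *m tuple_mx (v x) I.1.1) I.2.1 I.2.2).
  apply: (@ratfun_sub _ _ _ S) => [x []//|].
  by apply: ratfunB; apply: ratfun_mulmx.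
apply: basicE b2 => x; rewrite /X1 /=; split.
  move=> [[Sx ux] cx]; split=> //; split=> [i|i j].
    by rewrite unitmxE unitfE.
  apply/matrixP => p q; apply/eqP; rewrite -subr_eq0; apply/eqP.
  exact: (cx ((i, j), (p, q))).
move=> [Sx [ux cx]]; split=> [|[[i j] [p q]] /=]; last by rewrite cx subrr.
by split=> // i; have := ux i; rewrite unitmxE unitfE.
Qed.

Section Family.
Context {T : Type} {cT : has_coords k T}.
Implicit Types (S : set T) (u b c : T -> k).

(** Over the point [x] of [S], the fibre is the set of commuting tuples of
    invertible matrices in the centralizer of [[u x, b x], [c x, - u x]]. *)
Definition centralizer_family n S u b c : set (T * 'rV[k]_(n * (2 * 2))) :=
  [set z | [/\ S z.1, @commuting_GL2 k n z.2 & forall i,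
    tuple_mx z.2 i *m traceless (u z.1) (b z.1) (c z.1) =
    traceless (u z.1) (b z.1) (c z.1) *m tuple_mx z.2 i]].

Arguments centralizer_family : clear implicits.

Lemma centralizer_family_basic n S u b c :
  basic S -> ratfun S u -> ratfun S b -> ratfun S c ->
  basic (centralizer_family n S u b c).
Proof.
move=> bS ru rb rc.
set U := (T * 'rV[k]_(n * (2 * 2)))%type.
have b0 := basic_prod bS (@basicT k _ (@coords_rV k (n * (2 * 2)))).
have rs : regmap [set z : U | S z.1 /\ setT z.2] (fun z => z.2) by regular.
have b1 := basic_commuting b0 rs; set X := [set _ | _] in b1.
have XS (z : U) : X z -> S z.1 by case=> -[].
have rt i p q : ratfun X (fun z => tuple_mx z.2 i p q).
  by apply: ratfun_tuple_mx; regular.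
have rf f : ratfun S f -> ratfun X (fun z : U => f z.1).
  by move=> rf; apply: ratfun_comp rf _ XS; regular.
have rU i j : ratfun X (fun z : U => traceless (u z.1) (b z.1) (c z.1) i j).
  elim/ord2P: i; elim/ord2P: j.
  - by apply: eq_ratfun (rf _ ru) => z _; rewrite mxE.
  - by apply: eq_ratfun (rf _ rb) => z _; rewrite mxE.
  - by apply: eq_ratfun (rf _ rc) => z _; rewrite mxE.
  - by apply: eq_ratfun (ratfunN (rf _ ru)) => z _; rewrite mxE.
have /(basic_all0 b1) b2 (I : 'I_n * ('I_2 * 'I_2)) : ratfun X (fun z =>
    (tuple_mx z.2 I.1 *m traceless (u z.1) (b z.1) (c z.1)) I.2.1 I.2.2 -
    (traceless (u z.1) (b z.1) (c z.1) *m tuple_mx z.2 I.1) I.2.1 I.2.2).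
  by apply: ratfunB; apply: ratfun_mulmx.
apply: basicE b2 => z; rewrite /centralizer_family /X /=; split.
  move=> [[[Sz _] cz] Uz]; split=> // i.
  apply/matrixP => p q; apply/eqP; rewrite -subr_eq0; apply/eqP.
  exact: (Uz (i, (p, q))).
by move=> [Sz cz Uz]; split=> // -[i [p q]] /=; rewrite Uz subrr.
Qed.
End Family.
End Centralizers.
Arguments centralizer_family {k T} n S u b c.

(** * Families of unit groups of quadratic algebras *)

Section UnitFamilies.
Variable k : closedFieldType.
Hypothesis k2 : (2%:R : k) != 0.
Local Open Scope classical_set_scope.
Add Ring kring : (comPz_ring_theory k).
Local Notation L := (lefschetz k).

Lemma half_add a : (a + a) / 2%:R = a :> k.
Proof. by rewrite -mulr2n -[a *+ 2]mulr_natr mulfK. Qed.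

Lemma cls_point {T : Type} {cT : has_coords k T} (a : T) :
  cls [set x | x = a] = 1.
Proof.
rewrite -(cls_unit k); apply: (cls_iso (f := fun=> tt) (g := fun=> a)) => //.
- exact: regmap_cst.
- exact: regmap_cst.
- by case.
Qed.

Lemma cls_Gm : cls [set x : k | x != 0] = L - 1.
Proof.
rewrite -cls_line (@cls_split k k _ setT id); [|exact: basicT|by regular].
rewrite -(cls_point (0 : k)); apply/esym.
rewrite (_ : cls [set x | setT x /\ id x = 0] = cls [set x : k | x = 0]).
  by rewrite addrK; apply: eq_cls => x; split=> [[]|].
by apply: eq_cls => x; split=> [[]|].
Qed.

Lemma basic_Gm : basic [set x : k | x != 0].
Proof.
have rid : ratfun [set: k] id by regular.
by refine (basicE _ (basic_neq0 basicT rid)) => x; split=> [[]|].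
Qed.

Section Products.
Context {T : Type} {cT : has_coords k T}.
Implicit Types (S : set T) (d : T -> k).

Lemma ratfun_fst {B} {cB : has_coords k B} S (X : set (T * B)) d :
  ratfun S d -> (forall z, X z -> S z.1) -> ratfun X (fun z => d z.1).
Proof. by move=> rd XS; apply: ratfun_comp rd _ XS; regular. Qed.

Lemma basic_fst {B} {cB : has_coords k B} S :
  basic S -> basic [set z : T * B | S z.1].
Proof.
move=> bS; by refine (basicE _ (basic_prod bS basicT)) => z; split=> [[]|].
Qed.

Lemma cls_mulr_line S : basic S -> cls [set z : T * k | S z.1] = cls S * L.
Proof.
move=> bS; rewrite -cls_line -cls_prod//; last exact: basicT.
by apply: eq_cls => z; split=> [|[]].
Qed.

Lemma cls_mulr_Gm S : basic S ->
  cls [set z : T * k | S z.1 /\ z.2 != 0] = cls S * (L - 1).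
Proof. by move=> bS; rewrite -cls_Gm -cls_prod//; exact: basic_Gm. Qed.

End Products.

Section OneFamily.
Context {T : Type} {cT : has_coords k T}.
Implicit Types (S : set T) (d w : T -> k).

(** The units [z + y U] of the algebra [k[U]], [U^2 = d], for [d] varying with
    the point of [S]; the expression is the norm. *)
Definition unit_family S d : set (T * (k * k)) :=
  [set z | S z.1 /\ z.2.1 * z.2.1 - d z.1 * (z.2.2 * z.2.2) != 0].

Definition root_cover S d : set (T * k) :=
  [set z | S z.1 /\ z.2 * z.2 - d z.1 = 0].

Lemma unit_family_basic S d : basic S -> ratfun S d -> basic (unit_family S d).
Proof.
move=> bS rd; set X : set (T * (k * k)) := [set z | S z.1].
have rX : ratfun X (fun z => d z.1) by exact: ratfun_fst rd _.
by refine (basic_neq0 (basic_fst bS) _); regular.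
Qed.

Lemma root_cover_basic S d : basic S -> ratfun S d -> basic (root_cover S d).
Proof.
move=> bS rd; set X : set (T * k) := [set z | S z.1].
have rX : ratfun X (fun z => d z.1) by exact: ratfun_fst rd _.
by refine (basic_eq0 (basic_fst bS) _); regular.
Qed.

Lemma cls_unit_family_nilpotent S d : basic S -> (forall x, S x -> d x = 0) ->
  cls (unit_family S d) = L * (L - 1) * cls S.
Proof.
move=> bS d0.
rewrite [RHS]mulrC [L * _]mulrC -cls_Gm -cls_line -cls_prod; first last.
- exact: basicT.
- exact: basic_Gm.
rewrite -cls_prod //; last by apply: basic_prod; [exact: basic_Gm|exact: basicT].
apply: eq_cls => -[x [z y]] /=; split=> [[Sx]|[Sx [z0 _]]]; last first.
  by split=> //; rewrite d0// mul0r subr0 mulf_neq0.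
by rewrite d0// mul0r subr0 mulf_eq0 orbb.
Qed.

(** With [d = w^2] the norm factors as [(z - w y) (z + w y)], and the factors
    are coordinates because [2 w] is invertible. *)
Lemma cls_unit_family_split S d w : basic S -> ratfun S w ->
  (forall x, S x -> w x != 0) -> (forall x, S x -> d x = w x * w x) ->
  cls (unit_family S d) = (L - 1) * (L - 1) * cls S.
Proof.
move=> bS rw w0 dw.
rewrite [RHS]mulrC -!cls_Gm -cls_prod; [|exact: basic_Gm|exact: basic_Gm].
rewrite -cls_prod //; last by apply: basic_prod; exact: basic_Gm.
set X := [set z | _]; have XS z : X z -> S z.1 by case.
have FS z : unit_family S d z -> S z.1 by case.
have rF : ratfun (unit_family S d) (fun z => w z.1) by exact: ratfun_fst rw FS.
have rX : ratfun X (fun z => w z.1) by exact: ratfun_fst rw XS.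
apply: (cls_iso
  (f := fun z : T * (k * k) =>
    (z.1, (z.2.1 - w z.1 * z.2.2, z.2.1 + w z.1 * z.2.2)))
  (g := fun z : T * (k * k) =>
    (z.1, ((z.2.1 + z.2.2) / 2%:R, (z.2.2 - z.2.1) / 2%:R / w z.1)))).
- by regular.
- regular.
  by move=> z /XS; exact: w0.
- move=> [x [z y]] [/= Sx]; rewrite dw//.
  have -> : z * z - w x * w x * (y * y) = (z - w x * y) * (z + w x * y).
    by fold_ring k; ring.
  by rewrite mulf_eq0 negb_or => /andP[].
- move=> [x [p q]] [/= Sx [p0 q0]]; split=> //=; rewrite dw//.
  set y := (q - p) / _ / _; set z := (p + q) / _.
  have wy : w x * y = (q - p) / 2%:R by rewrite mulrC divfK//; exact: w0.
  have -> : z * z - w x * w x * (y * y) = (z - w x * y) * (z + w x * y).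
    by fold_ring k; ring.
  rewrite wy /z -mulrBl -mulrDl.
  have -> : p + q - (q - p) = p + p by fold_ring k; ring.
  have -> : p + q + (q - p) = q + q by fold_ring k; ring.
  by rewrite !half_add mulf_neq0.
- move=> [x [z y]] [/= Sx _]; congr (_, (_, _)).
    have -> : z - w x * y + (z + w x * y) = z + z by fold_ring k; ring.
    by rewrite half_add.
  have -> : z + w x * y - (z - w x * y) = w x * y + w x * y by fold_ring k; ring.
  by rewrite half_add mulrC mulKf//; exact: w0.
- move=> [x [p q]] [/= Sx _].
  have -> : w x * ((q - p) / 2%:R / w x) = (q - p) / 2%:R.
    by rewrite mulrC divfK//; exact: w0.
  rewrite -mulrBl -mulrDl.
  have -> : p + q - (q - p) = p + p by fold_ring k; ring.
  have -> : p + q + (q - p) = q + q by fold_ring k; ring.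
  by rewrite !half_add.
Qed.

(** The complement of the units in the plane is the zero locus of the norm.
    Its points with [y != 0] are parametrized by [y] and the square root
    [z / y] of [d]; the only other one is the origin. *)
Lemma cls_unit_family_ramified S d : basic S -> ratfun S d ->
  (forall x, S x -> d x != 0) ->
  cls (unit_family S d) = (L * L - 1) * cls S - (L - 1) * cls (root_cover S d).
Proof.
move=> bS rd d0.
pose X : set (T * (k * k)) := [set z | S z.1].
pose nrm (z : T * (k * k)) := z.2.1 * z.2.1 - d z.1 * (z.2.2 * z.2.2).
have bX : basic X by exact: basic_fst.
have rn : ratfun X nrm.
  have rX : ratfun X (fun z => d z.1) by exact: ratfun_fst rd _.
  by rewrite /nrm; regular.
pose Y := [set z | X z /\ nrm z = 0].
have bY : basic Y by exact: basic_eq0.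
have cX : cls X = L * L * cls S.
  rewrite mulrC -cls_line -[_ * cls _ in RHS](@cls_prod k k k);
    [|exact: basicT|exact: basicT].
  rewrite -cls_prod//; last by apply: basic_prod; exact: basicT.
  by apply: eq_cls => z; split=> [|[]].
have cY : cls Y = (L - 1) * cls (root_cover S d) + cls S.
  rewrite (cls_split (f := fun z => z.2.2) bY); last by regular.
  congr (_ + _).
    rewrite [RHS]mulrC -cls_mulr_Gm; last exact: root_cover_basic.
    apply: (cls_iso
      (f := fun z : T * (k * k) => ((z.1, z.2.1 / z.2.2), z.2.2))
      (g := fun z : T * k * k => (z.1.1, (z.1.2 * z.2, z.2)))).
    - by regular => z [].
    - by regular.
    - move=> [x [z y]] [[/= Sx]]; rewrite /nrm /= => /eqP.
      rewrite subr_eq0 => /eqP zz y0; split=> //; split=> //=.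
      by rewrite mulf_div zz mulfK ?subrr// mulf_neq0.
    - move=> [[x w] y] [[/= Sx]] /eqP; rewrite subr_eq0 => /eqP ww y0.
      by split=> //; split=> //; rewrite /nrm /= mulrACA ww subrr.
    - by move=> [x [z y]] [_ /= y0]; rewrite divfK.
    - by move=> [[x w] y] [_ /= y0]; rewrite mulfK.
  apply: (cls_iso (f := fst) (g := fun x => (x, (0, 0)))).
  - by regular.
  - by regular.
  - by move=> z [[]].
  - by move=> x Sx; split=> //; split=> //; rewrite /nrm /= !mulr0 subrr.
  - move=> [x [z y]] [[/= Sx]]; rewrite /nrm /= => + y0; rewrite y0 !mulr0 subr0.
    by move=> /eqP; rewrite mulf_eq0 orbb => /eqP ->.
  - by [].
have := cls_split bX rn; rewrite cX cY.
rewrite (_ : [set z | _] = unit_family S d) // => E.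
by rewrite mulrBl E mul1r addrA !addrK.
Qed.

End OneFamily.

(** Adjoining a unit and adjoining a square root of [d] commute: both sides
    are the fibre product over [S]. *)
Lemma cls_root_unit T (cT : has_coords k T) (S : set T) (d : T -> k) :
  cls (root_cover (unit_family S d) (fun z => d z.1)) =
  cls (unit_family (root_cover S d) (fun z => d z.1)).
Proof.
apply: (cls_iso (f := fun z : T * (k * k) * k => ((z.1.1, z.2), z.1.2))
                (g := fun z : T * k * (k * k) => ((z.1.1, z.2), z.1.2))).
- by regular.
- by regular.
- by move=> [[x p] w] [[/= Sx px] wx].
- by move=> [[x w] p] [[/= Sx px] wx].
- by move=> [[x p] w].
- by move=> [[x p] w].
Qed.

Section Peel.
Context {T : Type} {cT : has_coords k T}.
Implicit Types (S : set T).

Definition disc (u b c : T -> k) x : k := u x * u x + b x * c x.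

(** A regular linear form that equals [1] at [(u, b, c)] reads off the
    coefficient [y] of a traceless matrix [y (u, b, c)].  An invertible
    coordinate provides one. *)
Definition unimodular S (u b c : T -> k) := exists r : T -> k * (k * k), regmap S r /\
  forall x, S x -> (r x).1 * u x + (r x).2.1 * b x + (r x).2.2 * c x = 1.

Definition pencil (z y u b c : k) : 'M[k]_2 := z%:M + y *: traceless u b c.

Lemma pencilE z y u b c :
  [/\ pencil z y u b c 0 0 = z + y * u, pencil z y u b c 0 1 = y * b,
      pencil z y u b c 1 0 = y * c & pencil z y u b c 1 1 = z - y * u].
Proof. by rewrite !mxE /= !mulr0n !mulr1n !add0r mulrN. Qed.

Lemma pencil_comm (A : 'M[k]_2) z y u b c :
  A *m traceless u b c = traceless u b c *m A ->
  A *m pencil z y u b c = pencil z y u b c *m A.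
Proof.
by move=> E; rewrite mulmxDr mulmxDl scalar_mxC -scalemxAr -scalemxAl E.
Qed.

Lemma det_pencil z y u b c :
  \det (pencil z y u b c) = z * z - (u * u + b * c) * (y * y).
Proof.
by rewrite det_mx2; have [-> -> -> ->] := pencilE z y u b c; fold_ring k; ring.
Qed.

(** The centralizer of a nonscalar matrix [U] is [k[U]], with coefficients that
    are regular functions of the entries of [A]. *)
Lemma comm_traceless_pencil (A : 'M[k]_2) u b c r1 r2 r3 :
  A *m traceless u b c = traceless u b c *m A ->
  r1 * u + r2 * b + r3 * c = 1 ->
  A = pencil ((A 0 0 + A 1 1) / 2%:R)
    (r1 * ((A 0 0 - A 1 1) / 2%:R) + r2 * A 0 1 + r3 * A 1 0) u b c.
Proof.
move=> /traceless_comm[]; set p := A 0 0; set q := A 0 1; set r := A 1 0.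
set t := A 1 1; set h := (p - t) / _; set y := (X in pencil _ X).
have -> : p - t = h + h by rewrite -mulr2n -[h *+ 2]mulr_natr divfK.
have E2 a : 2%:R * a = a + a by rewrite mulr2n mulrDl mul1r.
rewrite !E2 !mulrDr => qc bh ch r1E.
have I a a' : a + a = a' + a' -> a = a' :> k.
  by move=> e; rewrite -[a]half_add e half_add.
have {}bh := I _ _ bh; have {}ch := I _ _ ch.
have yu : y * u = h.
  have -> : y * u = r1 * h * u + r2 * (u * q) + r3 * (u * r).
    by rewrite /y; fold_ring k; ring.
  rewrite -bh -ch -[RHS]mulr1 -r1E; fold_ring k; ring.
have yb : y * b = q.
  have -> : y * b = r1 * (b * h) + r2 * q * b + r3 * (b * r).
    by rewrite /y; fold_ring k; ring.
  rewrite bh -qc -[RHS]mulr1 -r1E; fold_ring k; ring.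
have yc : y * c = r.
  have -> : y * c = r1 * (c * h) + r2 * (q * c) + r3 * r * c.
    by rewrite /y; fold_ring k; ring.
  rewrite ch qc -[RHS]mulr1 -r1E; fold_ring k; ring.
have [e0 e1 e2 e3] := pencilE ((p + t) / 2%:R) y u b c.
apply: eq_mx2; rewrite ?e0 ?e1 ?e2 ?e3 ?yu ?yb ?yc // /h -?mulrDl -?mulrBl.
  have -> : p + t + (p - t) = p + p by fold_ring k; ring.
  by rewrite half_add.
have -> : p + t - (p - t) = t + t by fold_ring k; ring.
by rewrite half_add.
Qed.

(** The first matrix of a tuple is an arbitrary unit [z + y U] of [k[U]], and
    it commutes with whatever commutes with [U]; so it can be moved from the
    fibre into the base. *)
Lemma cls_peel n S (u b c : T -> k) : ratfun S u -> ratfun S b -> ratfun S c ->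
  unimodular S u b c ->
  cls (centralizer_family n.+1 S u b c) =
  cls (centralizer_family n (unit_family S (disc u b c))
         (fun z => u z.1) (fun z => b z.1) (fun z => c z.1)).
Proof.
move=> ru rb rc [r [rr rE]].
set d := disc u b c.
pose y (z : T * 'rV[k]_(n.+1 * (2 * 2))) := let A := tuple_mx z.2 ord0 in
  (r z.1).1 * ((A 0 0 - A 1 1) / 2%:R) + (r z.1).2.1 * A 0 1
    + (r z.1).2.2 * A 1 0.
pose s (z : T * 'rV[k]_(n.+1 * (2 * 2))) :=
  let A := tuple_mx z.2 ord0 in (A 0 0 + A 1 1) / 2%:R.
set X := centralizer_family n.+1 _ _ _ _.
set Y := centralizer_family n _ _ _ _.
have XS z : X z -> S z.1 by case.
have YS z : Y z -> S z.1.1 by case=> -[].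
have XE z : X z -> tuple_mx z.2 ord0 = pencil (s z) (y z) (u z.1) (b z.1) (c z.1).
  move=> [Sz _ /(_ ord0) /comm_traceless_pencil]; apply; exact: rE.
have rt i p q : ratfun X (fun z => tuple_mx z.2 i p q).
  by apply: ratfun_tuple_mx; regular.
have rX : regmap X (fun z => r z.1) by apply: regmap_comp rr _ XS; regular.
have rYf f : ratfun S f -> ratfun Y (fun z => f z.1.1).
  by move=> rf; apply: ratfun_comp rf _ YS; regular.
have ruY := rYf _ ru; have rbY := rYf _ rb; have rcY := rYf _ rc.
apply: (cls_iso
  (f := fun z : T * 'rV[k]_(n.+1 * (2 * 2)) => ((z.1, (s z, y z)), tail_mx z.2))
  (g := fun z : T * (k * k) * 'rV[k]_(n * (2 * 2)) => (z.1.1,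
    cons_mx (pencil z.1.2.1 z.1.2.2 (u z.1.1) (b z.1.1) (c z.1.1)) z.2))).
- apply: regmap_pair; last by apply: regmap_tail; regular.
  by rewrite /s /y; regular.
- apply: regmap_pair; first by regular.
  apply: regmap_cons; last by regular.
  elim/ord2P; elim/ord2P.
  + apply: (eq_ratfun (f := fun z => z.1.2.1 + z.1.2.2 * u z.1.1)); last by regular.
    by move=> z _; have [-> _ _ _] := pencilE z.1.2.1 z.1.2.2 (u z.1.1) (b z.1.1) (c z.1.1).
  + apply: (eq_ratfun (f := fun z => z.1.2.2 * b z.1.1)); last by regular.
    by move=> z _; have [_ -> _ _] := pencilE z.1.2.1 z.1.2.2 (u z.1.1) (b z.1.1) (c z.1.1).
  + apply: (eq_ratfun (f := fun z => z.1.2.2 * c z.1.1)); last by regular.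
    by move=> z _; have [_ _ -> _] := pencilE z.1.2.1 z.1.2.2 (u z.1.1) (b z.1.1) (c z.1.1).
  + apply: (eq_ratfun (f := fun z => z.1.2.1 - z.1.2.2 * u z.1.1)); last by regular.
    by move=> z _; have [_ _ _ ->] := pencilE z.1.2.1 z.1.2.2 (u z.1.1) (b z.1.1) (c z.1.1).
- move=> z Xz; have Az := XE z Xz; case: Xz => Sz cz Uz.
  move: cz; rewrite -{1}[z.2]tail_mxK => /commuting_GL2_cons[uA cv _].
  split=> //=; last by move=> i; rewrite untupleK; exact: Uz.
  by split=> //=; move: uA; rewrite Az unitmxE unitfE det_pencil.
- move=> [[x [z' y']] v] [[/= Sx dx] cv Uv]; split=> //=.
    apply/commuting_GL2_cons; split=> //.
      by rewrite unitmxE unitfE det_pencil.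
    by move=> i; exact: pencil_comm (Uv i).
  move=> i; case: (unliftP ord0 i) => [j ->|->]; first by rewrite cons_mxS.
  by rewrite cons_mx0; apply/esym; exact: pencil_comm.
- by move=> [x v] Xz /=; rewrite -(XE _ Xz) tail_mxK.
- move=> [[x [z' y']] v] [[/= Sx _] _ _]; rewrite /s /y /= cons_mx0 cons_mxK.
  have [-> -> -> ->] := pencilE z' y' (u x) (b x) (c x).
  congr ((_, (_, _)), _).
    have -> : z' + y' * u x + (z' - y' * u x) = z' + z' by fold_ring k; ring.
    by rewrite half_add.
  have -> : z' + y' * u x - (z' - y' * u x) = y' * u x + y' * u x.
    by fold_ring k; ring.
  by rewrite half_add -[RHS]mulr1 -(rE x Sx); fold_ring k; ring.
Qed.

End Peel.
End UnitFamilies.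

(** * Classes of the families of tuples *)

Section Ramification.
Variable R : comPzRingType.
Add Ring Rring : (comPz_ring_theory R).

(** The coefficient of the class of the double cover in the class of a family of
    [m]-tuples of units; it equals
    [((q^2 - 1)^m - (q - 1)^(2m)) / 2], the division being exact for integral
    polynomials. *)
Fixpoint ramification (q : R) (m : nat) : R :=
  if m is m'.+1
  then (q * q - 1) ^+ m' * (q - 1) + (q - 1) * (q - 1) * ramification q m'
  else 0.

Lemma ramificationS (q : R) m (s r : R) :
  (q * q - 1) ^+ m * ((q * q - 1) * s - (q - 1) * r)
    - ramification q m * ((q - 1) * (q - 1) * r) =
  (q * q - 1) ^+ m.+1 * s - ramification q m.+1 * r.
Proof.
rewrite exprS /=; set x := _ ^+ m; set c := ramification q m.
by fold_ring R; ring.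
Qed.

End Ramification.

Section FamilyClasses.
Variable k : closedFieldType.
Hypothesis k2 : (2%:R : k) != 0.
Local Open Scope classical_set_scope.
Local Notation L := (lefschetz k).

Section Good.
Context {T : Type} {cT : has_coords k T}.
Implicit Types (S : set T).

Record regular_family S (u b c : T -> k) : Prop := RegularFamily {
  rf_basic : basic S;
  rf_u : ratfun S u;
  rf_b : ratfun S b;
  rf_c : ratfun S c;
  rf_unimodular : unimodular S u b c
}.

Lemma ratfun_disc S u b c : regular_family S u b c -> ratfun S (disc u b c).
Proof. by case=> *; rewrite /disc; regular. Qed.

Lemma cls_family0 S u b c :
  cls (centralizer_family 0 S u b c) = cls S.
Proof.
apply: (cls_iso (f := fst) (g := fun x => (x, 0))).
- by regular.
- by apply: regmap_pair; [regular|exact: regmap_cst].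
- by move=> z [].
- by move=> x Sx; split=> [//||[]//]; split=> -[].
- by move=> [x v] _; congr (_, _); apply/rowP => -[].
- by [].
Qed.

End Good.

Lemma regular_unit_family T (cT : has_coords k T) (S : set T) u b c :
  regular_family S u b c ->
  regular_family (unit_family S (disc u b c))
    (fun z => u z.1) (fun z => b z.1) (fun z => c z.1).
Proof.
move=> RF; have rd := ratfun_disc RF.
case: RF => bS ru rb rc [r [rr rE]].
have US z : unit_family S (disc u b c) z -> S z.1 by case.
split.
- exact: unit_family_basic.
- exact: ratfun_fst ru US.
- exact: ratfun_fst rb US.
- exact: ratfun_fst rc US.
- exists (fun z => r z.1); split; last by move=> z /US; exact: rE.
  by apply: regmap_comp rr _ US; regular.
Qed.

(** The unit group of the dual numbers is [G_m x A^1]. *)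
Lemma cls_family_nilpotent n T (cT : has_coords k T) (S : set T) u b c :
  regular_family S u b c -> (forall x, S x -> disc u b c x = 0) ->
  cls (centralizer_family n S u b c) = (L * (L - 1)) ^+ n * cls S.
Proof.
elim: n T cT S u b c => [|n IH] T cT S u b c RF d0.
  by rewrite cls_family0 mul1r.
rewrite cls_peel; try by case: RF.
rewrite IH; [|exact: regular_unit_family|by move=> z [/d0]].
rewrite cls_unit_family_nilpotent //; last by case: RF.
by rewrite exprSr mulrA.
Qed.

Lemma cls_family_split n T (cT : has_coords k T) (S : set T) u b c w :
  regular_family S u b c -> ratfun S w -> (forall x, S x -> w x != 0) ->
  (forall x, S x -> disc u b c x = w x * w x) ->
  cls (centralizer_family n S u b c) = ((L - 1) * (L - 1)) ^+ n * cls S.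
Proof.
elim: n T cT S u b c w => [|n IH] T cT S u b c w RF rw w0 dw.
  by rewrite cls_family0 mul1r.
rewrite cls_peel; try by case: RF.
rewrite (IH _ _ _ _ _ _ (fun z => w z.1)); first last.
- by move=> z [/dw].
- by move=> z [/w0].
- by apply: ratfun_fst rw _ => z [].
- exact: regular_unit_family.
rewrite (cls_unit_family_split k2 (rf_basic RF) rw w0 dw).
by rewrite exprSr mulrA.
Qed.

(** Moving one matrix into the base multiplies the double cover by a split torus
    [G_m^2], as [d] is a square there; hence the recursion for
    [ramification]. *)
Lemma cls_family_ramified n T (cT : has_coords k T) (S : set T) u b c :
  regular_family S u b c -> (forall x, S x -> disc u b c x != 0) ->
  cls (centralizer_family n S u b c) =
  (L * L - 1) ^+ n * cls S - ramification L n * cls (root_cover S (disc u b c)).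
Proof.
elim: n T cT S u b c => [|n IH] T cT S u b c RF d0.
  by rewrite cls_family0 mul1r mul0r subr0.
have bS := rf_basic RF; have rd := ratfun_disc RF.
rewrite cls_peel; try by case: RF.
rewrite IH; [|exact: regular_unit_family|by move=> z [/d0]].
rewrite cls_unit_family_ramified // -ramificationS; congr (_ - _ * _).
rewrite cls_root_unit.
have rs : ratfun (root_cover S (disc u b c)) (fun z => z.2) by regular.
apply: (cls_unit_family_split k2 _ rs); first exact: root_cover_basic.
- move=> z [Sz /eqP]; rewrite subr_eq0 => /eqP zz.
  by apply: contraNneq (d0 _ Sz) => z0; rewrite -zz z0 mulr0.
- by move=> z [Sz /eqP]; rewrite subr_eq0 => /eqP.
Qed.

End FamilyClasses.

(** * Stratification of the first matrix *)

Section Stratification.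
Variable k : closedFieldType.
Hypothesis k2 : (2%:R : k) != 0.
Local Open Scope classical_set_scope.
Add Ring kring : (comPz_ring_theory k).
Local Notation L := (lefschetz k).

Lemma virtual_class_commuting n :
  virtual_class (commuting_variety k n) =
  cls (@commuting_GL2 k n : set 'rV[k]_(n * (2 * 2))).
Proof.
rewrite /cls; case: pselect => [aC|]; last by have := commuting_GL2_affine k n.
exact/virtual_class_iso/isomorphic_refl.
Qed.

(** The point [((s, u), (b, c))] stands for the matrix
    [[s + u, b], [c, s - u]], of determinant [s^2 - (u^2 + b c)]. *)
Let Q : Type := (k * k * (k * k))%type.
Let uQ (z : Q) := z.1.2.
Let bQ (z : Q) := z.2.1.
Let cQ (z : Q) := z.2.2.
Let dQ := disc uQ bQ cQ.
Let GL : set Q := [set z | z.1.1 * z.1.1 - dQ z != 0].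

Let ruQ (S : set Q) : ratfun S uQ. Proof. by rewrite /uQ; regular. Qed.
Let rbQ (S : set Q) : ratfun S bQ. Proof. by rewrite /bQ; regular. Qed.
Let rcQ (S : set Q) : ratfun S cQ. Proof. by rewrite /cQ; regular. Qed.
Let rdQ (S : set Q) : ratfun S dQ.
Proof. by rewrite /dQ /disc; regular. Qed.

Let basicGL : basic GL.
Proof.
have rn : ratfun [set: Q] (fun z => z.1.1 * z.1.1 - dQ z).
  by have rd := rdQ setT; regular.
by refine (basicE _ (basic_neq0 basicT rn)) => x; split=> [[]|].
Qed.

(** The first matrix is [s + U] with [U] traceless, and commuting with it amounts
    to commuting with [U]. *)
Lemma cls_commutingS n :
  cls (@commuting_GL2 k n.+1 : set 'rV[k]_(n.+1 * (2 * 2))) =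
  cls (centralizer_family n GL uQ bQ cQ).
Proof.
pose h (a : k) := a / 2%:R.
pose A (v : 'rV[k]_(n.+1 * (2 * 2))) := tuple_mx v ord0.
set X := (X in cls X = _).
have rA i j : ratfun X (fun v => A v i j) by apply: ratfun_tuple_mx; regular.
have PE (M : 'M[k]_2) : pencil (h (M 0 0 + M 1 1)) 1 (h (M 0 0 - M 1 1)) (M 0 1)
    (M 1 0) = M.
  have [e0 e1 e2 e3] := pencilE (h (M 0 0 + M 1 1)) 1 (h (M 0 0 - M 1 1))
    (M 0 1) (M 1 0).
  apply: eq_mx2; rewrite ?e0 ?e1 ?e2 ?e3 ?mul1r // /h -?mulrDl -?mulrBl.
    by rewrite addrACA subrr addr0 half_add.
  have -> : M 0 0 + M 1 1 - (M 0 0 - M 1 1) = M 1 1 + M 1 1.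
    by fold_ring k; ring.
  by rewrite half_add.
have P1 s u b c : pencil s 1 u b c = s%:M + traceless u b c.
  by rewrite /pencil scale1r.
have commP (M : 'M[k]_2) s u b c : M *m traceless u b c = traceless u b c *m M <->
    M *m pencil s 1 u b c = pencil s 1 u b c *m M.
  split=> [|E]; first exact: pencil_comm.
  apply: (@addrI _ (M *m s%:M)); rewrite -mulmxDr -P1 E P1 mulmxDl.
  by rewrite scalar_mxC.
apply: (cls_iso
  (f := fun v : 'rV[k]_(n.+1 * (2 * 2)) =>
    (((h (A v 0 0 + A v 1 1), h (A v 0 0 - A v 1 1)), (A v 0 1, A v 1 0)),
     tail_mx v))
  (g := fun z : Q * 'rV[k]_(n * (2 * 2)) =>
    cons_mx (pencil z.1.1.1 1 z.1.1.2 z.1.2.1 z.1.2.2) z.2)).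
- apply: regmap_pair; last by apply: regmap_tail; regular.
  by rewrite /h; regular.
- apply: regmap_cons; last by regular.
  elim/ord2P; elim/ord2P.
  + apply: (eq_ratfun (f := fun z : Q * 'rV[k]_(n * (2 * 2)) => z.1.1.1 + 1 * z.1.1.2)).
      by move=> z _; have [-> _ _ _] := pencilE z.1.1.1 1 z.1.1.2 z.1.2.1 z.1.2.2.
    by regular.
  + apply: (eq_ratfun (f := fun z : Q * 'rV[k]_(n * (2 * 2)) => 1 * z.1.2.1)).
      by move=> z _; have [_ -> _ _] := pencilE z.1.1.1 1 z.1.1.2 z.1.2.1 z.1.2.2.
    by regular.
  + apply: (eq_ratfun (f := fun z : Q * 'rV[k]_(n * (2 * 2)) => 1 * z.1.2.2)).
      by move=> z _; have [_ _ -> _] := pencilE z.1.1.1 1 z.1.1.2 z.1.2.1 z.1.2.2.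
    by regular.
  + apply: (eq_ratfun (f := fun z : Q * 'rV[k]_(n * (2 * 2)) => z.1.1.1 - 1 * z.1.1.2)).
      by move=> z _; have [_ _ _ ->] := pencilE z.1.1.1 1 z.1.1.2 z.1.2.1 z.1.2.2.
    by regular.
- move=> v; rewrite /X -{1}[v]tail_mxK => /commuting_GL2_cons[uA cv Av].
  split=> //=; last first.
    move=> i; rewrite /uQ /bQ /cQ /=.
    by apply/(commP _ (h (A v 0 0 + A v 1 1))); rewrite PE.
  by move: uA; rewrite -[tuple_mx v ord0]PE unitmxE unitfE det_pencil !mulr1.
- move=> [[[s u] [b c]] v] [/= Gz cv Uv]; apply/commuting_GL2_cons; split=> //.
    by rewrite unitmxE unitfE det_pencil !mulr1.
  by move=> i; apply/commP; exact: Uv.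
- by move=> v _; rewrite /= (PE (A v)) tail_mxK.
- move=> [[[s u] [b c]] v] _; rewrite /A /= cons_mx0 cons_mxK.
  have [-> -> -> ->] := pencilE s 1 u b c.
  rewrite !mul1r /h addrACA subrr addr0 half_add //.
  have -> : s + u - (s - u) = u + u by fold_ring k; ring.
  by rewrite half_add.
Qed.

Lemma cls_family_cut n T (cT : has_coords k T) (S : set T) u b c f :
  basic S -> ratfun S u -> ratfun S b -> ratfun S c -> ratfun S f ->
  cls (centralizer_family n S u b c) =
  cls (centralizer_family n [set x | S x /\ f x != 0] u b c) +
  cls (centralizer_family n [set x | S x /\ f x = 0] u b c).
Proof.
move=> bS ru rb rc rf.
have bF := centralizer_family_basic n bS ru rb rc.
have rF : ratfun (centralizer_family n S u b c) (fun z => f z.1).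
  by apply: ratfun_fst rf _ => z [].
rewrite (cls_split bF rF); congr (_ + _); apply: eq_cls => z.
  by split=> [[[Sz cz Uz] fz]|[[Sz fz] cz Uz]].
by split=> [[[Sz cz Uz] fz]|[[Sz fz] cz Uz]].
Qed.

(** The pairs [(d, s)] with [d] and [s^2 - d] nonzero, and the pairs [(w, s)]
    with [w] and [s^2 - w^2] nonzero: the discriminant and half the trace of an
    invertible matrix with distinct eigenvalues, before and after the choice of
    a square root of the discriminant. *)
Let D1 : set (k * k) := [set z | z.1 != 0 /\ z.2 * z.2 - z.1 != 0].
Let D2 : set (k * k) := [set z | z.1 != 0 /\ z.2 * z.2 - z.1 * z.1 != 0].

Let basicD1 : basic D1.
Proof.
by refine (basic_neq0 (basic_fst (B := k) (@basic_Gm k)) _); regular.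
Qed.

Let basicD2 : basic D2.
Proof.
by refine (basic_neq0 (basic_fst (B := k) (@basic_Gm k)) _); regular.
Qed.

Let clsD1 : cls D1 = (L - 1) * L - (L - 1).
Proof.
pose X : set (k * k) := [set z | z.1 != 0].
have bX : basic X by exact: (basic_fst (@basic_Gm k)).
have rX : ratfun X (fun z => z.2 * z.2 - z.1) by regular.
have cX : cls X = (L - 1) * L by rewrite -cls_Gm -cls_mulr_line//; exact: basic_Gm.
rewrite -cX (cls_split bX rX) -[LHS](addrK (L - 1)); congr (_ + _ - _).
rewrite -cls_Gm; apply: (cls_iso (f := fun w => (w * w, w)) (g := snd)).
- by regular.
- by regular.
- by move=> w w0; split; rewrite /X /= ?mulf_neq0 ?subrr.
- move=> [d w] [/= d0 /eqP]; rewrite subr_eq0 => /eqP dw.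
  by apply: contraNneq d0 => w0; rewrite -dw w0 mulr0.
- by [].
- by move=> [d w] [/= d0 /eqP]; rewrite subr_eq0 => /eqP ->.
Qed.

Let cls_minus2 : cls [set x : k | x * x - 1 != 0] = L - 1 - 1.
Proof.
have r1 : ratfun [set: k] (fun x => x * x - 1) by regular.
have b0 := basic_eq0 basicT r1; set X0 := [set _ | _] in b0.
have r2 : ratfun X0 (fun x => x - 1) by regular.
rewrite -cls_line (cls_split basicT r1) (cls_split b0 r2).
rewrite [cls [set x | X0 x /\ x - 1 = 0]](_ : _ = 1); last first.
  rewrite -(cls_point (1 : k)); apply: eq_cls => x; split=> [[_ /eqP]|->].
    by rewrite subr_eq0 => /eqP.
  by rewrite /X0 /= mulr1 subrr.
rewrite [cls [set x | X0 x /\ x - 1 != 0]](_ : _ = 1); last first.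
  rewrite -(cls_point (-1 : k)); apply: eq_cls => x; split=> [[[_ xx] x1]|->].
    have /eqP : (x - 1) * (x + 1) = 0.
      by rewrite -xx; fold_ring k; ring.
    by rewrite mulf_eq0 (negbTE x1) addr_eq0 => /eqP.
  split; first by split=> //; rewrite mulrNN mulr1 subrr.
  by rewrite -opprD oppr_eq0 -[1 + 1]/(2%:R : k).
by rewrite addrA !addrK; apply: eq_cls => x; split=> [|[]].
Qed.

(** The ratio [s / w] ranges over the line without [1] and [-1]. *)
Let clsD2 : cls D2 = (L - 1) * (L - 1 - 1).
Proof.
have b2 : basic [set x : k | x * x - 1 != 0].
  have r1 : ratfun [set: k] (fun x => x * x - 1) by regular.
  by refine (basicE _ (basic_neq0 basicT r1)) => x; split=> [[]|].
rewrite -cls_minus2 -cls_Gm -cls_prod//; last exact: basic_Gm.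
apply: (cls_iso (f := fun z => (z.1, z.2 / z.1)) (g := fun z => (z.1, z.2 * z.1))).
- by regular => z [].
- by regular.
- move=> [w s] [/= w0 sw]; split=> //=.
  by rewrite mulf_div -[X in _ - X](divff (mulf_neq0 w0 w0)) -mulrBl mulf_neq0
    ?invr_neq0 ?mulf_neq0.
- move=> [w s] [/= w0 sw]; split=> //=.
  by rewrite mulrACA -{2}[w * w]mul1r -mulrBl !mulf_neq0.
- by move=> [w s] [/= w0 sw]; rewrite divfK.
- by move=> [w s] [/= w0 sw]; rewrite mulfK.
Qed.

(** [GLb1], [GLb0], [GLc1], [GLc0], [GLu] and [GLs] partition [GL].  On [GLc1]
    and [GLu] the discriminant is [u^2], so [u] is a square root of it. *)
Let GLb : set Q := [set z | GL z /\ bQ z != 0].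
Let GLb1 : set Q := [set z | GLb z /\ dQ z != 0].
Let GLb0 : set Q := [set z | GLb z /\ dQ z = 0].
Let GL0 : set Q := [set z | GL z /\ bQ z = 0].
Let GLc : set Q := [set z | GL0 z /\ cQ z != 0].
Let GLc1 : set Q := [set z | GLc z /\ uQ z != 0].
Let GLc0 : set Q := [set z | GLc z /\ uQ z = 0].
Let GL00 : set Q := [set z | GL0 z /\ cQ z = 0].
Let GLu : set Q := [set z | GL00 z /\ uQ z != 0].
Let GLs : set Q := [set z | GL00 z /\ uQ z = 0].

Let basicGLb : basic GLb. Proof. exact: basic_neq0. Qed.
Let basicGLb1 : basic GLb1. Proof. exact: basic_neq0. Qed.
Let basicGLb0 : basic GLb0. Proof. exact: basic_eq0. Qed.
Let basicGL0 : basic GL0. Proof. exact: basic_eq0. Qed.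
Let basicGLc : basic GLc. Proof. exact: basic_neq0. Qed.
Let basicGLc1 : basic GLc1. Proof. exact: basic_neq0. Qed.
Let basicGLc0 : basic GLc0. Proof. exact: basic_eq0. Qed.
Let basicGL00 : basic GL00. Proof. exact: basic_eq0. Qed.
Let basicGLu : basic GLu. Proof. exact: basic_neq0. Qed.

Let regular_b (S : set Q) : basic S -> S `<=` GLb -> regular_family S uQ bQ cQ.
Proof.
move=> bS SG; split=> //; exists (fun z => (0, ((bQ z)^-1, 0))); split.
  by have rb := rbQ S; regular => z /SG[].
by move=> z /SG[_ b0]; rewrite /= !mul0r add0r addr0 mulVf.
Qed.

Let regular_c (S : set Q) : basic S -> S `<=` GLc -> regular_family S uQ bQ cQ.
Proof.
move=> bS SG; split=> //; exists (fun z => (0, (0, (cQ z)^-1))); split.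
  by have rb := rcQ S; regular => z /SG[].
by move=> z /SG[_ b0]; rewrite /= !mul0r !add0r mulVf.
Qed.

Let regular_u (S : set Q) : basic S -> S `<=` GLu -> regular_family S uQ bQ cQ.
Proof.
move=> bS SG; split=> //; exists (fun z => ((uQ z)^-1, (0, 0))); split.
  by have rb := ruQ S; regular => z /SG[].
by move=> z /SG[_ b0]; rewrite /= !mul0r !addr0 mulVf.
Qed.

Let clsGLb0 : cls GLb0 = (L - 1) * (L - 1) * L.
Proof.
have bG2 := basic_prod (@basic_Gm k) (@basic_Gm k).
rewrite -!cls_Gm -cls_prod; try exact: basic_Gm.
rewrite -cls_mulr_line//.
apply: (cls_iso (f := fun z : Q => ((z.1.1, z.2.1), z.1.2))
  (g := fun z : k * k * k => ((z.1.1, z.2), (z.1.2, - (z.2 * z.2) / z.1.2)))).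
- by regular.
- by regular => z [].
- move=> [[s u] [b c]] [[/= Gz b0] d0]; split=> //=.
  by move: Gz; rewrite /GL /= d0 subr0 mulf_eq0 orbb.
- move=> [[s b] u] [/= s0 b0].
  have d0 : dQ ((s, u), (b, - (u * u) / b)) = 0.
    by rewrite /dQ /disc /uQ /bQ /cQ /= [b * _]mulrC divfK// subrr.
  by split=> //; split=> //; rewrite /GL /= d0 subr0 mulf_neq0.
- move=> [[s u] [b c]] [[/= Gz b0] d0] /=; congr (_, (_, _)).
  move: d0; rewrite /dQ /disc /uQ /bQ /cQ /= => /eqP; rewrite addr_eq0 => /eqP ->.
  by rewrite opprK mulrC mulKf.
- by case=> -[].
Qed.

(** Since [b] is invertible, the entry [c] can be traded for the
    discriminant. *)
Let clsGLb1 : cls GLb1 = cls D1 * (L - 1) * L.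
Proof.
have bDG := basic_prod basicD1 (@basic_Gm k).
rewrite -cls_mulr_Gm// -cls_mulr_line//.
have rd := rdQ GLb1.
apply: (cls_iso (f := fun z : Q => (((dQ z, z.1.1), z.2.1), z.1.2))
  (g := fun z : k * k * k * k =>
    ((z.1.1.2, z.2), (z.1.2, (z.1.1.1 - z.2 * z.2) / z.1.2)))).
- by regular.
- by regular => z [].
- by move=> [[s u] [b c]] [[/= Gz b0] d0].
- move=> [[[d s] b] u] [[/= d0 sd] b0].
  have dE : dQ ((s, u), (b, (d - u * u) / b)) = d.
    by rewrite /dQ /disc /uQ /bQ /cQ /= [b * _]mulrC divfK// addrC subrK.
  by rewrite /GLb1 /GLb /GL /= dE.
- move=> [[s u] [b c]] [[/= Gz b0] d0] /=; congr (_, (_, _)).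
  by rewrite /dQ /disc /uQ /bQ /cQ /= addrC addKr mulrC mulKf.
- move=> [[[d s] b] u] [[/= d0 sd] b0] /=; congr (_, _, _, _).
  by rewrite /dQ /disc /uQ /bQ /cQ /= [b * _]mulrC divfK// addrC subrK.
Qed.

Let clsRGLb1 : cls (root_cover GLb1 dQ) = cls D2 * (L - 1) * L.
Proof.
have bDG := basic_prod basicD2 (@basic_Gm k).
rewrite -cls_mulr_Gm// -cls_mulr_line//.
apply: (cls_iso (f := fun z : Q * k => (((z.2, z.1.1.1), z.1.2.1), z.1.1.2))
  (g := fun z : k * k * k * k =>
    (((z.1.1.2, z.2), (z.1.2, (z.1.1.1 * z.1.1.1 - z.2 * z.2) / z.1.2)), z.1.1.1))).
- by regular.
- by regular => z [].
- move=> [[[s u] [b c]] w] [[[/= Gz b0] d0] /= /eqP]; rewrite subr_eq0 => /eqP ww.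
  split=> //; split=> //=; last by rewrite ww.
  by apply: contraNneq d0 => w0; rewrite -ww w0 mulr0.
- move=> [[[w s] b] u] [[/= d0 sd] b0].
  have dE : dQ ((s, u), (b, (w * w - u * u) / b)) = w * w.
    by rewrite /dQ /disc /uQ /bQ /cQ /= [b * _]mulrC divfK// addrC subrK.
  by rewrite /root_cover /GLb1 /GLb /GL /= dE subrr mulf_neq0.
- move=> [[[s u] [b c]] w] [[[/= Gz b0] d0] /= /eqP]; rewrite subr_eq0 => /eqP ww /=.
  congr (_, (_, _), _).
  by rewrite ww /dQ /disc /uQ /bQ /cQ /= addrC addKr mulrC mulKf.
- by move=> [[[w s] b] u] _.
Qed.

Let clsGLc0 : cls GLc0 = (L - 1) * (L - 1).
Proof.
rewrite -!cls_Gm -cls_prod; try exact: basic_Gm.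
apply: (cls_iso (f := fun z : Q => (z.1.1, z.2.2))
  (g := fun z : k * k => ((z.1, 0), (0, z.2)))).
- by regular.
- by regular.
- move=> [[s u] [b c]] [[[+ b0] c0] u0]; rewrite /uQ /bQ /cQ /= in b0 c0 u0 *.
  rewrite /GL /dQ /disc /uQ /bQ /cQ /= b0 u0 !mul0r addr0 subr0.
  by rewrite mulf_eq0 orbb.
- move=> [s c] [/= s0 c0]; split=> //; split=> //; split=> //.
  by rewrite /GL /dQ /disc /uQ /bQ /cQ /= !mul0r addr0 subr0 mulf_neq0.
- move=> [[s u] [b c]] [[[+ b0] c0] u0]; rewrite /uQ /bQ /cQ /= in b0 c0 u0 *.
  by rewrite b0 u0.
- by case.
Qed.

Let clsGLc1 : cls GLc1 = cls D2 * (L - 1).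
Proof.
rewrite -!cls_mulr_Gm//.
apply: (cls_iso (f := fun z : Q => ((z.1.2, z.1.1), z.2.2))
  (g := fun z : k * k * k => ((z.1.2, z.1.1), (0, z.2)))).
- by regular.
- by regular.
- move=> [[s u] [b c]] [[[+ b0] c0] u0]; rewrite /uQ /bQ /cQ /= in b0 c0 u0 *.
  by rewrite /GL /dQ /disc /uQ /bQ /cQ /= b0 !mul0r addr0.
- move=> [[u s] c] [[/= u0 su] c0]; split=> //; split=> //; split=> //.
  by rewrite /GL /dQ /disc /uQ /bQ /cQ /= !mul0r addr0.
- move=> [[s u] [b c]] [[[+ b0] c0] u0]; rewrite /uQ /bQ /cQ /= in b0 c0 u0 *.
  by rewrite b0.
- by case=> -[].
Qed.

Let clsGLu : cls GLu = cls D2.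
Proof.
apply: (cls_iso (f := fun z : Q => (z.1.2, z.1.1))
  (g := fun z : k * k => ((z.2, z.1), (0, 0)))).
- by regular.
- by regular.
- move=> [[s u] [b c]] [[[+ b0] c0] u0]; rewrite /uQ /bQ /cQ /= in b0 c0 u0 *.
  by rewrite /GL /dQ /disc /uQ /bQ /cQ /= b0 !mul0r addr0.
- move=> [u s] [/= u0 su]; split=> //; split=> //; split=> //.
  by rewrite /GL /dQ /disc /uQ /bQ /cQ /= !mul0r addr0.
- move=> [[s u] [b c]] [[[+ b0] c0] u0]; rewrite /uQ /bQ /cQ /= in b0 c0 u0 *.
  by rewrite b0 c0.
- by case.
Qed.

Lemma commuting_GL2_basic n :
  basic (@commuting_GL2 k n : set 'rV[k]_(n * (2 * 2))).
Proof.
have rid : regmap [set: 'rV[k]_(n * (2 * 2))] (fun v => v) by regular.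
by refine (basicE _ (basic_commuting basicT rid)) => v; split=> [[]|].
Qed.

Let cls_scalar n : cls (centralizer_family n GLs uQ bQ cQ) =
  (L - 1) * cls (@commuting_GL2 k n : set 'rV[k]_(n * (2 * 2))).
Proof.
rewrite -cls_Gm -cls_prod; [|exact: basic_Gm|exact: commuting_GL2_basic].
apply: (cls_iso (f := fun z : Q * 'rV[k]_(n * (2 * 2)) => (z.1.1.1, z.2))
  (g := fun z : k * 'rV[k]_(n * (2 * 2)) => (((z.1, 0), (0, 0)), z.2))).
- by regular.
- by regular.
- move=> [[[s u] [b c]] v] [[[[+ b0] c0] u0] cv _].
  rewrite /uQ /bQ /cQ /= in b0 c0 u0 *.
  rewrite /GL /dQ /disc /uQ /bQ /cQ /= b0 u0 !mul0r addr0 subr0.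
  by rewrite mulf_eq0 orbb.
- move=> [s v] [/= s0 cv]; split=> //=.
    split=> //; split=> //; split=> //.
    by rewrite /GL /dQ /disc /uQ /bQ /cQ /= !mul0r addr0 subr0 mulf_neq0.
  move=> i; rewrite /uQ /bQ /cQ /= (_ : traceless 0 0 0 = 0).
    by rewrite mulmx0 mul0mx.
  by apply: eq_mx2; rewrite !mxE /= ?oppr0.
- move=> [[[s u] [b c]] v] [[[[+ b0] c0] u0] cv _].
  rewrite /uQ /bQ /cQ /= in b0 c0 u0 *.
  by rewrite b0 c0 u0.
- by case.
Qed.

(** The terms are the contributions of [GLb1] (two terms), [GLb0], [GLc1],
    [GLc0], [GLu] and [GLs]. *)
Definition commuting_step (R : comPzRingType) (q : R) n (C : R) : R :=
  (q * q - 1) ^+ n * (((q - 1) * q - (q - 1)) * (q - 1) * q)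
    - ramification q n * ((q - 1) * (q - 1 - 1) * (q - 1) * q)
  + (q * (q - 1)) ^+ n * ((q - 1) * (q - 1) * q)
  + (((q - 1) * (q - 1)) ^+ n * ((q - 1) * (q - 1 - 1) * (q - 1))
    + (q * (q - 1)) ^+ n * ((q - 1) * (q - 1))
    + (((q - 1) * (q - 1)) ^+ n * ((q - 1) * (q - 1 - 1)) + (q - 1) * C)).

Lemma cls_commuting_recursion n :
  cls (@commuting_GL2 k n.+1 : set 'rV[k]_(n.+1 * (2 * 2))) =
  commuting_step L n (cls (@commuting_GL2 k n : set 'rV[k]_(n * (2 * 2)))).
Proof.
rewrite cls_commutingS (cls_family_cut n basicGL (f := bQ)) //.
rewrite -/GLb -/GL0 (cls_family_cut n basicGLb (f := dQ)) // -/GLb1 -/GLb0.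
rewrite (cls_family_cut n basicGL0 (f := cQ)) // -/GLc -/GL00.
rewrite (cls_family_cut n basicGLc (f := uQ)) // -/GLc1 -/GLc0.
rewrite (cls_family_cut n basicGL00 (f := uQ)) // -/GLu -/GLs.
rewrite cls_scalar /commuting_step; congr (_ + _ + (_ + _ + (_ + _))).
- rewrite (cls_family_ramified k2) -/dQ; first by rewrite clsGLb1 clsD1 clsRGLb1 clsD2.
    by apply: regular_b => // z [].
  by move=> z [].
- rewrite (cls_family_nilpotent k2) ?clsGLb0 //.
    by apply: regular_b => // z [].
  by move=> z [].
- rewrite (cls_family_split k2 n (w := uQ)) ?clsGLc1 ?clsD2 //.
  + by apply: regular_c => // z [].
  + by move=> z [].
  + by move=> z [[[_ b0]]]; rewrite /disc b0 mul0r addr0.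
- rewrite (cls_family_nilpotent k2) ?clsGLc0 //.
    by apply: regular_c => // z [].
  by move=> z [[[_ b0] _] u0]; rewrite /disc b0 u0 !mul0r addr0.
- rewrite (cls_family_split k2 n (w := uQ)) ?clsGLu ?clsD2 //.
  + exact: regular_u.
  + by move=> z [].
  + by move=> z [[[_ b0]]]; rewrite /disc b0 mul0r addr0.
Qed.

End Stratification.

(** * Solution of the recursion *)

Section Evaluation.
Variables (R : comPzRingType) (x : R).
Implicit Types P Q : {poly int}.

Lemma int_poly_eval_wide P n : (size P <= n)%N ->
  int_poly_eval P x = \sum_(i < n) (P`_i)%:~R * x ^+ i.
Proof.
move=> Pn; rewrite /int_poly_eval.
rewrite (big_ord_widen n (fun i => (P`_i)%:~R * x ^+ i) Pn) big_mkcond /=.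
apply: eq_bigr => i _; case: ltnP => // /(nth_default 0) ->.
by rewrite mul0r.
Qed.

(** A named function, so that it can carry the structure of a ring
    homomorphism. *)
Definition int_poly_at P := int_poly_eval P x.

Lemma int_poly_at_zmod : zmod_morphism int_poly_at.
Proof.
rewrite /int_poly_at => P Q; set n := maxn (size P) (size Q).
rewrite (@int_poly_eval_wide _ n); last first.
  by rewrite (leq_trans (size_polyD _ _))// size_polyN.
rewrite (@int_poly_eval_wide P n) ?leq_maxl// (@int_poly_eval_wide Q n) ?leq_maxr//.
rewrite -sumrB; apply: eq_bigr => i _.
by rewrite coefB intrB mulrBl.
Qed.

Lemma int_poly_evalD P Q :
  int_poly_eval (P + Q) x = int_poly_eval P x + int_poly_eval Q x.
Proof.
have E0 : int_poly_eval 0 x = 0 by rewrite /int_poly_eval size_poly0 big_ord0.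
have EB := int_poly_at_zmod; rewrite /int_poly_at in EB.
by rewrite -[Q in LHS]opprK EB -[- Q]sub0r EB E0 sub0r opprK.
Qed.

Lemma int_poly_evalC c : int_poly_eval c%:P x = c%:~R.
Proof.
rewrite (@int_poly_eval_wide _ 1) ?size_polyC_leq1// big_ord1 coefC /=.
by rewrite expr0 mulr1.
Qed.

Lemma int_poly_evalCM c P : int_poly_eval (c%:P * P) x = c%:~R * int_poly_eval P x.
Proof.
rewrite (@int_poly_eval_wide _ (size P)); last first.
  by rewrite mul_polyC; exact: size_scale_leq.
rewrite /int_poly_eval mulr_sumr; apply: eq_bigr => i _.
by rewrite coefCM intrM mulrA.
Qed.

Lemma int_poly_evalXM P : int_poly_eval (P * 'X) x = int_poly_eval P x * x.
Proof.
rewrite (@int_poly_eval_wide _ (size P).+1); last first.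
  have [->|P0] := eqVneq P 0; first by rewrite mul0r size_poly0.
  by rewrite size_mulX.
rewrite big_ord_recl coefMX /= mul0r add0r /int_poly_eval mulr_suml.
by apply: eq_bigr => i _; rewrite coefMX /= exprSr mulrA.
Qed.

Lemma int_poly_at_monoid : monoid_morphism int_poly_at.
Proof.
rewrite /int_poly_at; split; first by rewrite -polyC1 int_poly_evalC.
elim/poly_ind => [|P c IH] Q.
  by rewrite mul0r -[0]polyC0 int_poly_evalC mul0r.
rewrite mulrDl !int_poly_evalD int_poly_evalCM int_poly_evalC mulrDl.
by rewrite mulrAC !int_poly_evalXM IH mulrAC.
Qed.

HB.instance Definition _ := GRing.isZmodMorphism.Build {poly int} R
  int_poly_at int_poly_at_zmod.
HB.instance Definition _ := GRing.isMonoidMorphism.Build {poly int} R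
  int_poly_at int_poly_at_monoid.

Lemma int_poly_evalX : int_poly_eval 'X x = x.
Proof. by rewrite -['X]mul1r int_poly_evalXM -polyC1 int_poly_evalC mul1r. Qed.

End Evaluation.

Section Recursion.
Variable R : comPzRingType.
Add Ring Rring : (comPz_ring_theory R).
Variable q : R.

Fixpoint commuting_class (n : nat) : R :=
  if n is m.+1 then commuting_step q m (commuting_class m) else 1.

Lemma ramificationE n :
  2%:R * ramification q n = (q * q - 1) ^+ n - ((q - 1) * (q - 1)) ^+ n.
Proof.
elim: n => [|n IH]; first by rewrite mulr0 subrr.
rewrite /= !exprS; move: IH; set x := _ ^+ n; set y := _ ^+ n => IH.
have -> : 2%:R * (x * (q - 1) + (q - 1) * (q - 1) * ramification q n) =
  2%:R * x * (q - 1) + (q - 1) * (q - 1) * (2%:R * ramification q n).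
  by rewrite mulr2n; fold_ring R; ring.
by rewrite IH mulr2n; fold_ring R; ring.
Qed.

(** Clearing the denominator keeps the identity meaningful in rings where [2]
    is not invertible. *)
Lemma commuting_classE n : 2%:R * commuting_class n =
  2%:R * (q + 1) * (q * (q - 1)) ^+ n - 2%:R * q * (q + 1) * (q - 1) ^+ n
  + q * (q - 1) * (q * q - 1) ^+ n + q * (q + 1) * ((q - 1) * (q - 1)) ^+ n.
Proof.
elim: n => [|n IH]; first by rewrite !expr0 /= mulr2n; fold_ring R; ring.
have := ramificationE n; move: IH => /=; rewrite /commuting_step !exprS.
set a := (q * (q - 1)) ^+ n; set b := (q - 1) ^+ n; set c := (q * q - 1) ^+ n.
set d := ((q - 1) * (q - 1)) ^+ n; set r := ramification q n.
set C := commuting_class n => IH rE.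
pose E := c * (((q - 1) * q - (q - 1)) * (q - 1) * q)
  + a * ((q - 1) * (q - 1) * q)
  + (d * ((q - 1) * (q - 1 - 1) * (q - 1)) + a * ((q - 1) * (q - 1))
  + d * ((q - 1) * (q - 1 - 1))).
transitivity (2%:R * E + (q - 1) * (2%:R * C)
   - (2%:R * r) * ((q - 1) * (q - 1 - 1) * (q - 1) * q)).
  by rewrite /E mulr2n; fold_ring R; ring.
by rewrite IH rE /E mulr2n; fold_ring R; ring.
Qed.

Lemma commuting_class_closed_form m : 2%:R * commuting_class m.+1 =
  q * (q ^+ 2 - 1) * (2%:R * (q ^+ 2 - q) ^+ m - 2%:R * (q - 1) ^+ m
    + (q - 1) * (q ^+ 2 - 1) ^+ m + (q - 1) ^+ (2 * m).+1).
Proof.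
rewrite commuting_classE [_ ^+ (2 * m).+1]exprS exprM !expr2 !exprS.
have -> : q * q - q = q * (q - 1) by fold_ring R; ring.
set a := (q * (q - 1)) ^+ m; set b := (q - 1) ^+ m; set c := (q * q - 1) ^+ m.
set d := ((q - 1) * (q - 1)) ^+ m.
by rewrite mulr2n; fold_ring R; ring.
Qed.

End Recursion.

Lemma rmorph_ramification (R S : comPzRingType) (f : {rmorphism R -> S}) q n :
  f (ramification q n) = ramification (f q) n.
Proof.
elim: n => [|n IH] /=; first exact: rmorph0.
by rewrite rmorphD !rmorphM rmorphXn !rmorphB !rmorphM rmorph1 IH.
Qed.

(** Applied to the two ring homomorphisms out of the integral polynomials, into
    the rational polynomials and into the Grothendieck ring. *)
Lemma rmorph_commuting_class (R S : comPzRingType) (f : {rmorphism R -> S}) q n :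
  f (commuting_class q n) = commuting_class (f q) n.
Proof.
elim: n => [|n IH] /=; first exact: rmorph1.
rewrite /commuting_step !(rmorphD, rmorphN, rmorphM, rmorphXn).
by rewrite rmorph_ramification rmorph1 IH.
Qed.

Lemma commuting_class_poly_rat m :
  map_poly intr (commuting_class ('X : {poly int}) m.+1) =
  (1 / 2)%:P * 'X * ('X ^+ 2 - 1) *
    (2 * ('X ^+ 2 - 'X) ^+ m - 2 * ('X - 1) ^+ m
     + ('X - 1) * ('X ^+ 2 - 1) ^+ m + ('X - 1) ^+ (2 * m).+1) :> {poly rat}.
Proof.
rewrite (rmorph_commuting_class (map_poly (intr : int -> rat))) /= map_polyX.
have E := commuting_class_closed_form ('X : {poly rat}) m.
have half2 : (1 / 2%:R : rat)%:P * 2%:R = 1 :> {poly rat}.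
  by rewrite -(rmorph_nat (@polyC rat) 2) -polyCM mul1r mulVf // polyC1.
set C := commuting_class _ _ in E *.
transitivity ((1 / 2%:R : rat)%:P * (2%:R * C)); first by rewrite mulrA half2 mul1r.
by rewrite E !mulrA.
Qed.

Section CommutingClass.
Variable k : closedFieldType.
Hypothesis k2 : (2%:R : k) != 0.

Lemma virtual_class_commutingE n :
  virtual_class (commuting_variety k n) =
  int_poly_eval (commuting_class 'X n) (lefschetz k).
Proof.
rewrite virtual_class_commuting -[RHS]/(int_poly_at (lefschetz k) _).
rewrite rmorph_commuting_class /= /int_poly_at int_poly_evalX.
elim: n => [|n IH]; last by rewrite cls_commuting_recursion // IH.
rewrite -[RHS]/(1 : K0 k) -(cls_unit k).
apply: (cls_iso (f := fun=> tt) (g := fun=> 0)) => //.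
- exact: regmap_cst.
- exact: regmap_cst.
- by move=> _ _; split=> -[].
- by move=> v _; apply/rowP => -[].
- by case.
Qed.

End CommutingClass.

(** * Length of chains of irreducible closed sets *)

Section Zariski.
Variables (k : closedFieldType) (N : nat) (S : set (affine_space k N)).
Local Open Scope classical_set_scope.
Local Notation X := (sub_space S).
Implicit Types (Z : set X) (p q : {mpoly k[N]}).

Definition ev (z : X) p : k := p.@[(val z : 'rV[k]_N) 0].

Lemma closed_ev0 p : closed [set z : X | ev z p = 0].
Proof.
apply: regular_zeros_closed => x.
have [_ rv] := @sub_space_val _ (affine_space k N) S.
exact: rv (affine_reg_mpoly p (val x)).
Qed.

(** Closed sets of the induced topology are cut out by polynomials. *)
Lemma closed_separated Z (x : X) : closed Z -> ~ Z x ->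
  exists2 p, (forall z, Z z -> ev z p = 0) & ev x p != 0.
Proof.
rewrite -openC => -[B [P ->] BZ] Zx.
have /existsNP[p /not_implyP[Pp /eqP px]] : ~ zeros P (val x).
  by have : (~` Z) x by []; rewrite -BZ.
exists p => // z Zz; have zP : zeros P (val z).
  apply: contrapT => zP; have : (~` Z) z by rewrite -BZ.
  exact.
exact: zP.
Qed.

Lemma irreducible_evM Z p q : irreducible_set Z ->
  (forall z, Z z -> ev z p * ev z q = 0) ->
  (forall z, Z z -> ev z p = 0) \/ (forall z, Z z -> ev z q = 0).
Proof.
move=> [_ irrZ] pq.
have Zpq : Z `<=` [set z | ev z p = 0] `|` [set z | ev z q = 0].
  by move=> z /pq /eqP; rewrite mulf_eq0 => /orP[] /eqP; [left|right].
by case: (irrZ _ _ (@closed_ev0 p) (@closed_ev0 q) Zpq); [left|right].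
Qed.

Definition independent_on Z (I : finType) (g : I -> {mpoly k[N]}) : Prop :=
  forall c : I -> k, (forall z, Z z -> \sum_i c i * ev z (g i) = 0) ->
  forall i, c i = 0.

(** In a relation between the [g_i p^t], restricting to [Z] kills the terms with
    [t > 0], so the coefficients for [t = 0] vanish; then a factor [p] can be
    cancelled, as the functions on an irreducible set have no zero divisors and
    [p] does not vanish on it. *)
Lemma independent_on_powers Z Z' (I : finType) (g : I -> {mpoly k[N]}) p T :
  irreducible_set Z' -> Z `<=` Z' -> independent_on Z g ->
  (forall z, Z z -> ev z p = 0) -> (exists2 z, Z' z & ev z p != 0) ->
  independent_on Z' (fun a : I * 'I_T => g a.1 * p ^+ a.2).
Proof.
move=> irrZ' ZZ' ig pZ [z0 Zz0 pz0].
suff H (c : I -> nat -> k) : (forall z, Z' z ->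
    \sum_(t < T) \sum_i c i t * (ev z (g i) * ev z p ^+ t) = 0) ->
    forall i t, (t < T)%N -> c i t = 0.
  move=> c c0 [i t]; pose c' i (n : nat) := oapp (fun t => c (i, t)) 0 (insub n).
  have c'E j (s : 'I_T) : c' j s = c (j, s) by rewrite /c' valK.
  rewrite -c'E; apply: H => // z Zz; rewrite -[RHS](c0 z Zz).
  rewrite exchange_big pair_big /=; apply: eq_bigr => -[j s] _ /=.
  by rewrite c'E /ev mevalM rmorphXn.
elim: T c => [//|T IH] c c0.
have cz i : c i 0%N = 0.
  apply: (ig (fun i => c i 0%N)) => z Zz; rewrite -[RHS](c0 z (ZZ' _ Zz)) big_ord_recl /=.
  rewrite [X in _ = _ + X]big1 ?addr0 => [|t _].
    by apply: eq_bigr => j _; rewrite mulr1.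
  by rewrite big1 // => j _; rewrite (pZ z Zz) exprS mul0r !mulr0.
have H : forall i t, (t < T)%N -> c i t.+1 = 0.
  apply: (IH (fun i t => c i t.+1)) => z Zz.
  pose q := \sum_(t < T) \sum_i c i t.+1 *: (g i * p ^+ t).
  have qE y : ev y q = \sum_(t < T) \sum_i c i t.+1 * (ev y (g i) * ev y p ^+ t).
    rewrite /ev /q rmorph_sum; apply: eq_bigr => t _.
    rewrite rmorph_sum; apply: eq_bigr => i _.
    by rewrite /= mevalZ mevalM rmorphXn.
  rewrite -qE; case: (@irreducible_evM Z' p q irrZ') => [y Zy||q0].
  - rewrite qE -[RHS](c0 y Zy) big_ord_recl /= [X in _ = X + _]big1 ?add0r.
      rewrite mulr_sumr; apply: eq_bigr => t _.
      rewrite mulr_sumr; apply: eq_bigr => i _.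
      by rewrite mulrCA exprS; congr (_ * _); rewrite mulrCA.
    by move=> i _; rewrite cz mul0r.
  - by move=> /(_ z0 Zz0) p0; rewrite p0 eqxx in pz0.
  - exact: q0.
by move=> i [|t] tT; [exact: cz|exact: H].
Qed.

Section Charts.
Variables (D : nat) (J : finType) (phi : J -> N.-tuple {mpoly k[D]}).
Hypothesis phiS : forall x, S x -> exists j (w : 'I_D -> k),
  forall i, (x : 'rV[k]_N) 0 i = (tnth (phi j) i).@[w].

Lemma msizeM_leS n (p q : {mpoly k[n]}) a b :
  (msize p <= a.+1)%N -> (msize q <= b.+1)%N -> (msize (p * q) <= (a + b).+1)%N.
Proof.
have [->|p0] := eqVneq p 0; first by rewrite mul0r msize0.
have [->|q0] := eqVneq q 0; first by rewrite mulr0 msize0.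
move=> pa qb; rewrite msizeM //.
have : (msize p + msize q <= a.+1 + b.+1)%N by exact: leq_add.
by rewrite addSn addnS; case: (_ + _)%N.
Qed.

Lemma msizeX_leS n (p : {mpoly k[n]}) a t :
  (msize p <= a.+1)%N -> (msize (p ^+ t) <= (a * t).+1)%N.
Proof.
move=> pa; elim: t => [|t IH]; first by rewrite expr0 msize1.
by rewrite exprS mulnS; exact: msizeM_leS.
Qed.

(** The [T^m] functions are the monomials, with exponents below [T], in [m]
    functions that separate the successive members of the chain; [e] bounds the
    total degree of these [m] functions in the charts. *)
Lemma chain_independent m (Z : nat -> set X) : irreducible_chain m Z ->
  exists e, forall T, exists (I : finType) (g : I -> {mpoly k[N]}),
    [/\ #|I| = (T ^ m)%N, independent_on (Z m) g &
        forall i j, (msize (g i \mPo phi j) <= (e * T).+1)%N].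
Proof.
elim: m => [|m IH] [irrZ ltZ].
  exists 0%N => T; exists unit, (fun=> 1); split; first by rewrite card_unit.
    have [_ [[z Zz] _]] := irrZ 0%N (leqnn _).
    move=> c /(_ z Zz); rewrite big_enum_val /= => c0 [].
    move: c0; rewrite (eq_bigr (fun=> c tt)) => [|i _]; last first.
      by rewrite /ev meval1 mulr1; case: (enum_val i).
    by rewrite sumr_const card_ord card_unit mulr1n.
  by move=> _ j; rewrite comp_mpoly1 msize1.
have [|e He] := IH; first by split=> i im; [apply: irrZ|apply: ltZ]; rewrite ltnW.
have [Zm Zn] := ltZ m (ltnSn m).
have [z Zz Nz] : exists2 z, Z m.+1 z & ~ Z m z.
  by apply: contrapT => H; apply: Zn => z Zz; apply: contrapT => Nz; apply: H; exists z.
have [cZ _] := irrZ m (leqnSn m).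
have [p pZ pz] := closed_separated cZ Nz.
exists (e + \max_j msize (p \mPo phi j))%N => T.
have [I [g [cI ig sg]]] := He T.
exists (I * 'I_T)%type, (fun a : I * 'I_T => g a.1 * p ^+ a.2); split.
- by rewrite card_prod card_ord cI -expnSr.
- apply: independent_on_powers ig pZ _ => //; last by exists z.
  by have [] := irrZ m.+1 (leqnn _).
- move=> [i t] j /=; rewrite rmorphM rmorphXn mulnDl.
  apply: msizeM_leS; first exact: sg.
  apply: leq_trans (msizeX_leS (a := \max_j msize (p \mPo phi j)) t _) _.
    by apply: leqW; exact: (leq_bigmax j).
  by rewrite ltnS leq_mul2l ltnW ?orbT.
Qed.

Lemma mnm_le_mdeg n (m : 'X_{1..n}) i : (m i <= mdeg m)%N.
Proof. by rewrite mdegE (bigD1 i) //= leq_addr. Qed.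

Lemma card_bmultinom n b : (#|{: 'X_{1..n < b}}| <= b ^ n)%N.
Proof.
pose f (m : 'X_{1..n < b}) : {ffun 'I_n -> 'I_b} :=
  [ffun i => Ordinal (leq_ltn_trans (mnm_le_mdeg m i) (bmdeg m))].
rewrite -[X in (_ <= X ^ _)%N]card_ord -[X in (_ <= _ ^ X)%N]card_ord -card_ffun.
apply: (leq_card f) => m m' /ffunP mm; apply/val_inj/mnmP => i.
by have := mm i; rewrite !ffunE => -[].
Qed.

(** If there were more functions than coefficients in all charts together, some
    linear combination would pull back to [0] in every chart, hence vanish on
    [S]. *)
Lemma independent_card Z (I : finType) (g : I -> {mpoly k[N]}) b :
  independent_on Z g -> (forall i j, (msize (g i \mPo phi j) <= b)%N) ->
  (#|I| <= #|J| * b ^ D)%N.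
Proof.
move=> ig sg.
suff : (#|I| <= #|{: J * 'X_{1..D < b}}|)%N.
  move/leq_trans; apply; rewrite card_prod.
  by rewrite leq_mul2l card_bmultinom orbT.
rewrite leqNgt; apply/negP => ltI.
pose K : finType := (J * 'X_{1..D < b})%type.
pose entry (i : I) (a : K) := (g i \mPo phi a.1)@_(bmnm a.2).
pose A := \matrix_(i < #|I|, a < #|K|) entry (enum_val i) (enum_val a).
have : kermx A != 0.
  rewrite -mxrank_eq0 mxrank_ker subn_eq0 -ltnNge.
  exact: leq_ltn_trans (rank_leq_col A) ltI.
move=> /rowV0Pn[v /sub_kermxP vA]; apply/negP; rewrite negbK.
pose c i := v 0 (enum_rank i).
have q0 j : \sum_i c i *: (g i \mPo phi j) = 0.
  apply/mpolyP => m; rewrite mcoeff0 raddf_sum /=.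
  case: (ltnP (mdeg m) b) => mb; last first.
    rewrite big1 // => i _; rewrite mcoeffZ memN_msupp_eq0 ?mulr0//.
    by apply: msize_mdeg_ge; exact: leq_trans (sg i j) mb.
  have := congr1 (fun M : 'rV__ => M 0 (enum_rank ((j, BMultinom mb) : K))) vA.
  rewrite !mxE => E; rewrite -[RHS]E [RHS](reindex (@enum_rank I)) /=; last first.
    exact/onW_bij/enum_rank_bij.
  apply: eq_bigr => i _.
  by rewrite mcoeffZ !mxE !enum_rankK /entry.
have c0 : forall i, c i = 0.
  apply: ig => z _; have [j [w wE]] := phiS (sub_spaceP z).
  have E p : ev z p = (p \mPo phi j).@[w].
    by rewrite comp_mpoly_meval; apply: meval_eq => i; rewrite wE.
  have := congr1 (meval w) (q0 j); rewrite rmorph0 rmorph_sum /= => E'; rewrite -[RHS]E'.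
  by apply: eq_bigr => i _; rewrite E mevalZ.
by apply/eqP/rowP => i; rewrite mxE -[i]enum_valK; exact: c0.
Qed.

Lemma chain_length m (Z : nat -> set X) : irreducible_chain m Z -> (m <= D)%N.
Proof.
move=> /chain_independent[e He]; rewrite leqNgt; apply/negP => Dm.
(* With [T] above this bound, [#|J| (e T + 1)^D < T^(D+1)]. *)
set a := (#|J| * e.+1 ^ D)%N; pose T := a.+1.
have [I [g [cI ig sg]]] := He T.
have := independent_card ig sg; rewrite cI leqNgt => /negP; apply.
apply: (@leq_trans (T * T ^ D)%N); last by rewrite -expnS leq_pexp2l.
apply: (@leq_trans (a * T ^ D).+1); last by rewrite mulSn -add1n leq_add2r expn_gt0.
rewrite ltnS /a -mulnA leq_mul2l -expnMn; apply/orP; right.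
case: (posnP D) => [->//|D0]; by rewrite leq_exp2r // mulSn -add1n leq_add2r.
Qed.

End Charts.
End Zariski.

(** * Parametrization of the commuting tuples *)

(** A nonscalar matrix, up to adding scalars and scaling, is one of these: its
    last entry can be made [0] and one of the three others [1]. *)
Definition direction (R : comPzRingType) (j : option bool) (u v : R) : 'M[R]_2 :=
  match j with
  | None => mx2 1 u v 0
  | Some true => mx2 u 1 v 0
  | Some false => mx2 u v 1 0
  end.

Section UpperBound.
Variable k : closedFieldType.
Local Open Scope classical_set_scope.
Add Ring kring : (comPz_ring_theory k).

Lemma commuting_mx2 (A B : 'M[k]_2) : A *m B = B *m A ->
  [/\ A 0 1 * B 1 0 = B 0 1 * A 1 0,
      (A 0 0 - A 1 1) * B 0 1 = (B 0 0 - B 1 1) * A 0 1 &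
      (A 0 0 - A 1 1) * B 1 0 = (B 0 0 - B 1 1) * A 1 0].
Proof.
move=> E; have e i j : (A *m B) i j = (B *m A) i j by rewrite E.
move: (e 0 0) (e 0 1) (e 1 0); rewrite !mulmx2E => e0 e1 e2.
split; apply/eqP; rewrite -subr_eq0; apply/eqP.
- have -> : A 0 1 * B 1 0 - B 0 1 * A 1 0 = A 0 0 * B 0 0 + A 0 1 * B 1 0
    - (B 0 0 * A 0 0 + B 0 1 * A 1 0) by fold_ring k; ring.
  by rewrite e0 subrr.
- have -> : (A 0 0 - A 1 1) * B 0 1 - (B 0 0 - B 1 1) * A 0 1 =
    A 0 0 * B 0 1 + A 0 1 * B 1 1 - (B 0 0 * A 0 1 + B 0 1 * A 1 1).
    by fold_ring k; ring.
  by rewrite e1 subrr.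
- have -> : (A 0 0 - A 1 1) * B 1 0 - (B 0 0 - B 1 1) * A 1 0 =
    - (A 1 0 * B 0 0 + A 1 1 * B 1 0 - (B 1 0 * A 0 0 + B 1 1 * A 1 0)).
    by fold_ring k; ring.
  by rewrite e2 subrr oppr0.
Qed.

(** If some member of the tuple is not scalar, all members are combinations of
    it and the identity; if all are scalar, any direction serves. *)
Lemma commuting_direction n (A : 'I_n -> 'M[k]_2) :
  (forall i j, A i *m A j = A j *m A i) ->
  exists (j : option bool) (u v : k) (y : 'I_n -> k),
    forall i, A i = (A i 1 1)%:M + y i *: direction j u v.
Proof.
move=> cA.
have eqM (B M : 'M[k]_2) y : M 1 1 = 0 -> B 0 0 - B 1 1 = y * M 0 0 ->
    B 0 1 = y * M 0 1 -> B 1 0 = y * M 1 0 -> B = (B 1 1)%:M + y *: M.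
  move=> M0 e0 e1 e2; apply: eq_mx2; rewrite !mxE /= ?mulr1n ?mulr0n ?add0r //.
    by rewrite -e0 addrC subrK.
  by rewrite M0 mulr0 addr0.
pose nz i := [|| A i 0 0 - A i 1 1 != 0, A i 0 1 != 0 | A i 1 0 != 0].
case: (pickP nz) => [i0 /or3P[]a0|nz0]; last 1 first.
  exists None, 0, 0, (fun=> 0) => i; have := nz0 i.
  rewrite /nz => /negbT; rewrite !negb_or !negbK => /and3P[/eqP e0 /eqP e1 /eqP e2].
  by apply: eqM; rewrite ?mul0r //= mxE.
- exists None, (A i0 0 1 / (A i0 0 0 - A i0 1 1)),
    (A i0 1 0 / (A i0 0 0 - A i0 1 1)), (fun i => A i 0 0 - A i 1 1) => i.
  have [_ e1 e2] := commuting_mx2 (cA i0 i).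
  apply: eqM; rewrite mxE //= ?mulr1 // mulrA.
    by rewrite -e1 mulrAC divff ?mul1r.
  by rewrite -e2 mulrAC divff ?mul1r.
- exists (Some true), ((A i0 0 0 - A i0 1 1) / A i0 0 1), (A i0 1 0 / A i0 0 1),
    (fun i => A i 0 1) => i.
  have [e0 e1 _] := commuting_mx2 (cA i0 i).
  apply: eqM; rewrite mxE //= ?mulr1 // mulrA.
    by rewrite [A i 0 1 * _]mulrC e1 mulfK.
  by rewrite -e0 mulrAC divff ?mul1r.
- exists (Some false), ((A i0 0 0 - A i0 1 1) / A i0 1 0), (A i0 0 1 / A i0 1 0),
    (fun i => A i 1 0) => i.
  have [e0 _ e2] := commuting_mx2 (cA i0 i).
  apply: eqM; rewrite mxE //= ?mulr1 // mulrA.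
    by rewrite [A i 1 0 * _]mulrC e2 mulfK.
  by rewrite [A i 1 0 * _]mulrC e0 mulfK.
Qed.

Definition chart_mx n (j : option bool) (i : 'I_n) :
    'M[{mpoly k[n + n + 2]}]_2 :=
  ('X_(lshift 2 (lshift n i)))%:M + 'X_(lshift 2 (rshift n i)) *:
    direction j 'X_(rshift (n + n) ord0) 'X_(rshift (n + n) ord_max).

Definition chart n (j : option bool) :
    (n * (2 * 2)).-tuple {mpoly k[n + n + 2]} :=
  [tuple mxvec (\matrix_i mxvec (chart_mx j i)) 0 a | a < n * (2 * 2)].

Lemma chart_surjective n (x : 'rV[k]_(n * (2 * 2))) : @commuting_GL2 k n x ->
  exists (j : option bool) (w : 'I_(n + n + 2) -> k),
    forall a, x 0 a = (tnth (chart n j) a).@[w].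
Proof.
move=> [_ cx]; have [j [u [v [y xE]]]] := commuting_direction cx.
pose w' : 'rV[k]_(n + n + 2) :=
  row_mx (row_mx (\row_i tuple_mx x i 1 1) (\row_i y i))
    (\row_(i < 2) if i == ord0 then u else v).
exists j, (fun i => w' 0 i) => a.
rewrite tnth_mktuple; case/mxvec_indexP: a => i a; case/mxvec_indexP: a => p q.
rewrite -tuple_mxE {1}xE !mxvecE !mxE /= mxvecE.
rewrite !mxE mevalD mevalM mevalXU row_mxEl row_mxEr mxE.
rewrite mevalMn mevalXU row_mxEl row_mxEl mxE.
congr (_ *+ _ + _ * _); first by rewrite tuple_mxE.
have Eu : ('X_(rshift (n + n) ord0)).@[fun i => w' 0 i] = u.
  by rewrite mevalXU row_mxEr mxE.
have Ev : ('X_(rshift (n + n) ord_max)).@[fun i => w' 0 i] = v.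
  by rewrite mevalXU row_mxEr mxE.
by case: j {xE} => [[]|]; rewrite /direction !mxE; case: ifP => _; case: ifP => _;
  rewrite ?Eu ?Ev ?meval1 ?meval0.
Qed.

End UpperBound.

(** * A chain of maximal length *)

Section Curves.
Variables (k : closedFieldType) (N : nat) (S : set (affine_space k N)).
Local Open Scope classical_set_scope.
Local Notation X := (sub_space S).

Lemma meval_curve (G : 'I_N -> {poly k}) (p : {mpoly k[N]}) :
  exists P : {poly k}, forall t, P.[t] = p.@[fun i => (G i).[t]].
Proof.
exists (\sum_(m <- msupp p) (p@_m)%:P * \prod_i G i ^+ m i) => t.
rewrite mevalE horner_sum; apply: eq_bigr => m _.
rewrite hornerM hornerC horner_prod; congr (_ * _).
by apply: eq_bigr => i _; rewrite horner_exp.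
Qed.

(** If neither of two closed sets contains [Y], pick in [Y] one point outside
    each of them.  On a curve through both points, each of the two sets is left
    outside a finite set of parameters, and the field is infinite. *)
Lemma irreducible_closure (Y : set X) : Y !=set0 ->
  (forall a b, Y a -> Y b -> exists (G : 'I_N -> {poly k}) (W : {poly k}),
    [/\ W != 0,
     forall i, (G i).[0] = (val a : 'rV[k]_N) 0 i,
     forall i, (G i).[1] = (val b : 'rV[k]_N) 0 i &
     forall t, W.[t] != 0 -> exists2 y, Y y &
       forall i, (G i).[t] = (val y : 'rV[k]_N) 0 i]) ->
  irreducible_set (closure Y).
Proof.
move=> [y0 Yy0] curve; split; first by exists y0; exact: subset_closure.
move=> A B cA cB YAB.
have clY F : closed F -> ~ closure Y `<=` F -> exists2 y, Y y & ~ F y.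
  move=> cF H; apply: contrapT => H'; apply: H; rewrite closureE.
  apply: smallest_sub => // y Yy; apply: contrapT => Fy.
  by apply: H'; exists y.
apply: contrapT => /not_orP[/(clY _ cA)[a Ya Aa] /(clY _ cB)[b Yb Bb]].
have [p pA pa] := closed_separated cA Aa.
have [q qB qb] := closed_separated cB Bb.
have [G [W [W0 Ga Gb Gy]]] := curve a b Ya Yb.
have [P PE] := meval_curve G p; have [R RE] := meval_curve G q.
have evE r (z : X) t : (forall i, (G i).[t] = (val z : 'rV[k]_N) 0 i) ->
    r.@[fun i => (G i).[t]] = ev z r.
  by move=> Gz; apply: meval_eq.
have P0 : P != 0.
  by apply: contraNneq pa => P0; rewrite -(evE _ _ _ Ga) -PE P0 horner0.
have R0 : R != 0.
  by apply: contraNneq qb => R0; rewrite -(evE _ _ _ Gb) -RE R0 horner0.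
have /closed_nonrootP[t] : P * R * W != 0 by rewrite !mulf_neq0.
rewrite !rootM !negb_or => /andP[/andP[Pt Rt] Wt].
have [y Yy yE] := Gy t Wt.
have [Ay|By] := YAB y (subset_closure Yy).
  by move: Pt; rewrite /root PE (evE _ _ _ yE) pA ?eqxx.
by move: Rt; rewrite /root RE (evE _ _ _ yE) qB ?eqxx.
Qed.

End Curves.

Section Flag.
Variables (k : closedFieldType) (m : nat).
Local Open Scope classical_set_scope.
Local Notation S := (@commuting_GL2 k m.+1).
Local Notation X := (sub_space S).

(** The chart whose parameters are regular functions of the tuple: with
    [M = [[p_1, p_2], [p_3, 0]]], the first matrix is [p_0 + M] and matrix
    [j + 1] is [p_(4+j) + p_(4+m+j) M].  Parameters are indexed by [nat] to
    make the flag of coordinate subspaces easy to express, and are taken in any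
    ring to allow polynomial curves. *)
Definition flag_mx (R : comPzRingType) (p : nat -> R) (i : 'I_m.+1) : 'M[R]_2 :=
  let M := mx2 (p 1%N) (p 2) (p 3) 0 in
  if unlift ord0 i is Some j
  then (p (4 + j)%N)%:M + p (4 + m + j)%N *: M else (p 0%N)%:M + M.

(** Invertible tuples for which [p_2] is invertible; the latter makes
    [p_(4+m+j)] a function of the tuple. *)
Definition flag_domain (p : nat -> k) : Prop :=
  p 2 != 0 /\ forall i, \det (flag_mx p i) != 0.

Lemma map_flag_mx (R R' : comPzRingType) (f : {rmorphism R -> R'}) p i :
  map_mx f (flag_mx p i) = flag_mx (fun l => f (p l)) i.
Proof.
have fM : map_mx f (mx2 (p 1%N) (p 2) (p 3) 0) =
    mx2 (f (p 1%N)) (f (p 2)) (f (p 3)) 0.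
  by apply: eq_mx2; rewrite !mxE //= rmorph0.
rewrite /flag_mx; case: unlift => [j|].
  by rewrite map_mxD map_scalar_mx map_mxZ fM.
by rewrite map_mxD map_scalar_mx fM.
Qed.

Lemma flag_mx_comm (p : nat -> k) i j :
  flag_mx p i *m flag_mx p j = flag_mx p j *m flag_mx p i.
Proof.
pose M := mx2 (p 1%N) (p 2) (p 3) 0.
have H l : exists x y, flag_mx p l = x%:M + y *: M.
  rewrite /flag_mx -/M; case: unlift => [l'|].
    by exists (p (4 + l')%N), (p (4 + m + l')%N).
  by exists (p 0%N), 1; rewrite scale1r.
have [x [y ->]] := H i; have [x' [y' ->]] := H j.
rewrite !mulmxDl !mulmxDr -!scalemxAl -!scalemxAr [y *: (y' *: _)]scalerA.
rewrite mulrC -scalerA -!scalar_mxM [x * x']mulrC !scalar_mxC.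
by rewrite -!addrA; congr (_ + _); rewrite addrCA.
Qed.

Lemma flag_point (p : nat -> k) : flag_domain p -> S (untuple (flag_mx p)).
Proof.
move=> [_ dp]; split=> [i|i j]; rewrite !untupleK; last exact: flag_mx_comm.
by rewrite unitmxE unitfE.
Qed.

Definition flag_pt p (dp : flag_domain p) : X :=
  @exist (affine_space k (m.+1 * (2 * 2))) (fun x => x \in S)
    (untuple (flag_mx p)) (mem_set (flag_point dp)).

(** The base point of the flag: the first matrix is [[0, 1], [1, 0]] and the
    others are the identity. *)
Definition flag_origin (i : nat) : k := ((2 <= i < 4 + m)%N : nat)%:R.

Lemma flag_originS d : flag_origin (4 + d) = (d < m)%N%:R.
Proof. by rewrite /flag_origin ltn_add2l. Qed.

Lemma flag_origin_domain : flag_domain flag_origin.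
Proof.
split=> [|i]; first exact: oner_neq0.
rewrite det_mx2 /flag_mx; case: unliftP => [j _|_].
  rewrite -addnA !flag_originS ltn_ord ltnNge leq_addr /=.
  rewrite !mxE /=.
  by rewrite !mul0r !addr0 mulr0n mul0r subr0 mulr1n mulr1 oner_neq0.
by rewrite !mxE /= !mulr1n !mulr0n !add0r mulr0 mulr1 sub0r oppr_eq0 oner_neq0.
Qed.

Definition flag_stratum (d : nat) : set X :=
  [set z | exists p, [/\ flag_domain p, forall l, (d <= l)%N -> p l = flag_origin l &
    val z = untuple (flag_mx p) :> 'rV[k]_(m.+1 * (2 * 2))]].

Definition flag_line (p p' : nat -> k) (l : nat) : {poly k} :=
  (p l)%:P + 'X * (p' l - p l)%:P.

Lemma flag_lineE p p' l t : (flag_line p p' l).[t] = p l + t * (p' l - p l).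
Proof. by rewrite hornerD hornerC hornerM hornerX hornerC. Qed.

(** Its nonzeros are the parameters at which the line through [p] and [p'] stays
    in the domain of the chart. *)
Definition flag_disc (p p' : nat -> k) : {poly k} :=
  flag_line p p' 2 * \prod_i \det (flag_mx (flag_line p p') i).

Lemma flag_mx_ext (R : comPzRingType) (p p' : nat -> R) : p =1 p' ->
  forall i, flag_mx p i = flag_mx p' i.
Proof. by move=> pp i; rewrite /flag_mx !pp; case: unlift => [j|] //; rewrite !pp. Qed.

Lemma flag_mx_line p p' t i a b : (flag_mx (flag_line p p') i a b).[t] =
  flag_mx (fun l => p l + t * (p' l - p l)) i a b.
Proof.
have := map_flag_mx (horner_eval t) (flag_line p p') i.
move/matrixP/(_ a b); rewrite mxE /= /horner_eval => ->.
congr (fun_of_matrix _ a b); apply: flag_mx_ext => l.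
by rewrite flag_lineE.
Qed.

Lemma flag_discP p p' t : (flag_disc p p').[t] != 0 <->
  flag_domain (fun l => p l + t * (p' l - p l)).
Proof.
have E i : (\det (flag_mx (flag_line p p') i)).[t] =
    \det (flag_mx (fun l => p l + t * (p' l - p l)) i).
  by rewrite !det_mx2 hornerD hornerN !hornerM !flag_mx_line.
rewrite hornerM flag_lineE mulf_eq0 negb_or horner_prod; split.
  by move=> /andP[p2 /prodf_neq0 H]; split=> // i; rewrite -E; exact: H.
move=> [p2 H]; rewrite p2 /=; apply/prodf_neq0 => i _.
by rewrite E.
Qed.

Lemma flag_disc_neq0 p p' : flag_domain p -> flag_disc p p' != 0.
Proof.
move=> [p2 dp]; have : (flag_disc p p').[0] != 0.
  apply/flag_discP; split=> [|i]; first by rewrite mul0r addr0.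
  rewrite (flag_mx_ext (p' := p)) // => l.
  by rewrite mul0r addr0.
by apply: contraNneq => ->; rewrite horner0.
Qed.

Lemma flag_stratum_irreducible d : irreducible_set (closure (flag_stratum d)).
Proof.
have pt p (dp : flag_domain p) : exists z : X,
    val z = untuple (flag_mx p) :> 'rV[k]_(m.+1 * (2 * 2)).
  by exists (flag_pt dp).
apply: irreducible_closure.
  have [z zE] := pt _ flag_origin_domain.
  by exists z, flag_origin; split=> //; exact: flag_origin_domain.
move=> a b [p [dp pd aE]] [p' [dp' pd' bE]].
pose G (l : 'I_(m.+1 * (2 * 2))) : {poly k} :=
  mxvec (\matrix_i mxvec (flag_mx (flag_line p p') i)) 0 l.
have GE t l : (G l).[t] = (untuple (flag_mx (fun l => p l + t * (p' l - p l))) :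
    'rV[k]_(m.+1 * (2 * 2))) 0 l.
  rewrite /G /untuple; case/mxvec_indexP: l => i l; case/mxvec_indexP: l => c e.
  by rewrite !mxvecE !mxE !mxvecE flag_mx_line.
exists G, (flag_disc p p'); split.
- exact: flag_disc_neq0.
- move=> i; rewrite GE aE; congr (fun_of_matrix _ 0 i); apply: eq_untuple.
  by apply: flag_mx_ext => l; rewrite mul0r addr0.
- move=> i; rewrite GE bE; congr (fun_of_matrix _ 0 i); apply: eq_untuple.
  by apply: flag_mx_ext => l; rewrite mul1r addrC subrK.
- move=> t /flag_discP dt; have [z zE] := pt _ dt; exists z; last first.
    by move=> i; rewrite GE zE.
  exists (fun l => p l + t * (p' l - p l)); split=> // l dl.
  by rewrite pd // pd' // subrr mulr0 addr0.
Qed.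

Definition entry_mpoly (i : 'I_m.+1) (a b : 'I_2) : {mpoly k[m.+1 * (2 * 2)]} :=
  'X_(mxvec_index i (mxvec_index a b)).

(** The equations of the flag make sense on the closure of the image.  For the
    last [m] parameters, whose value at the origin is [0], the polynomial is an
    entry equal to [p_2 p_d]. *)
Lemma flag_coordinate d : (d < 4 + m + m)%N ->
  exists f : {mpoly k[m.+1 * (2 * 2)]}, forall p, flag_domain p ->
    f.@[untuple (flag_mx p) 0] = 0 <-> p d = flag_origin d.
Proof.
have E p i a b : (entry_mpoly i a b).@[untuple (flag_mx p) 0] = flag_mx p i a b.
  by rewrite mevalXU -tuple_mxE untupleK.
have e0 p : flag_mx p ord0 = (p 0%N)%:M + mx2 (p 1%N) (p 2) (p 3) 0 :> 'M[k]_2.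
  by rewrite /flag_mx unlift_none.
have eS p j : flag_mx p (lift ord0 j) =
    (p (4 + j)%N)%:M + p (4 + m + j)%N *: mx2 (p 1%N) (p 2) (p 3) 0 :> 'M[k]_2.
  by rewrite /flag_mx liftK.
have eqB (a b : k) : a - b = 0 <-> a = b.
  by split=> [/eqP|->]; rewrite ?subr_eq0 ?subrr // => /eqP.
case: d => [|[|[|[|d]]]] dm.
- exists (entry_mpoly ord0 1 1) => p _; rewrite E e0 !mxE /= mulr1n addr0.
  by rewrite /flag_origin.
- exists (entry_mpoly ord0 0 0 - entry_mpoly ord0 1 1) => p _.
  by rewrite mevalB !E e0 !mxE /= !mulr1n addr0 [p 0%N + _]addrC addrK.
- exists (entry_mpoly ord0 0 1 - 1) => p _.
  by rewrite mevalB meval1 !E e0 !mxE /= mulr0n add0r; exact: eqB.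
- exists (entry_mpoly ord0 1 0 - 1) => p _.
  by rewrite mevalB meval1 !E e0 !mxE /= mulr0n add0r; exact: eqB.
have [dm'|md] := ltnP d m.
  exists (entry_mpoly (lift ord0 (Ordinal dm')) 1 1 - 1) => p _.
  rewrite mevalB meval1 E eS !mxE /= mulr1n mulr0 addr0.
  by rewrite [flag_origin _]flag_originS dm'; exact: eqB.
have dm' : (d - m < m)%N by rewrite ltn_subLR // -(ltn_add2l 4) addnA.
exists (entry_mpoly (lift ord0 (Ordinal dm')) 0 1) => p [p2 _].
rewrite E eS !mxE /= mulr0n add0r -addnA subnKC //.
rewrite [flag_origin _]flag_originS ltnNge md /=.
by split=> [/eqP|->]; rewrite ?mul0r // mulf_eq0 (negbTE p2) orbF => /eqP.
Qed.

Lemma flag_chain : irreducible_chain (4 + m + m) (fun d => closure (flag_stratum d)).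
Proof.
split=> [d _|d dm].
  by split; [exact: closed_closure|exact: flag_stratum_irreducible].
split.
  apply: closureS => z [p [dp pd zE]]; exists p; split=> // l /ltnW; exact: pd.
have [f fE] := flag_coordinate dm.
(* A point of the next stratum off the present one: move the origin along
   coordinate [d], staying in the domain. *)
pose p' l := flag_origin l + (l == d)%:R.
have : flag_disc flag_origin p' * 'X != 0.
  by rewrite mulf_neq0 ?polyX_eq0 // flag_disc_neq0 //; exact: flag_origin_domain.
move=> /closed_nonrootP[t]; rewrite rootM negb_or => /andP[dt].
rewrite /root hornerX => t0.
have {dt} : (flag_disc flag_origin p').[t] != 0 by [].
move=> /flag_discP; set p := (fun l => _) => dp.
have pE l : p l = flag_origin l + t * (l == d)%:R.
  by rewrite /p /p' [flag_origin l + _ - _]addrC addKr.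
pose z : X := flag_pt dp.
have Yz : flag_stratum d.+1 z.
  exists p; split=> // l dl; rewrite pE; case: eqP => [ld|]; last by rewrite mulr0 addr0.
  by rewrite ld ltnn in dl.
move=> /(_ z (subset_closure Yz)) Zz.
have cf := @closed_ev0 _ _ S f.
have : ev z f = 0.
  have : closure (flag_stratum d) `<=` [set y | ev y f = 0].
    rewrite closureE; apply: smallest_sub => // y [p1 [dp1 p1d yE]] /=.
    by rewrite /ev yE; apply/fE => //; exact: p1d.
  exact.
move=> /(fE p dp)/eqP; rewrite pE eqxx mulr1 -subr_eq0 addrC addKr.
exact/negP.
Qed.

End Flag.

Lemma commuting_dimension (k : closedFieldType) n : (0 < n)%N ->
  has_dimension (commuting_variety k n) (2 * n + 2).
Proof.
move=> n0; split.
  case: n n0 => // m _; rewrite (_ : 2 * m.+1 + 2 = 4 + m + m)%N.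
    by eexists; exact: flag_chain.
  by rewrite mul2n -addnn !addnS !addSn addn0.
have -> : (2 * n + 2 = n + n + 2)%N by rewrite mul2n -addnn.
move=> m Z; apply: (chain_length (phi := chart k n)); exact: chart_surjective.
Qed.

Theorem theorem4p10 (k : closedFieldType) (k_char0 : [pchar k] =i pred0)
    (n : nat) (n_ge1 : (1 <= n)%N) :
  (exists P : {poly int},
     map_poly intr P =
       (1 / 2)%:P * 'X * ('X ^+ 2 - 1) *
       (2 * ('X ^+ 2 - 'X) ^+ (n - 1) - 2 * ('X - 1) ^+ (n - 1)
        + ('X - 1) * ('X ^+ 2 - 1) ^+ (n - 1) + ('X - 1) ^+ (2 * n - 1))
       :> {poly rat} /\
     virtual_class (commuting_variety k n) = int_poly_eval P (lefschetz k)) /\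
  has_dimension (commuting_variety k n) (2 * n + 2)%N.
Proof.
split; last exact: commuting_dimension.
have k2 : (2%:R : k) != 0 by rewrite ((pcharf0P k).1 k_char0).
exists (commuting_class 'X n); split; last exact: virtual_class_commutingE.
case: n n_ge1 => // m _; rewrite commuting_class_poly_rat.
by rewrite mulnS subn1.
Qed.
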